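(* Let $(a_1,\ldots,a_d)$ be an SD-tuple, and for each $1\le i\le d$ let $K_i\subseteq\mathbb{R}^{n_i}$ be a nonempty compact convex set with $K_i=-K_i$. Then $$\prod_{i=1}^d \mathcal{W}^{\min}(K_i)\subseteq \mathcal{W}^{\min}\Big(\prod_{i=1}^d a_iK_i\Big).$$ Consequently, it also holds that $$\mathcal{W}^{\max}\Big(\prod_{i=1}^d K_i\Big)\subseteq \mathcal{W}^{\min}\Big(\prod_{i=1}^d \theta(K_i)\,a_iK_i\Big)$$ and $$\theta\Big(\prod_{i=1}^d K_i\Big)\le \inf_{a\text{ is an SD-tuple of length }d}\Big[\max_{1\le i\le d} a_i\,\theta(K_i)\Big]\le \mathcal{U}(d)\cdot\max_{1\le i\le d}\theta(K_i).$$
   Context: Let $\mathcal{M}^d=\bigcup_{n\ge1}M_n^d$, where $M_n^d$ is the set of $d$-tuples of complex $n\times n$ matrices. A tuple of operators is normal if its members are normal and commute with each other; $\sigma(N)$ denotes the joint spectrum of a normal tuple. $Y\in\mathcal{B}(K)^d$ is a dilation of $X\in\mathcal{B}(H)^d$ if there is an isometry $V:H\to K$ with $X_i=V^*Y_iV$ for all $i$. For $T\in\mathcal{B}(H)^d$, $\mathcal{W}_1(T)=\{(\psi(T_1),\ldots,\psi(T_d)):\psi\text{ a state on }\mathcal{B}(H)\}$. For a compact convex set $K\subseteq\mathbb{C}^d$ (or $K\subseteq\mathbb{R}^d\subseteq\mathbb{C}^d$), $\mathcal{W}^{\min}(K)$ is the set of $X\in\mathcal{M}^d$ having a normal dilation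 $N$ with $\sigma(N)\subseteq K$, and $\mathcal{W}^{\max}(K)=\{X\in\mathcal{M}^d:\mathcal{W}_1(X)\subseteq K\}$. The product of subsets $\mathcal{S}^j=\bigcup_n\mathcal{S}^j_n$ of matrix universes is the graded product $\prod_j\mathcal{S}^j:=\bigcup_{n\ge1}\prod_j\mathcal{S}^j_n$ (concatenation of tuples of matrices of the same size). For nonempty compact convex $K$, $\theta(K):=\inf\{C>0:\mathcal{W}^{\max}(K)\subseteq C\cdot\mathcal{W}^{\min}(K)\}$. $\Delta_n\subseteq\mathbb{R}^n$ is the convex hull of $0$ and the standard basis vectors, and $\diamond_n$ is the closed $\ell^1$ unit ball of $\mathbb{R}^n$. A tuple $(a_1,\ldots,a_d)$ of positive numbers is an SD-tuple if for every $n\in\mathbb{Z}^+$, $\mathcal{W}^{\max}(\Delta_n^d)\subseteq\mathcal{W}^{\min}\big(\prod_{j=1}^d a_j\cdot\diamond_n\big)$. Set $\mathcal{U}(d):=\inf\{C>0:(C,\ldots,C)\text{ is an SD-tuple of length }d\}$. *)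

(* Defs.v *)
From HB Require Import structures.
From mathcomp Require Import all_boot all_order all_algebra.
From mathcomp Require Import sesquilinear complex.
From mathcomp Require Import all_classical all_reals all_analysis.

Set Implicit Arguments.
Unset Strict Implicit.
Unset Printing Implicit Defensive.

Import Order.TTheory GRing.Theory Num.Theory numFieldNormedType.Exports.
Local Open Scope classical_set_scope.
Local Open Scope ring_scope.

(* The inner product is linear in its first argument. *)
Record hilbert (R : realType) := Hilbert {
  hilbert_sort :> completeNormedModType R[i];
  inner : {dot hilbert_sort for @Num.conj R[i]};
  inner_norm : forall x, inner x x = `|x| ^+ 2 }.

Definition bounded_op (R : realType) (H : hilbert R) : set (H -> H) :=
  [set T | linear T /\ continuous T].

Definition adjoint_op (R : realType) (H : hilbert R) (S T : H -> H) : Prop :=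
  forall x y, inner H (S x) y = inner H x (T y).

(* The adjoint is unique, so that "some adjoint" is "the adjoint"; it exists
   for every bounded operator. *)
Definition normal_tuple (R : realType) (H : hilbert R) (d : nat)
    (N : 'I_d -> H -> H) : Prop :=
  [/\ forall i, bounded_op (N i),
      forall i, exists2 T, adjoint_op (N i) T & N i \o T = T \o N i
    & forall i j, N i \o N j = N j \o N i].

(* Unital C*-subalgebras of B(H); the last clause is closedness for the
   operator norm. *)
Definition cstar_subalgebra (R : realType) (H : hilbert R)
    (A : set (H -> H)) : Prop :=
  [/\ A `<=` @bounded_op R H,
      A idfun,
      forall (c : R[i]) S T, A S -> A T -> A (fun x => c *: S x + T x),
      forall S T, A S -> A T -> A (S \o T)
    & (forall S T, A S -> adjoint_op S T -> A T) /\
      (forall T, (forall e : R[i], 0 < e ->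
           exists2 S, A S & forall x, `|S x - T x| <= e * `|x|) -> A T)].

Definition cstar_generated (R : realType) (H : hilbert R) (d : nat)
    (N : 'I_d -> H -> H) : set (H -> H) :=
  smallest (@cstar_subalgebra R H) (range N).

(* The values of chi outside of A are irrelevant. *)
Definition character (R : realType) (H : hilbert R) (A : set (H -> H))
    (chi : (H -> H) -> R[i]) : Prop :=
  [/\ chi idfun = 1,
      forall (c : R[i]) S T, A S -> A T ->
        chi (fun x => c *: S x + T x) = c * chi S + chi T
    & forall S T, A S -> A T -> chi (S \o T) = chi S * chi T].

(* Joint spectrum of a normal tuple: the image of the Gelfand spectrum of the
   commutative unital C*-algebra generated by N. *)
Definition joint_spectrum (R : realType) (H : hilbert R) (d : nat)
    (N : 'I_d -> H -> H) : set 'rV[R[i]]_d :=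
  [set l | exists2 chi, character (cstar_generated N) chi &
           forall i, l 0 i = chi (N i)].

(* The Euclidean inner product on C^n, linear in its first argument (the
   library norm on column vectors is the sup norm). *)
Definition cdot (R : realType) (n : nat) (x y : 'cV[R[i]]_n) : R[i] :=
  \sum_k x k 0 * Num.conj (y k 0).

(* X_i = V^* N_i V for some isometry V : C^n -> H; Vs stands for V^*. *)
Definition dilation (R : realType) (d n : nat) (X : 'I_d -> 'M[R[i]]_n)
    (H : hilbert R) (N : 'I_d -> H -> H) : Prop :=
  exists (V : 'cV[R[i]]_n -> H) (Vs : H -> 'cV[R[i]]_n),
    [/\ linear V,
        forall x, inner H (V x) (V x) = cdot x x,
        forall x h, inner H (V x) h = cdot x (Vs h)
      & forall i x, X i *m x = Vs (N i (V x))].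

(* A subset of the disjoint union over n >= 1 of the sets of d-tuples of
   n x n matrices; S n is its part made of matrices of size n.+1. *)
Definition matrix_set (R : realType) (d : nat) : Type :=
  forall n : nat, set ('I_d -> 'M[R[i]]_n.+1).

Definition msubset (R : realType) (d : nat) (S T : matrix_set R d) : Prop :=
  forall n, S n `<=` T n.

Definition mscale (R : realType) (d : nat) (C : R) (S : matrix_set R d) :
    matrix_set R d :=
  fun n => [set (fun i => (C%:C)%C *: X i) | X in S n].

(* tagnat.Rank j k is the position in the concatenation of the k-th entry of
   the j-th tuple. *)
Definition mprod (R : realType) (d : nat) (n_ : 'I_d -> nat)
    (S : forall j, matrix_set R (n_ j)) : matrix_set R (\sum_j n_ j) :=
  fun n => [set X | forall j, S j n (fun k => X (tagnat.Rank j k))].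

Definition state (R : realType) (n : nat)
    (psi : {scalar 'M[R[i]]_n.+1}) : Prop :=
  (forall A : 'M[R[i]]_n.+1, 0 <= psi ((map_mx Num.conj A)^T *m A)) /\
  psi 1%:M = 1.

Definition W1 (R : realType) (d n : nat) (X : 'I_d -> 'M[R[i]]_n.+1) :
    set 'rV[R[i]]_d :=
  [set \row_i psi (X i) | psi in @state R n].

Definition Wmin (R : realType) (d : nat) (K : set 'rV[R[i]]_d) :
    matrix_set R d :=
  fun n => [set X | exists (H : hilbert R) (N : 'I_d -> H -> H),
    [/\ normal_tuple N, joint_spectrum N `<=` K & dilation X N]].

Definition Wmax (R : realType) (d : nat) (K : set 'rV[R[i]]_d) :
    matrix_set R d :=
  fun n => [set X | W1 X `<=` K].

(* Extended-real infimum: +oo if no constant is admissible. *)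
Definition theta (R : realType) (d : nat) (K : set 'rV[R[i]]_d) : \bar R :=
  ereal_inf [set C%:E | C in
    [set C : R | 0 < C /\ msubset (Wmax K) (mscale C (Wmin K))]].

(* R^d as a subset of C^d. *)
Definition cplx (R : realType) (d : nat) (K : set 'rV[R]_d) :
    set 'rV[R[i]]_d :=
  [set map_mx (fun t : R => (t%:C)%C) x | x in K].

Definition scale_set (R : realType) (d : nat) (c : R) (K : set 'rV[R]_d) :
    set 'rV[R]_d :=
  [set c *: x | x in K].

Definition prod_set (R : realType) (d : nat) (n_ : 'I_d -> nat)
    (K : forall j, set 'rV[R]_(n_ j)) : set 'rV[R]_(\sum_j n_ j) :=
  [set x | forall j, K j (submxrow x j)].

Definition Delta (R : realType) (n : nat) : set 'rV[R]_n :=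
  smallest (fun A : set 'rV[R]_n => convex_set A)
    ([set 0] `|` range (fun k : 'I_n => delta_mx 0 k : 'rV[R]_n)).

Definition diamond (R : realType) (n : nat) : set 'rV[R]_n :=
  [set x | \sum_k `|x 0 k| <= 1].

Definition SD_tuple (R : realType) (d : nat) (a : 'I_d -> R) : Prop :=
  (forall j, 0 < a j) /\
  forall n : nat, (0 < n)%N ->
    msubset (Wmax (cplx (prod_set (fun _ : 'I_d => @Delta R n))))
            (Wmin (cplx (prod_set
              (fun j : 'I_d => scale_set (a j) (@diamond R n))))).

Definition SD_constant (R : realType) (d : nat) : \bar R :=
  ereal_inf [set C%:E | C in
    [set C : R | 0 < C /\ SD_tuple (fun _ : 'I_d => C)]].

(* Main.v *)
Require Import Defs.
From HB Require Import structures.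
From mathcomp Require Import all_boot all_order all_algebra.
From mathcomp Require Import sesquilinear complex spectral.
From mathcomp Require Import all_classical all_reals all_analysis.
From mathcomp Require Import ring lra.
Import Order.TTheory GRing.Theory Num.Theory numFieldNormedType.Exports.
Local Open Scope classical_set_scope.
Local Open Scope ring_scope.

(* A matrix tuple X lies in W^min(K), for K compact in R^d, iff it has a finite
   representation X_i = sum_k lam_k,i w_k w_k^* with lam_k in K and
   sum_k w_k w_k^* = 1.  Given such representations of X^1, ..., X^d, pad them to
   the same number m of terms: the rank one matrices w_k w_k^* of the j-th
   representation have joint numerical range in the simplex Delta_m, so the SD
   property dilates all of them at once to commuting selfadjoint operators M^j_k
   with spectrum in prod_j a_j diamond_m, and N^j = sum_k lam^j_k M^j_k dilates
   X^j with spectrum in a_j K_j, because K_j is convex and symmetric.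

   That a normal dilation gives a finite representation is a separation argument:
   by Caratheodory's theorem finite representations form a closed cone, and a
   separating functional is a linear pencil which is positive on K but not on the
   dilating tuple N.  The negative part of its spectrum at N yields a joint
   approximate eigenvalue of N outside K, and joint approximate eigenvalues belong
   to the joint spectrum, since taking limits along approximate eigenvectors is a
   character.  The same machinery (without Fuglede's theorem: joint approximate
   eigenvectors are improved one operator at a time by polynomials in that
   operator and its adjoint) shows that N is selfadjoint, and that the joint
   spectrum of linear combinations of M is the image of that of M.

   The dual description of finite representations also shows that the infimum
   theta(K) is attained, which reduces the inclusion for W^max to the one for
   W^min. *)

Set Implicit Arguments.
Unset Strict Implicit.
Unset Printing Implicit Defensive.

(** No Hilbert space is constructed: every dilation comes from a hypothesis or from the SD property,
    and finite powers of H enter only through a semidefinite form. Instead of a functional calculus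
    there is a penalty [p] that gets arbitrarily small relative to the squared norm ([approx_null]).
    Each eigenvalue condition is added to the penalty, and a further operator can be treated if it
    keeps the penalty under control ([seminvariant]). The obstacle is that, without Fuglede's
    theorem, N_i is not known to commute with the adjoint of N_k. So an adjoint occurs in the
    penalty only while its own operator is treated: the values of |N + c|^2 for c = 0, 1, i are
    fixed, N is recovered by polarization, and only the norm of (N - z) h is kept. The way back,
    from characters to approximate eigenvectors, is needed for linear images of the spectrum.
    Characters are purely algebraic here; a Neumann series in the algebra provides it. That theta(K)
    is finite is not assumed: a crude bound comes from coordinates along a spanning subset of K, at
    the cost of one factor a_j. *)

Local Notation Re := complex.Re.
Local Notation Im := complex.Im.

(** * Real and imaginary parts, squared modulus *)

Section ComplexNumbers.
Variable R : realType.
Implicit Types (c z : R[i]) (x : R).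

Lemma Re_add c z : Re (c + z) = Re c + Re z. Proof. by case: c z => [? ?] [? ?]. Qed.
Lemma Im_add c z : Im (c + z) = Im c + Im z. Proof. by case: c z => [? ?] [? ?]. Qed.
Lemma Re_opp c : Re (- c) = - Re c. Proof. by case: c. Qed.
Lemma Im_opp c : Im (- c) = - Im c. Proof. by case: c. Qed.
Lemma Re_mul c z : Re (c * z) = Re c * Re z - Im c * Im z.
Proof. by case: c z => [? ?] [? ?]. Qed.
Lemma Im_mul c z : Im (c * z) = Re c * Im z + Im c * Re z.
Proof. by case: c z => [? ?] [? ?]. Qed.
Lemma Re_conj c : Re (Num.conj c) = Re c. Proof. by case: c. Qed.
Lemma Im_conj c : Im (Num.conj c) = - Im c. Proof. by case: c. Qed.
Lemma Re_sum I (r : seq I) (P : pred I) (F : I -> R[i]) :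
  Re (\sum_(i <- r | P i) F i) = \sum_(i <- r | P i) Re (F i).
Proof. by rewrite (big_morph _ Re_add (erefl (Re 0))). Qed.
Lemma Im_sum I (r : seq I) (P : pred I) (F : I -> R[i]) :
  Im (\sum_(i <- r | P i) F i) = \sum_(i <- r | P i) Im (F i).
Proof. by rewrite (big_morph _ Im_add (erefl (Im 0))). Qed.
Lemma complex_eq c z : Re c = Re z -> Im c = Im z -> c = z.
Proof. by case: c z => [? ?] [? ?] /= -> ->. Qed.
Lemma conj_realC x : Num.conj (x%:C)%C = (x%:C)%C.
Proof. by apply: complex_eq; rewrite //= oppr0. Qed.
Lemma ge0_realE c : 0 <= c -> c = ((Re c)%:C)%C.
Proof. by rewrite lecE => /andP[/eqP c0 _]; apply: complex_eq; rewrite //= c0. Qed.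
Lemma ge0_Re c : 0 <= c -> 0 <= Re c.
Proof. by rewrite lecE => /andP[]. Qed.

(** Kept in [R], so that estimates are inequalities between reals, open to [lra] and [nra]. *)
Definition nsq c := Re c ^+ 2 + Im c ^+ 2.

Lemma nsq_ge0 c : 0 <= nsq c. Proof. by rewrite addr_ge0 ?sqr_ge0. Qed.
Lemma nsq_eq0 c : nsq c = 0 -> c = 0.
Proof.
move/eqP; rewrite paddr_eq0 ?sqr_ge0// !sqrf_eq0 => /andP[/eqP r0 /eqP i0].
by apply: complex_eq; rewrite ?r0 ?i0.
Qed.
Lemma nsqM c z : nsq (c * z) = nsq c * nsq z.
Proof. by rewrite /nsq Re_mul Im_mul; ring. Qed.
Lemma nsqR x : nsq (x%:C)%C = x ^+ 2. Proof. by rewrite /nsq /= expr0n addr0. Qed.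
Lemma nsqN c : nsq (- c) = nsq c.
Proof. by rewrite /nsq Re_opp Im_opp !sqrrN. Qed.
Lemma nsq_conj c : nsq (Num.conj c) = nsq c.
Proof. by rewrite /nsq Re_conj Im_conj sqrrN. Qed.
Lemma mul_conj c : c * Num.conj c = ((nsq c)%:C)%C.
Proof.
by apply: complex_eq; rewrite ?Re_mul ?Im_mul Re_conj Im_conj /nsq /=; ring.
Qed.
End ComplexNumbers.

(** * Semidefinite forms and approximate eigenvectors *)

(* Definiteness is not required: besides the inner products of a Hilbert space and
   of its finite powers, the form [f ((T - m) x) y] occurs as an instance, where [m]
   is the infimum of the numerical range of [T]. *)
Record psd_form (R : realType) (E : lmodType R[i]) (f : E -> E -> R[i]) : Prop :=
  PsdForm {
    form_linear : forall c x y z, f (c *: x + y) z = c * f x z + f y z;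
    form_herm : forall x y, f y x = Num.conj (f x y);
    form_pos : forall x, 0 <= f x x }.

Definition qform (R : realType) (E : lmodType R[i]) (f : E -> E -> R[i]) (x : E) :=
  Re (f x x).

Definition qbounded (R : realType) (E : lmodType R[i]) (f : E -> E -> R[i])
    (T : E -> E) :=
  exists2 M : R, 0 <= M & forall x, qform f (T x) <= M * qform f x.

(** Typically p h = q (T h - z h), and the vectors [h] are approximate eigenvectors. They are not
    normalized, since both sides scale alike. *)
Definition approx_null (R : realType) (E : lmodType R[i]) (f : E -> E -> R[i])
    (p : E -> R) :=
  forall e : R, 0 < e -> exists2 h, 0 < qform f h & p h <= e * qform f h.

(** This is what commutation of [T] with the operators occurring in [p] yields: applying [T] does
    not leave the region of small penalty. *)
Definition seminvariant (R : realType) (E : lmodType R[i]) (p : E -> R) (T : E -> E) :=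
  exists2 M : R, 0 <= M & forall h, p (T h) <= M * p h.

Section Forms.
Variables (R : realType) (E : lmodType R[i]) (f : E -> E -> R[i]).
Hypothesis fP : psd_form f.
Local Notation q := (qform f).
Implicit Types (x y h : E) (c : R[i]) (p : E -> R).

Lemma formDl x y z : f (x + y) z = f x z + f y z.
Proof. by rewrite -[x]scale1r (form_linear fP) mul1r scale1r. Qed.
Lemma form0l z : f 0 z = 0.
Proof. by apply/(addrI (f 0 z)); rewrite -formDl !addr0. Qed.
Lemma formZl c x z : f (c *: x) z = c * f x z.
Proof. by rewrite -[c *: x]addr0 (form_linear fP) form0l addr0. Qed.
Lemma formDr x y z : f z (x + y) = f z x + f z y.
Proof. by rewrite !(form_herm fP _ z) formDl rmorphD. Qed.
Lemma formZr c x z : f z (c *: x) = Num.conj c * f z x.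
Proof. by rewrite !(form_herm fP _ z) formZl rmorphM. Qed.
Lemma form0r z : f z 0 = 0.
Proof. by rewrite (form_herm fP) form0l rmorph0. Qed.
Lemma formNl x z : f (- x) z = - f x z.
Proof. by rewrite -scaleN1r formZl mulN1r. Qed.
Lemma formNr x z : f z (- x) = - f z x.
Proof. by rewrite !(form_herm fP _ z) formNl rmorphN. Qed.

Lemma form_suml I (r : seq I) (P : pred I) (F : I -> E) z :
  f (\sum_(i <- r | P i) F i) z = \sum_(i <- r | P i) f (F i) z.
Proof. by rewrite (big_morph (f^~ z) (fun x y => formDl x y z) (form0l z)). Qed.
Lemma form_sumr I (r : seq I) (P : pred I) (F : I -> E) z :
  f z (\sum_(i <- r | P i) F i) = \sum_(i <- r | P i) f z (F i).
Proof. by rewrite (big_morph (f z) (fun x y => formDr x y z) (form0r z)). Qed.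

Lemma formqE x : f x x = ((q x)%:C)%C.
Proof. exact/ge0_realE/form_pos. Qed.
Lemma q_ge0 x : 0 <= q x. Proof. exact/ge0_Re/form_pos. Qed.
Lemma q0 : q 0 = 0. Proof. by rewrite /q form0l. Qed.
Lemma qZ c x : q (c *: x) = nsq c * q x.
Proof.
by rewrite /q formZl formZr formqE mulrA mul_conj -rmorphM.
Qed.
Lemma qZR (t : R) x : q ((t%:C)%C *: x) = t ^+ 2 * q x.
Proof. by rewrite qZ nsqR. Qed.
Lemma qN x : q (- x) = q x.
Proof. by rewrite -scaleN1r qZ nsqN /nsq /= !expr2 mulr0 addr0 !mul1r. Qed.
Lemma qD x y : q (x + y) = q x + q y + 2 * Re (f x y).
Proof.
rewrite /q formDl !formDr !Re_add (form_herm fP x y) Re_conj; ring.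
Qed.
Lemma qB x y : q (x - y) = q x + q y - 2 * Re (f x y).
Proof. by rewrite qD qN formNr Re_opp mulrN. Qed.
Lemma qD_le x y : q (x + y) <= 2 * q x + 2 * q y.
Proof. by have := q_ge0 (x - y); rewrite qB qD; lra. Qed.
Lemma qB_le x y : q (x - y) <= 2 * q x + 2 * q y.
Proof. by rewrite -(qN y) qD_le. Qed.

(** The form may be degenerate, so q y = 0 is a separate case: the lower bound [H] is then affine in
    [s], and a large [s] would make it negative. *)
Lemma cauchy_schwarz x y : nsq (f x y) <= q x * q y.
Proof.
have H (s : R) : 0 <= q x + s ^+ 2 * (nsq (f x y) * q y) - 2 * s * nsq (f x y).
  have := q_ge0 (x - ((s%:C)%C * f x y) *: y).
  rewrite qB qZ formZr nsqM nsqR rmorphM /= conj_realC.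
  have -> : (s%:C)%C * Num.conj (f x y) * f x y = ((s * nsq (f x y))%:C)%C.
    rewrite -mulrA [X in _ * X]mulrC mul_conj.
    by rewrite -rmorphM.
  by rewrite /=; lra.
have [y0|y0] := eqVneq (q y) 0.
  move: H; rewrite y0 !mulr0 => H.
  have [->//|n0] := eqVneq (nsq (f x y)) 0.
  have := H ((q x + 1) / (2 * nsq (f x y))).
  rewrite mulr0 addr0.
  have -> : 2 * ((q x + 1) / (2 * nsq (f x y))) * nsq (f x y) = q x + 1.
    by field.
  lra.
have yp : 0 < q y by rewrite lt_neqAle eq_sym y0 q_ge0.
have := H ((q y)^-1).
have -> : q x + (q y)^-1 ^+ 2 * (nsq (f x y) * q y) - 2 * (q y)^-1 * nsq (f x y)
  = (q x * q y - nsq (f x y)) / q y by field.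
by rewrite pmulr_lge0 ?invr_gt0// subr_ge0.
Qed.

Lemma Re_cauchy_schwarz x y : Re (f x y) ^+ 2 <= q x * q y.
Proof.
by apply: le_trans (cauchy_schwarz x y); rewrite /nsq lerDl sqr_ge0.
Qed.

Lemma q_sum (I : finType) (F : I -> E) :
  q (\sum_i F i) <= #|I|%:R * \sum_i q (F i).
Proof.
have H (s : seq I) :
    q (\sum_(i <- s) F i) <= (size s)%:R * \sum_(i <- s) q (F i).
  elim: s => [|i s IH]; first by rewrite !big_nil q0 mul0r.
  rewrite !big_cons /= qD -(natr1 (size s)).
  set y := \sum_(j <- s) F j in IH *; set Y := \sum_(j <- s) q (F j) in IH *.
  case: s @y @Y IH => [|j s] y Y IH.
    rewrite /y /Y !big_nil q0 form0r /= mulr0 !addr0 mulr0n add0r.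
    by rewrite mul1r.
  set n := (size (j :: s))%:R in IH *.
  have n0 : 0 < n by rewrite ltr0n.
  (* AM-GM: [2 Re (f x y) <= n q x + q y / n] *)
  have := q_ge0 ((n%:C)%C *: F i - y); rewrite qB qZR formZl Re_mul /= mul0r subr0.
  move=> H.
  have H2 : 2 * Re (f (F i) y) <= n * q (F i) + Y.
    rewrite -(ler_pM2l n0); nra.
  have : q y <= n * Y by [].
  lra.
have := H (enum I); rewrite -cardE.
by rewrite !big_enum.
Qed.

Lemma approx_null_le C p p' : 0 <= C -> (forall h, p' h <= C * p h) ->
  approx_null f p -> approx_null f p'.
Proof.
move=> C0 pC Ap e e0.
have C1 : 0 < C + 1 by rewrite ltr_wpDl.
have [h h0 ph] := Ap (e / (C + 1)) (divr_gt0 e0 C1).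
exists h => //; apply: le_trans (pC h) _.
apply: (@le_trans _ _ (C * (e / (C + 1) * q h))); first by rewrite ler_wpM2l.
rewrite !mulrA ler_wpM2r ?q_ge0// ler_pdivrMr//; nra.
Qed.

(* The supremum of [q (B h) / q h] over the [h] on which [p] is small is almost
   attained at some [h] and not exceeded at [B h]; this forces [P h = B^* B h]
   to be close to a multiple of [h]. *)
Lemma approx_null_abs p (B P : E -> E) :
  qbounded f B -> seminvariant p B -> (forall h, 0 <= p h) ->
  (forall h, f (P h) h = f (B h) (B h)) -> (forall h, q (P h) = q (B (B h))) ->
  approx_null f p ->
  exists r : R, approx_null f (fun h => p h + q (P h - (r%:C)%C *: h)).
Proof.
move=> [M M0 BM] [M' M'0 pM] p0 PB PBB Ap.
pose S := [set r : R | forall e, 0 < e ->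
  exists h, [/\ 0 < q h, p h <= e * q h & r * q h <= q (B h)]].
have S0 : S 0.
  move=> e /Ap[h h0 ph]; exists h; split => //; by rewrite mul0r q_ge0.
have SM : ubound S M.
  move=> r /(_ 1 ltr01)[h [h0 _ hr]].
  by rewrite -(ler_pM2r h0) (le_trans hr) ?BM.
have supS : has_sup S by split; [exists 0 | exists M].
set r := sup S.
have r0 : 0 <= r by apply: sup_upper_bound.
(* As r + d is outside [S], the ratio q (B h) / q h stays below r + d wherever [p] is small
   enough. *)
have Sfar d : 0 < d -> exists2 e0, 0 < e0 &
    forall h, 0 < q h -> p h <= e0 * q h -> q (B h) <= (r + d) * q h.
  move=> d0; apply: contrapT => H.
  have : S (r + d).
    move=> e e0; apply: contrapT => H'; apply: H; exists e => // h h0 ph.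
    rewrite leNgt; apply/negP => /ltW hl; apply: H'; by exists h.
  by move/(sup_upper_bound supS); rewrite -/r; lra.
have qPr h : q (P h - (r%:C)%C *: h) = q (B (B h)) - 2 * r * q (B h) + r ^+ 2 * q h.
  rewrite qB qZR formZr conj_realC PBB PB Re_mul /= mul0r subr0 -/(q (B h)); ring.
exists r => e e0.
have e20 : 0 < e / 2 by rewrite divr_gt0.
(* For r = 0 the vector B h may vanish and cannot be tested; but then q (B h) is small, and
   boundedness makes q (B (B h)) small. *)
have [rz|rN] := eqVneq r 0.
  have M1 : 0 < M + 1 by rewrite ltr_wpDl.
  have [d1 d10 Hd] := Sfar _ (divr_gt0 e20 M1).
  have d2 : 0 < Num.min d1 (e / 2) by rewrite lt_min d10.
  have [h h0 ph] := Ap _ d2; exists h => //.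
  rewrite qPr rz expr0n /= mulr0 !mul0r subr0 addr0.
  have p1 : p h <= e / 2 * q h.
    by apply: le_trans ph _; rewrite ler_wpM2r ?q_ge0// ge_min lexx orbT.
  have p2 : p h <= d1 * q h.
    by apply: le_trans ph _; rewrite ler_wpM2r ?q_ge0// ge_min lexx.
  have := Hd h h0 p2; rewrite rz add0r => H1.
  have H2 := BM (B h).
  have H3 : M * q (B h) <= e / 2 * q h.
    apply: (@le_trans _ _ (M * (e / 2 / (M + 1) * q h))); first by rewrite ler_wpM2l.
    rewrite mulrA ler_wpM2r ?q_ge0// mulrA ler_pdivrMr//; nra.
  lra.
have rp : 0 < r by rewrite lt_neqAle eq_sym rN.
(* One half of [e] pays for p h, the other for the final error 2 r d. The bound r / 2 keeps q (B h)
   above r / 2 q h, so that B h can be tested in turn. *)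
pose d := Num.min (r / 2) (e / (4 * r)).
have d0 : 0 < d by rewrite lt_min !divr_gt0 ?mulr_gt0.
have dr : d <= r / 2 by rewrite ge_min lexx.
have de : 2 * r * d <= e / 2.
  have : d <= e / (4 * r) by rewrite ge_min lexx orbT.
  rewrite ler_pdivlMr ?mulr_gt0//; nra.
have [d1 d10 Hd] := Sfar _ d0.
have [s Ss sr] := sup_adherent d0 supS.
(* The last entry gives p (B h) <= M' p h <= d1 q (B h), so that [Hd] applies at B h. *)
pose e1 := Num.min (e / 2) (Num.min d1 (d1 * r / (2 * (M' + 1)))).
have M1 : 0 < 2 * (M' + 1) by rewrite mulr_gt0// ltr_wpDl.
have e10 : 0 < e1 by rewrite !lt_min e20 d10 /= divr_gt0 // mulr_gt0.
have [h [h0 ph sh]] := Ss e1 e10.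
have le1 a : e1 <= a -> p h <= a * q h.
  by move=> ea; apply: le_trans ph _; rewrite ler_wpM2r ?q_ge0.
have p1 : p h <= e / 2 * q h by apply: le1; rewrite ge_min lexx.
have p2 : p h <= d1 * q h by apply: le1; rewrite !ge_min lexx orbT.
have p3 : p h <= (d1 * r / (2 * (M' + 1))) * q h by apply: le1; rewrite !ge_min lexx !orbT.
have Blow : (r - d) * q h <= q (B h).
  by apply: le_trans sh; rewrite ler_wpM2r ?q_ge0// ltW.
have Blow2 : r / 2 * q h <= q (B h).
  by apply: le_trans Blow; rewrite ler_wpM2r ?q_ge0//; lra.
have Bpos : 0 < q (B h) by apply: lt_le_trans Blow2; rewrite mulr_gt0// divr_gt0.
have pB : p (B h) <= d1 * q (B h).
  apply: le_trans (pM h) _.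
  apply: (@le_trans _ _ (M' * (d1 * r / (2 * (M' + 1)) * q h))); first by rewrite ler_wpM2l.
  apply: (@le_trans _ _ (d1 * (r / 2 * q h))); last by rewrite ler_wpM2l// ltW.
  rewrite !mulrA ler_wpM2r ?q_ge0//.
  rewrite ler_pdivrMr// -!mulrA.
  have -> : d1 * (r * (2^-1 * (2 * (M' + 1)))) = d1 * r * (M' + 1) by field.
  have : 0 < d1 * r by rewrite mulr_gt0.
  nra.
exists h => //; rewrite qPr.
have H1 := Hd _ Bpos pB.
(* As q (B (B h)) <= (r + d) q (B h) and q (B h) >= (r - d) q h, the left side is at most (r^2 - (r
   - d)^2) q h. *)
have : q (B (B h)) - 2 * r * q (B h) + r ^+ 2 * q h <= 2 * r * d * q h.
  have : (r - d) * ((r - d) * q h) <= (r - d) * q (B h).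
    by rewrite ler_wpM2l//; lra.
  have : 0 <= d ^+ 2 * q h by rewrite mulr_ge0 ?sqr_ge0 ?q_ge0.
  lra.
have : 2 * r * d * q h <= e / 2 * q h by rewrite ler_wpM2r ?q_ge0.
lra.
Qed.

End Forms.

Section LinearMaps.
Variables (R : realType) (E F : lmodType R[i]).
Implicit Types (T : E -> F) (x y : E) (c : R[i]).

Lemma lin_add T : linear T -> forall x y, T (x + y) = T x + T y.
Proof. by move=> TL x y; have := TL 1 x y; rewrite !scale1r. Qed.
Lemma lin_zero T : linear T -> T 0 = 0.
Proof. by move=> TL; have := TL (-1) 0 0; rewrite scaler0 addr0 scaleN1r addNr. Qed.
Lemma lin_scale T : linear T -> forall c x, T (c *: x) = c *: T x.
Proof. by move=> TL c x; have := TL c x 0; rewrite (lin_zero TL) !addr0. Qed.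
Lemma lin_opp T : linear T -> forall x, T (- x) = - T x.
Proof. by move=> TL x; rewrite -scaleN1r lin_scale// scaleN1r. Qed.
Lemma lin_sub T : linear T -> forall x y, T (x - y) = T x - T y.
Proof. by move=> TL x y; rewrite lin_add// lin_opp. Qed.
Lemma lin_sum T : linear T -> forall I (r : seq I) (P : pred I) (u : I -> E),
  T (\sum_(i <- r | P i) u i) = \sum_(i <- r | P i) T (u i).
Proof.
by move=> TL I r P u; rewrite (big_morph T (lin_add TL) (lin_zero TL)).
Qed.
End LinearMaps.

(** * Joint approximate eigenvectors of commuting normal operators *)

Section JointApproximateSpectrum.
Variables (R : realType) (E : lmodType R[i]) (f : E -> E -> R[i]).
Hypothesis fP : psd_form f.
Local Notation q := (qform f).
Implicit Types (x y h : E) (c : R[i]) (p : E -> R) (S T : E -> E).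

Lemma qbounded_shift T c : qbounded f T -> qbounded f (fun h => T h + c *: h).
Proof.
move=> [M M0 TM]; exists (2 * M + 2 * nsq c).
  by rewrite addr_ge0// mulr_ge0// nsq_ge0.
move=> x; apply: le_trans (qD_le fP _ _) _; rewrite (qZ fP).
by have := TM x; lra.
Qed.

Lemma seminvariant_add p S T : (forall h, 0 <= p h) -> qbounded f T -> seminvariant p T ->
  (forall h, S (T h) = T (S h)) -> seminvariant (fun h => p h + q (S h)) T.
Proof.
move=> p0 [M M0 TM] [M' M'0 pM] ST; exists (M + M'); first by rewrite addr_ge0.
move=> h; rewrite ST.
have h1 := TM (S h); have h2 := pM h; have h3 := p0 h; have h4 := q_ge0 fP (S h).
have : 0 <= M * p h by rewrite mulr_ge0.
have : 0 <= M' * q (S h) by rewrite mulr_ge0.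
lra.
Qed.

(** P_c = (N + c)^* (N + c) is made almost scalar for c = 0, 1, i in turn; it commutes with every N
    + c', so each condition survives the next. The polarization 2 N = (P_1 - P_0 - 1) + i (P_i - P_0
    - 1) then gives the eigenvalue of N. *)
Lemma approx_null_normal p (N N' : E -> E) :
  linear N -> linear N' -> qbounded f N ->
  (forall x y, f (N x) y = f x (N' y)) -> (forall x, N (N' x) = N' (N x)) ->
  (forall h, 0 <= p h) ->
  (forall c, seminvariant p (fun h => N h + c *: h)) ->
  approx_null f p -> exists z, approx_null f (fun h => p h + q (N h - z *: h)).
Proof.
move=> NL N'L Nb adj com p0 pN Ap.
have adj' x y : f (N' x) y = f x (N y) by rewrite (form_herm fP) -adj -(form_herm fP).
pose B c h := N h + c *: h.
pose P c h := N' (B c h) + Num.conj c *: B c h.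
have Bb c : qbounded f (B c) by exact: qbounded_shift.
have BL c : linear (B c).
  move=> a x y; rewrite /B NL scalerDr [a *: (_ + _)]scalerDr !scalerA [a * c]mulrC.
  by rewrite addrACA.
have BN' c x : B c (N' x) = N' (B c x).
  by rewrite /B com (lin_add N'L) (lin_scale N'L).
have BB c c' x : B c (B c' x) = B c' (B c x).
  by rewrite /B !(lin_add NL) !(lin_scale NL) !scalerDr !scalerA [c * c']mulrC addrACA.
have PB c c' h : P c (B c' h) = B c' (P c h).
  by rewrite /P (lin_add (BL c')) BN' (lin_scale (BL c')) !(BB c).
have fP1 c h : f (P c h) h = f (B c h) (B c h).
  by rewrite /P (formDl fP) adj' (formZl fP) {4}/B (formDr fP) (formZr fP).
have adjB c x y : f (B c x) y = f x (N' y + Num.conj c *: y).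
  by rewrite /B (formDl fP) (formDr fP) adj (formZl fP) (formZr fP) conjCK.
(* P = B^* B with [B] normal, and B^* y and B y have the same norm. *)
have fP2 c h : q (P c h) = q (B c (B c h)).
  rewrite /qform adjB; congr Re.
  have -> : N' (B c (B c h)) + Num.conj c *: B c (B c h) = B c (P c h).
    by rewrite -PB.
  by rewrite [RHS](form_herm fP) adjB -(form_herm fP) /P.
pose S c r h := P c h - r *: h.
have SB c r c' h : S c r (B c' h) = B c' (S c r h).
  by rewrite /S PB (lin_sub (BL c')) (lin_scale (BL c')).
have step c p' : (forall h, 0 <= p' h) -> (forall c, seminvariant p' (B c)) ->
    approx_null f p' -> exists r : R,
    [/\ forall h, 0 <= p' h + q (S c (r%:C)%C h),
      forall c', seminvariant (fun h => p' h + q (S c (r%:C)%C h)) (B c')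
      & approx_null f (fun h => p' h + q (S c (r%:C)%C h))].
  move=> p'0 p'N Ap'.
  have [r rP] := approx_null_abs fP (Bb c) (p'N c) p'0 (fP1 c) (fP2 c) Ap'.
  exists r; split => //.
    by move=> h; rewrite addr_ge0 ?(q_ge0 fP).
  by move=> c'; apply: seminvariant_add.
have [r0 [p10 p1N Ap1]] := step 0 p p0 pN Ap.
have [r1 [p20 p2N Ap2]] := step 1 _ p10 p1N Ap1.
have [r2 [p30 p3N Ap3]] := step 'i%C _ p20 p2N Ap2.
pose z : R[i] := ((r1%:C)%C - (r0%:C)%C - 1 + 'i%C * ((r2%:C)%C - (r0%:C)%C - 1)) / 2.
(* The constant 10 is not sharp; it only has to absorb the factors in [E2] and in q (x - y) <= 2 q x
   + 2 q y. *)
exists z; move: Ap3; apply: (@approx_null_le _ _ _ fP 10) => // h.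
set s0 := S 0 _ h; set s1 := S 1 _ h; set s2 := S _ _ h.
have E2 : 2 *: (N h - z *: h) = (s1 - s0) + 'i%C *: (s2 - s0).
  (* Coordinates with respect to N^* N, N^*, N and 1 reduce the identity to four scalar ones. *)
  pose L a b c d := a *: N' (N h) + b *: N' h + c *: N h + d *: h.
  have LD a b c d a' b' c' d' :
      L a b c d + L a' b' c' d' = L (a + a') (b + b') (c + c') (d + d').
    rewrite /L !scalerDl (addrACA (_ + _ + _)); congr (_ + _).
    by rewrite (addrACA (_ + _)); congr (_ + _); rewrite addrACA.
  have LZ k a b c d : k *: L a b c d = L (k * a) (k * b) (k * c) (k * d).
    by rewrite /L !scalerDr !scalerA.
  have SE c r : S c r h = L 1 c (Num.conj c) (c * Num.conj c - r).
    rewrite /S /P /B /L (lin_add N'L) (lin_scale N'L) scale1r scalerDr scalerA.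
    by rewrite scalerBl !addrA mulrC.
  have -> : N h - z *: h = L 0 0 1 (- z).
    by rewrite /L !scale0r !add0r scale1r scaleNr.
  have ND u : - u = (-1) *: u :> E by rewrite scaleN1r.
  rewrite /s0 /s1 /s2 !SE !(ND (L _ _ _ _)) !LZ !LD !LZ !LD.
  have ii : 'i%C * 'i%C = -1 :> R[i] by rewrite -expr2 sqr_i.
  have ci : Num.conj 'i%C = - 'i%C :> R[i].
    by apply: complex_eq; rewrite /= ?oppr0.
  have z2 : 2 * z = (r1%:C)%C - (r0%:C)%C - 1 + 'i%C * ((r2%:C)%C - (r0%:C)%C - 1).
    by rewrite mulrC /z divfK// pnatr_eq0.
  congr (L _ _ _ _); rewrite ?ci ?rmorph0 ?rmorph1; [ring | | | rewrite mulrN z2; ring: ii].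
    by rewrite mulr0; ring: ii.
  by ring: ii.
have H4 : 4 * q (N h - z *: h) = q (2 *: (N h - z *: h)).
  by rewrite (qZ fP) /nsq /= ; congr (_ * _); ring.
have Hi (u : E) : q ('i%C *: u) = q u.
  by rewrite (qZ fP) /nsq /= expr0n expr1n add0r mul1r.
have := qD_le fP (s1 - s0) ('i%C *: (s2 - s0)).
rewrite -E2 -H4 Hi.
have := qB_le fP s1 s0; have := qB_le fP s2 s0.
have := q_ge0 fP s0; have := q_ge0 fP s1; have := q_ge0 fP s2; have := p0 h.
lra.
Qed.

(** Once an eigenvalue z of N_k is found, the penalty grows by q (N_k h - z h) only, and this is
    controlled under each N_i because N_i and N_k commute. By [uniq] the eigenvalue at [k] can be
    set without disturbing the others. *)
Lemma approx_null_joint (I : eqType) (s : seq I) p (N N' : I -> E -> E) :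
  uniq s ->
  (forall i, linear (N i)) -> (forall i, linear (N' i)) ->
  (forall i, qbounded f (N i)) ->
  (forall i x y, f (N i x) y = f x (N' i y)) ->
  (forall i x, N i (N' i x) = N' i (N i x)) ->
  (forall i j x, N i (N j x) = N j (N i x)) ->
  (forall h, 0 <= p h) ->
  (forall i c, seminvariant p (fun h => N i h + c *: h)) ->
  approx_null f p ->
  exists l : I -> R[i],
    approx_null f (fun h => p h + \sum_(i <- s) q (N i h - l i *: h)).
Proof.
move=> + NL N'L Nb adj com coms.
elim: s p => [|k s IH] p /=.
  move=> _ p0 pN Ap; exists (fun=> 0); apply: (@approx_null_le _ _ _ fP 1 _ _ _ _ Ap) => // h.
  by rewrite big_nil addr0 mul1r.
move=> /andP[ks us] p0 pN Ap.
have [z Az] := approx_null_normal (NL k) (N'L k) (Nb k) (adj k) (com k) p0 (pN k) Ap.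
have [||l Al] := IH _ us _ _ Az.
- by move=> h; rewrite addr_ge0 ?(q_ge0 fP).
- move=> i c; apply: seminvariant_add => //; first exact: qbounded_shift.
  move=> h; rewrite (lin_add (NL k)) (lin_sub (NL i)) !(lin_scale (NL _)) coms.
  by rewrite scalerBr scalerDr !scalerA [z * c]mulrC opprD addrACA.
exists (fun i => if i == k then z else l i); apply: (@approx_null_le _ _ _ fP 1 _ _ _ _ Al) => // h.
rewrite mul1r big_cons eqxx addrA lerD2l.
rewrite (eq_big_seq (fun i => q (N i h - l i *: h)))// => i si.
by case: eqVneq => // ik; rewrite -ik si in ks.
Qed.

(* Cauchy-Schwarz for the form [f ((T - m) x) y], with [m] the infimum of the
   numerical range, turns almost minimizers into approximate eigenvectors. *)
Lemma approx_null_inf (T : E -> E) (h0 : E) :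
  linear T -> qbounded f T -> (forall x y, f (T x) y = f x (T y)) ->
  Re (f (T h0) h0) < 0 ->
  exists2 m : R, m < 0 & approx_null f (fun h => q (T h - (m%:C)%C *: h)).
Proof.
move=> TL Tb Tsa Th0.
have h00 : 0 < q h0.
  rewrite lt_neqAle q_ge0// andbT eq_sym; apply/eqP => q0.
  have := Re_cauchy_schwarz fP (T h0) h0; rewrite q0 mulr0 => H.
  have : Re (f (T h0) h0) ^+ 2 = 0 by apply/eqP; rewrite eq_le H sqr_ge0.
  by move/eqP; rewrite sqrf_eq0 => /eqP H0; rewrite H0 ltxx in Th0.
have [M M0 TM] := Tb.
pose V := [set Re (f (T h) h) / q h | h in [set h | 0 < q h]].
have lbV : lbound V (- (M + 1)).
  move=> _ [h /= hp <-]; rewrite ler_pdivlMr//.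
  have := q_ge0 fP (T h + h); rewrite (qD fP).
  have := TM h; have : 0 <= M * q h by rewrite mulr_ge0 ?q_ge0.
  lra.
have infV : has_inf V by split; [exists (Re (f (T h0) h0) / q h0), h0 | exists (- (M + 1))].
have [m mE] : exists m, m = inf V by exists (inf V).
have mlow h : m * q h <= Re (f (T h) h).
  have [hp|] := ltP 0 (q h).
    by rewrite -ler_pdivlMr// mE; apply: (inf_lbound (proj2 infV)); exists h.
  move=> hn; have q0 : q h = 0 by apply/eqP; rewrite eq_le hn q_ge0.
  have := Re_cauchy_schwarz fP (T h) h; rewrite q0 mulr0 => H.
  have : Re (f (T h) h) ^+ 2 = 0 by apply/eqP; rewrite eq_le H sqr_ge0.
  by move/eqP; rewrite sqrf_eq0 => /eqP ->; rewrite mulr0.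
exists m.
  by rewrite -(pmulr_llt0 _ h00); apply: le_lt_trans Th0.
pose S h := T h - (m%:C)%C *: h.
pose g x y := f (S x) y.
have SE h : S h = T h + (- (m%:C)%C) *: h by rewrite /S scaleNr.
have [M' M'0 SM'] : qbounded f S.
  have [M' M'0 H] := qbounded_shift (- (m%:C)%C) Tb.
  by exists M' => // h; rewrite SE.
have conjm : Num.conj (- (m%:C)%C) = - (m%:C)%C by rewrite rmorphN /= conj_realC.
have gP : psd_form g.
  split => [c x y z|x y|x].
  - by rewrite /g !SE TL scalerDr scalerA mulrC -scalerA addrACA -scalerDr
      (form_linear fP).
  - rewrite /g !SE !(formDl fP) !(formZl fP) rmorphD rmorphM /= conjm.
    by rewrite Tsa -!(form_herm fP).
  - have Im0 : Im (f (T x) x) = 0.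
      have : f (T x) x = Num.conj (f (T x) x) by rewrite {1}Tsa (form_herm fP).
      by move/(congr1 (@Im R)); rewrite Im_conj; lra.
    rewrite /g SE (formDl fP) (formZl fP) (formqE fP) lecE Re_add Im_add Re_mul Im_mul /= Im0.
    have := mlow x; rewrite !(mulr0, mul0r, oppr0, addr0, subr0) eqxx /=; lra.
(* Cauchy-Schwarz for [g] at [h] and S h: g h (S h) is q (S h), and g (S h) (S h) <= (M' + 1) q (S
   h). *)
have key h : q (S h) <= (M' + 1) * qform g h.
  have M1 : 0 < M' + 1 by rewrite ltr_wpDl.
  have [->|n0] := eqVneq (q (S h)) 0; first by rewrite mulr_ge0 ?(q_ge0 gP) ?ltW.
  have Sp : 0 < q (S h) by rewrite lt_neqAle eq_sym n0 q_ge0.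
  have := cauchy_schwarz gP h (S h).
  rewrite {1}/g (formqE fP) nsqR.
  have : qform g (S h) <= (M' + 1) * q (S h).
    rewrite {1}/qform {1}/g; have := q_ge0 fP (S (S h) - S h); rewrite (qB fP).
    have := SM' (S h); have := q_ge0 fP (S (S h)); have := q_ge0 fP (S h); lra.
  move=> H1 H2; rewrite -(ler_pM2r Sp) -expr2; apply: le_trans H2 _.
  have := q_ge0 gP h; nra.
move=> e e0.
have [_ [h /= hp <-] hv] := inf_adherent (divr_gt0 e0 (ltr_wpDl M'0 (@ltr01 R))) infV.
exists h => //; apply: le_trans (key h) _.
have : qform g h <= e / (M' + 1) * q h.
  rewrite /qform /g SE (formDl fP) (formZl fP) (formqE fP) Re_add Re_mul /=.
  move: hv; rewrite -mE ltr_pdivrMr//; lra.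
have M1 : 0 < M' + 1 by rewrite ltr_wpDl.
rewrite -(ler_pM2l M1) => /le_trans; apply.
by rewrite [X in X <= _](_ : _ = e * q h)//; field; rewrite gt_eqF.
Qed.
End JointApproximateSpectrum.

(** * The joint spectrum in a Hilbert space *)

Section Hilbert.
Variables (R : realType) (H : hilbert R).
Local Notation f := (inner H).
Local Notation q := (qform (inner H)).
Implicit Types (x y h : H) (c : R[i]) (S T : H -> H).

Lemma inner_psd : psd_form f.
Proof.
split => [c x y z|x y|x].
- by rewrite linearDl linearZl_LR.
- by rewrite (hermC (inner H)) expr0 mul1r.
- by rewrite inner_norm exprn_ge0.
Qed.
Local Notation fP := inner_psd.

Lemma norm_sqrE x : `|x| ^+ 2 = ((q x)%:C)%C.
Proof. by rewrite -inner_norm (formqE fP). Qed.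

Lemma q_eq0 x : q x = 0 -> x = 0.
Proof. by move=> x0; apply/eqP; rewrite -normr_eq0 -sqrf_eq0 norm_sqrE x0. Qed.

Lemma le_normP x y (e : R) : 0 <= e -> `|x| <= (e%:C)%C * `|y| <-> q x <= e ^+ 2 * q y.
Proof.
move=> e0.
have e0' : 0 <= (e%:C)%C :> R[i] by rewrite ler0c.
have -> : (`|x| <= (e%:C)%C * `|y|) = (`|x| ^+ 2 <= ((e%:C)%C * `|y|) ^+ 2).
  by rewrite ler_sqr ?nnegrE ?mulr_ge0.
by rewrite exprMn !norm_sqrE -rmorphXn -rmorphM lecR.
Qed.

Lemma bounded_opP T : bounded_op T <-> linear T /\ qbounded f T.
Proof.
split => [[TL Tc]|[TL [M M0 TM]]].
  split => //.
  pose T' := GRing.isLinear.Build _ _ _ _ T TL.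
  pose TT : {linear H -> H} := HB.pack T T'.
  have /linear_bounded_continuous/linear_boundedP : continuous TT by [].
  move=> /pinfty_ex_gt0 [r r0 rT].
  have rE : r = ((Re r)%:C)%C by apply/ge0_realE/ltW.
  have Rr0 : 0 <= Re r by apply/ge0_Re/ltW.
  exists (Re r ^+ 2) => [|x]; first exact: sqr_ge0.
  by apply/le_normP => //; rewrite -rE; exact: rT.
split => //.
pose T' := GRing.isLinear.Build _ _ _ _ T TL.
pose TT : {linear H -> H} := HB.pack T T'.
suff : continuous TT by [].
apply/linear_bounded_continuous/linear_boundedP.
have K0 : 0 <= (((Num.sqrt M)%:C)%C : R[i]) by rewrite ler0c sqrtr_ge0.
exists ((Num.sqrt M)%:C)%C; split; first exact: ger0_real.
move=> r Mr x.
apply: (@le_trans _ _ (((Num.sqrt M)%:C)%C * `|x|)); last first.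
  by rewrite ler_wpM2r// ltW.
by apply/le_normP; rewrite ?sqrtr_ge0// sqr_sqrtr.
Qed.

Lemma inner_ext x y : (forall z, f z x = f z y) -> x = y.
Proof.
move=> xy; apply/subr0_eq/q_eq0.
by rewrite /qform (formDr fP) (formNr fP) xy subrr.
Qed.

Lemma adjoint_sym S T : adjoint_op S T -> adjoint_op T S.
Proof. by move=> ST x y; rewrite (form_herm fP) -ST -(form_herm fP). Qed.

Lemma adjoint_linear S T : adjoint_op S T -> linear T.
Proof.
move=> ST c x y; apply: inner_ext => z.
by rewrite (formDr fP) (formZr fP) -!ST (formDr fP) (formZr fP).
Qed.

(** q (T y)^2 = <S T y, y>^2 <= q (S T y) q y <= M q (T y) q y, so [T] inherits the constant of
    [S]. *)
Lemma adjoint_bounded S T : qbounded f S -> adjoint_op S T -> qbounded f T.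
Proof.
move=> [M M0 SM] ST; exists M => // y.
have [->|n0] := eqVneq (q (T y)) 0; first by rewrite mulr_ge0 ?(q_ge0 fP).
have Tp : 0 < q (T y) by rewrite lt_neqAle eq_sym n0 (q_ge0 fP).
have := Re_cauchy_schwarz fP (S (T y)) y; rewrite ST -/(q (T y)) => H1.
rewrite -(ler_pM2r Tp) -expr2; apply: le_trans H1 _.
by rewrite [leRHS]mulrAC ler_wpM2r ?(q_ge0 fP).
Qed.

Lemma adjoint_normal S T : adjoint_op S T -> (forall x, S (T x) = T (S x)) ->
  forall x, q (T x) = q (S x).
Proof. by move=> ST com x; rewrite /qform -ST com (adjoint_sym ST). Qed.

Lemma norm_limit_near (A : set (H -> H)) T :
  (forall e : R[i], 0 < e -> exists2 S, A S & forall x, `|S x - T x| <= e * `|x|) ->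
  forall e : R, 0 < e -> exists2 S, A S & forall x, q (S x - T x) <= e * q x.
Proof.
move=> HT e e0; have [|S AS ST] := HT (((Num.sqrt e)%:C)%C).
  by rewrite ltcR sqrtr_gt0.
exists S => // x; rewrite -(sqr_sqrtr (ltW e0)).
by apply/le_normP; rewrite ?sqrtr_ge0.
Qed.

(** Being one of the algebras whose intersection is [cstar_generated], it bounds the latter from
    above. A norm limit of linear maps is linear because its defect at k x + y is controlled by the
    approximation errors at three vectors. *)
Lemma bounded_op_cstar : cstar_subalgebra (@bounded_op R H).
Proof.
split.
- by [].
- by apply/bounded_opP; split => //; exists 1 => // x; rewrite mul1r.
- move=> a S T /bounded_opP[SL [M M0 SM]] /bounded_opP[TL [M' M'0 TM]].
  apply/bounded_opP; split.
    by move=> k x y; rewrite SL TL !scalerDr !scalerA [a * k]mulrC addrACA.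
  exists (2 * nsq a * M + 2 * M') => [|x].
    by rewrite addr_ge0 ?mulr_ge0 ?nsq_ge0.
  apply: le_trans (qD_le fP _ _) _; rewrite (qZ fP).
  have := TM x; have : nsq a * q (S x) <= nsq a * (M * q x).
    by rewrite ler_wpM2l ?nsq_ge0.
  lra.
- move=> S T /bounded_opP[SL [M M0 SM]] /bounded_opP[TL [M' M'0 TM]].
  apply/bounded_opP; split; first by move=> k x y /=; rewrite TL SL.
  exists (M * M') => [|x /=]; first exact: mulr_ge0.
  by apply: le_trans (SM _) _; rewrite -mulrA ler_wpM2l.
- split=> [S T /bounded_opP[SL Sq] ST|T HT].
    by apply/bounded_opP; split;
      [exact: adjoint_linear ST | exact: adjoint_bounded ST].
  have near := norm_limit_near HT.
  apply/bounded_opP; split.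
    move=> k x y; apply/subr0_eq/q_eq0/eqP; rewrite eq_le (q_ge0 fP) andbT.
    set u := k *: x + y.
    apply/ler_addgt0Pl => e e0; rewrite addr0.
    (* [Q] is the total factor that multiplies the approximation error in the estimate below. *)
    pose Q := 2 * q u + 2 * (2 * nsq k * q x + 2 * q y).
    have Q0 : 0 <= Q.
      have : 0 <= nsq k * q x by rewrite mulr_ge0 ?nsq_ge0 ?(q_ge0 fP).
      by have := q_ge0 fP u; have := q_ge0 fP y; rewrite /Q; lra.
    have Q1 : 0 < Q + 1 by rewrite ltr_wpDl.
    have [S /bounded_opP[SL _] ST] := near _ (divr_gt0 e0 Q1).
    have -> : T u - (k *: T x + T y) =
        (k *: (S x - T x) + (S y - T y)) - (S u - T u).
      rewrite /u SL scalerBr [X in _ = X - _]addrACA -opprD opprB [RHS]addrC.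
      by rewrite addrA subrK.
    apply: le_trans (qB_le fP _ _) _.
    have := qD_le fP (k *: (S x - T x)) (S y - T y); rewrite (qZ fP) => h1.
    have h2 := ST u; have h3 := ST y.
    have h4 : nsq k * q (S x - T x) <= nsq k * (e / (Q + 1) * q x).
      by rewrite ler_wpM2l ?nsq_ge0.
    have h5 : e / (Q + 1) * Q <= e.
      by rewrite mulrAC ler_pdivrMr//; nra.
    rewrite /Q in h5 *; lra.
  have [S /bounded_opP[SL [M M0 SM]] ST] := near 1 ltr01.
  exists (2 * M + 2) => [|x]; first by lra.
  have -> : T x = S x - (S x - T x) by rewrite opprB addrC subrK.
  by apply: le_trans (qB_le fP _ _) _; have := SM x; have := ST x; lra.
Qed.

End Hilbert.

(** * The algebra of operators that have eigenvalues along a sequence of vectors *)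

Section ApproximateSpectrum.
Variables (R : realType) (H : hilbert R).
Local Notation f := (inner H).
Local Notation q := (qform (inner H)).
Local Notation fP := (inner_psd H).
Implicit Types (x y h : H) (c : R[i]) (S T : H -> H).

Lemma cauchy_limit (a : nat -> R) :
  (forall e, 0 < e -> exists r m0, forall m, (m0 <= m)%N -> `|a m - r| <= e) ->
  exists r, forall e, 0 < e -> exists m0, forall m, (m0 <= m)%N -> `|a m - r| <= e.
Proof.
move=> Ha.
have /cvg_ex[l al] : cvgn a.
  apply/cauchy_cvgP/cauchy_exP => e e0.
  have [c [m0 Hc]] := Ha _ (divr_gt0 e0 (ltr0n R 2)).
  exists c; exists m0 => // m /= /Hc.
  rewrite -ball_normE /= distrC => /le_lt_trans; apply.
  by rewrite ltr_pdivrMr// ltr_pMr// ltr1n.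
exists l => e e0.
have /cvgrPdist_le/(_ e e0)[m0 _ Hm] := al.
by exists m0 => m /Hm; rewrite distrC.
Qed.

Variable hs : nat -> H.
Hypothesis hs_gt0 : forall m, 0 < q (hs m).

(* The second clause says [q (T^* h - conj c h) <= e q h] without assuming that
   the adjoint exists. *)
Definition almost_eigen T c (e : R) h :=
  q (T h - c *: h) <= e * q h /\
  forall y, nsq (f (T y - c *: y) h) <= e * q y * q h.

(** The approximate eigenvalue [c] may depend on [e]: this makes closedness under norm limits
    immediate, and a single eigenvalue is extracted afterwards from the completeness of [R]. *)
Definition eigen_algebra : set (H -> H) := [set T | bounded_op T /\
  forall e, 0 < e -> exists c m0, forall m, (m0 <= m)%N -> almost_eigen T c e (hs m)].

Lemma nsqD_le c c' : nsq (c + c') <= 2 * nsq c + 2 * nsq c'.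
Proof.
rewrite /nsq Re_add Im_add.
have := sqr_ge0 (Re c - Re c'); have := sqr_ge0 (Im c - Im c').
rewrite !sqrrB !sqrrD; lra.
Qed.

Lemma almost_eigen_le T c e e' h : e <= e' -> almost_eigen T c e h ->
  almost_eigen T c e' h.
Proof.
move=> ee [h1 h2]; split=> [|y].
  by apply: le_trans h1 _; rewrite ler_wpM2r ?(q_ge0 fP).
by apply: le_trans (h2 y) _; rewrite !ler_wpM2r ?(q_ge0 fP).
Qed.

Lemma almost_eigen_bound T c e h M : e <= 1 -> 0 < q h ->
  (forall x, q (T x) <= M * q x) -> almost_eigen T c e h -> nsq c <= 2 * M + 2.
Proof.
move=> e1 h0 TM [h1 _]; rewrite -(ler_pM2r h0) -(qZ fP).
have -> : c *: h = T h - (T h - c *: h) by rewrite opprB addrC subrK.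
apply: le_trans (qB_le fP _ _) _.
have := TM h; have : e * q h <= q h by rewrite -[leRHS]mul1r ler_wpM2r ?(q_ge0 fP).
lra.
Qed.

Lemma almost_eigen_lin a S T c d e e' h : almost_eigen S c e h -> almost_eigen T d e' h ->
  almost_eigen (fun x => a *: S x + T x) (a * c + d) (2 * nsq a * e + 2 * e') h.
Proof.
have E x : a *: S x + T x - (a * c + d) *: x = a *: (S x - c *: x) + (T x - d *: x).
  by rewrite scalerDl opprD addrACA scalerBr scalerA.
move=> [S1 S2] [T1 T2]; split=> [|y]; rewrite E.
  apply: le_trans (qD_le fP _ _) _; rewrite (qZ fP).
  have : nsq a * q (S h - c *: h) <= nsq a * (e * q h) by rewrite ler_wpM2l ?nsq_ge0.
  lra.
rewrite (formDl fP) (formZl fP); apply: le_trans (nsqD_le _ _) _; rewrite nsqM.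
have := T2 y.
have : nsq a * nsq (f (S y - c *: y) h) <= nsq a * (e * q y * q h).
  by rewrite ler_wpM2l ?nsq_ge0.
lra.
Qed.

(** The first clause uses ST - cd = S (T - d) + d (S - c), the second ST - cd = (S - c) T + c (T -
    d); the error is large enough for both. *)
Lemma almost_eigen_comp S T c d e e' h M M' :
  linear S -> (forall x, q (S x) <= M * q x) -> (forall x, q (T x) <= M' * q x) ->
  0 <= M -> 0 <= e -> almost_eigen S c e h -> almost_eigen T d e' h ->
  almost_eigen (S \o T) (c * d)
    (2 * (M + nsq c) * e' + 2 * (M' + nsq d) * e) h.
Proof.
move=> SL SM TM M0 e0 [S1 S2] [T1 T2]; split=> [|y] /=.
  have -> : S (T h) - (c * d) *: h = S (T h - d *: h) + d *: (S h - c *: h).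
    by rewrite (lin_sub SL) (lin_scale SL) scalerBr scalerA [d * c]mulrC addrA subrK.
  apply: le_trans (qD_le fP _ _) _; rewrite (qZ fP).
  have := SM (T h - d *: h).
  have : M * q (T h - d *: h) <= M * (e' * q h) by rewrite ler_wpM2l.
  have : nsq d * q (S h - c *: h) <= nsq d * (e * q h) by rewrite ler_wpM2l ?nsq_ge0.
  have : 0 <= nsq c * (e' * q h).
    by rewrite mulr_ge0 ?nsq_ge0// (le_trans _ T1) ?(q_ge0 fP).
  have : 0 <= M' * q h * e by rewrite mulr_ge0// (le_trans _ (TM h)) ?(q_ge0 fP).
  lra.
have -> : S (T y) - (c * d) *: y = (S (T y) - c *: T y) + c *: (T y - d *: y).
  by rewrite scalerBr scalerA addrA subrK.
rewrite (formDl fP) (formZl fP); apply: le_trans (nsqD_le _ _) _; rewrite nsqM.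
have h1 := S2 (T y).
have h2 : nsq c * nsq (f (T y - d *: y) h) <= nsq c * (e' * q y * q h).
  by rewrite ler_wpM2l ?nsq_ge0.
have h3 : e * q (T y) * q h <= e * (M' * q y) * q h.
  by rewrite ler_wpM2r ?(q_ge0 fP)// ler_wpM2l.
have h4 : 0 <= M * (e' * q y * q h).
  by rewrite mulr_ge0// (le_trans _ (T2 y)) ?nsq_ge0.
have h5 : 0 <= nsq d * (e * q y * q h).
  by rewrite !mulr_ge0 ?nsq_ge0 ?(q_ge0 fP).
lra.
Qed.

(** The second clause for [S], tested at u = T h - conj c h, reads q (u)^2 <= e q u q h, which is
    the first clause for [T]. *)
Lemma almost_eigen_adj S T c e h : adjoint_op S T -> almost_eigen S c e h ->
  0 <= e -> almost_eigen T (Num.conj c) e h.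
Proof.
move=> ST [S1 S2] e0; split=> [|y].
  set u := T h - _.
  have [->|n0] := eqVneq (q u) 0; first by rewrite mulr_ge0 ?(q_ge0 fP).
  have up : 0 < q u by rewrite lt_neqAle eq_sym n0 (q_ge0 fP).
  have := S2 u; rewrite (formDl fP) (formNl fP) (formZl fP) ST.
  have -> : f u (T h) - c * f u h = f u u.
    by rewrite {4}/u (formDr fP) (formNr fP) (formZr fP) conjCK.
  rewrite (formqE fP) nsqR -mulrA [q u * q h]mulrC mulrA expr2.
  by rewrite ler_pM2r.
rewrite (form_herm fP) nsq_conj (formDr fP) (formNr fP) (formZr fP) conjCK -ST.
rewrite -(formZl fP) -(formNl fP) -(formDl fP).
apply: le_trans (cauchy_schwarz fP _ _) _.
by rewrite mulrAC ler_wpM2r ?(q_ge0 fP).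
Qed.

Lemma almost_eigen_near S T c e e' h : almost_eigen S c e h ->
  (forall x, q (S x - T x) <= e' * q x) ->
  almost_eigen T c (2 * e + 2 * e') h.
Proof.
move=> [S1 S2] ST.
have E x : T x - c *: x = (S x - c *: x) - (S x - T x).
  by rewrite opprB [RHS]addrC addrA subrK.
split=> [|y]; rewrite E.
  by apply: le_trans (qB_le fP _ _) _; have := ST h; lra.
rewrite (formDl fP) (formNl fP); apply: le_trans (nsqD_le _ _) _; rewrite nsqN.
have := S2 y; have := cauchy_schwarz fP (S y - T y) h.
have : q (S y - T y) * q h <= e' * q y * q h by rewrite ler_wpM2r ?(q_ge0 fP).
lra.
Qed.

Lemma eigen_algebra_cstar : cstar_subalgebra eigen_algebra.
Proof.
have [_ B1 BL BM [BA BC]] := bounded_op_cstar H.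
split.
- by move=> T [].
- split=> // e e0; exists 1, 0%N => m _; split => [|y].
    by rewrite scale1r subrr (q0 fP) mulr_ge0 ?ltW.
  rewrite scale1r subrr (form0l fP) /nsq /= expr0n addr0.
  by rewrite !mulr_ge0 ?(q_ge0 fP)// ltW.
- move=> a S T [Sb Se] [Tb Te]; split; first exact: BL.
  move=> e e0.
  have a1 : 0 < 4 * (nsq a + 1) by rewrite mulr_gt0// ltr_wpDl ?nsq_ge0.
  have [c [m0 Hc]] := Se _ (divr_gt0 e0 a1).
  have [d [m1 Hd]] := Te _ (divr_gt0 e0 (ltr0n R 4)).
  exists (a * c + d), (maxn m0 m1) => m; rewrite geq_max => /andP[/Hc hc /Hd hd].
  apply: almost_eigen_le (almost_eigen_lin a hc hd).
  have -> : 2 * nsq a * (e / (4 * (nsq a + 1))) = e / 2 * (nsq a / (nsq a + 1)).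
    by field; rewrite gt_eqF// ltr_wpDl ?nsq_ge0.
  have : nsq a / (nsq a + 1) <= 1.
    by rewrite ler_pdivrMr ?ltr_wpDl ?nsq_ge0// mul1r lerDl.
  nra.
- move=> S T [Sb Se] [Tb Te]; split; first exact: BM.
  have [SL [M M0 SM]] := (bounded_opP S).1 Sb.
  have [TL [M' M'0 TM]] := (bounded_opP T).1 Tb.
  move=> e e0.
  (* For errors at most 1, [almost_eigen_bound] gives nsq c <= 2 M + 2, hence M + nsq c <= 3 M + 2,
     and likewise for [T]. *)
  pose K := 4 * (3 * M + 2 + 3 * M' + 2).
  have K0 : 0 < K by rewrite /K; lra.
  pose e1 := Num.min 1 (e / K).
  have e10 : 0 < e1 by rewrite lt_min ltr01 divr_gt0.
  have e11 : e1 <= 1 by rewrite ge_min lexx.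
  have [c [m0 Hc]] := Se _ e10; have [d [m1 Hd]] := Te _ e10.
  exists (c * d), (maxn m0 m1) => m; rewrite geq_max => /andP[/Hc hc /Hd hd].
  apply: almost_eigen_le (almost_eigen_comp SL SM TM M0 (ltW e10) hc hd).
  have := almost_eigen_bound e11 (hs_gt0 m) SM hc.
  have := almost_eigen_bound e11 (hs_gt0 m) TM hd => hd' hc'.
  have : e1 * K <= e by rewrite -ler_pdivlMr// /e1 ge_min lexx orbT.
  rewrite /K; nra.
- split=> [S T [Sb Se] ST|T HT].
    split; first exact: BA ST.
    move=> e e0; have [c [m0 Hc]] := Se _ e0; exists (Num.conj c), m0 => m /Hc hc.
    by apply: almost_eigen_adj hc _ => //; exact: ltW.
  split; first by apply: BC => e /HT[S [Sb _] ST]; exists S.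
  move=> e e0; have e4 : 0 < e / 4 by rewrite divr_gt0.
  have [S [_ Se] ST] := norm_limit_near HT e4; have [c [m0 Hc]] := Se _ e4.
  exists c, m0 => m /Hc hc; apply: almost_eigen_le (almost_eigen_near hc ST).
  lra.
Qed.

(** The Rayleigh quotients [a m] are eventually close to every approximate eigenvalue, so they form
    a Cauchy sequence; its limit is the eigenvalue. *)
Lemma eigen_algebra_limit T : eigen_algebra T -> exists c, forall e, 0 < e ->
  exists m0, forall m, (m0 <= m)%N -> q (T (hs m) - c *: hs m) <= e * q (hs m).
Proof.
move=> [_ Te].
pose a m := f (T (hs m)) (hs m) / f (hs m) (hs m).
have Ha e c m : 0 < e -> almost_eigen T c (e ^+ 2) (hs m) ->
    `|Re (a m) - Re c| <= e /\ `|Im (a m) - Im c| <= e.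
  move=> e0 [h1 _].
  have hn : f (hs m) (hs m) != 0.
    by rewrite (formqE fP) (inj_eq (@complexI _)) gt_eqF.
  have E : nsq (a m - c) <= e ^+ 2.
    have -> : a m - c = f (T (hs m) - c *: hs m) (hs m) / f (hs m) (hs m).
      by rewrite (formDl fP) (formNl fP) (formZl fP) mulrBl mulfK.
    have q2 : 0 < q (hs m) ^+ 2 by rewrite exprn_gt0.
    rewrite -(ler_pM2r q2) -nsqR -(formqE fP) -nsqM divfK//.
    apply: le_trans (cauchy_schwarz fP _ _) _. rewrite (formqE fP) nsqR [_ (hs m) ^+ 2]expr2 mulrA.
    by rewrite ler_wpM2r ?(q_ge0 fP).
  have le_e (t : R) : t ^+ 2 <= nsq (a m - c) -> `|t| <= e.
    move=> te; rewrite -[leRHS](ger0_norm (ltW e0)) -!sqrtr_sqr.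
    by apply: ler_wsqrtr; apply: le_trans te E.
  rewrite -Re_opp -Re_add -Im_opp -Im_add.
  by split; apply: le_e; rewrite /nsq ?lerDl ?lerDr sqr_ge0.
have [r Hr] : exists r, forall e, 0 < e -> exists m0, forall m, (m0 <= m)%N ->
    `|Re (a m) - r| <= e.
  apply: (@cauchy_limit (fun m => Re (a m))) => e e0.
  have [c [m0 Hc]] := Te _ (exprn_gt0 2 e0); exists (Re c), m0 => m /Hc.
  by case/(Ha _ _ _ e0).
have [s Hs] : exists s, forall e, 0 < e -> exists m0, forall m, (m0 <= m)%N ->
    `|Im (a m) - s| <= e.
  apply: (@cauchy_limit (fun m => Im (a m))) => e e0.
  have [c [m0 Hc]] := Te _ (exprn_gt0 2 e0); exists (Im c), m0 => m /Hc.
  by case/(Ha _ _ _ e0).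
exists (Complex r s) => e e0.
(* The limit differs from [c] by at most 8 d^2 in squared modulus, so the total error is at most (2
   + 16) d^2 <= 18 d. *)
pose d := Num.min 1 (e / 20).
have d0 : 0 < d by rewrite lt_min ltr01 divr_gt0.
have d1 : d <= 1 by rewrite ge_min lexx.
have de : d <= e / 20 by rewrite ge_min lexx orbT.
have [c [m0 Hc]] := Te _ (exprn_gt0 2 d0).
have [m1 Hm1] := Hr _ d0; have [m2 Hm2] := Hs _ d0.
exists (maxn m0 (maxn m1 m2)) => m; rewrite !geq_max => /and3P[/Hc hc /Hm1 h1 /Hm2 h2].
have [h3 h4] := Ha _ _ _ d0 hc.
have E : nsq (c - Complex r s) <= 8 * d ^+ 2.
  have sq (x y z : R) : `|x - y| <= d -> `|x - z| <= d -> (z - y) ^+ 2 <= 4 * d ^+ 2.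
    move=> xy xz.
    have -> : 4 * d ^+ 2 = (2 * d) ^+ 2 by ring.
    have d20 : 0 <= 2 * d by rewrite mulr_ge0// ltW.
    rewrite -(real_normK (num_real (z - y))) ler_sqr ?nnegrE//.
    have -> : z - y = (x - y) - (x - z) by ring.
    by apply: le_trans (ler_normB _ _) _; lra.
  rewrite /nsq Re_add Im_add Re_opp Im_opp /=.
  have := sq _ _ _ h1 h3; have := sq _ _ _ h2 h4; lra.
have -> : T (hs m) - Complex r s *: hs m =
    (T (hs m) - c *: hs m) + (c - Complex r s) *: hs m.
  by rewrite scalerBl addrA subrK.
apply: le_trans (qD_le fP _ _) _; rewrite (qZ fP).
have := hc.1; have := hs_gt0 m.
have : nsq (c - Complex r s) * q (hs m) <= 8 * d ^+ 2 * q (hs m).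
  by rewrite ler_wpM2r ?(q_ge0 fP).
have d2 : d ^+ 2 <= d by rewrite expr2 -[leRHS]mulr1 ler_wpM2l// ltW.
move=> h5 h6 h7.
have : d ^+ 2 * q (hs m) <= e / 20 * q (hs m).
  by rewrite ler_wpM2r ?(q_ge0 fP)// (le_trans d2).
have : 0 < e * q (hs m) by rewrite mulr_gt0.
lra.
Qed.

Lemma eigen_limit_unique T c c' :
  (forall e, 0 < e -> exists m0, forall m, (m0 <= m)%N ->
     q (T (hs m) - c *: hs m) <= e * q (hs m)) ->
  (forall e, 0 < e -> exists m0, forall m, (m0 <= m)%N ->
     q (T (hs m) - c' *: hs m) <= e * q (hs m)) -> c = c'.
Proof.
move=> Hc Hc'; apply/subr0_eq/nsq_eq0/eqP; rewrite eq_le nsq_ge0 andbT.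
apply/ler_addgt0Pl => e e0; rewrite addr0.
have e4 : 0 < e / 4 by rewrite divr_gt0.
have [m0 h0] := Hc _ e4; have [m1 h1] := Hc' _ e4.
set m := maxn m0 m1.
have {}h0 := h0 m (leq_maxl _ _); have {}h1 := h1 m (leq_maxr _ _).
rewrite -(ler_pM2r (hs_gt0 m)) -(qZ fP).
have -> : (c - c') *: hs m = (T (hs m) - c' *: hs m) - (T (hs m) - c *: hs m).
  by rewrite scalerBl opprB [RHS]addrC addrA subrK.
apply: le_trans (qB_le fP _ _) _; lra.
Qed.
End ApproximateSpectrum.

(** Identifies eigenvalues obtained in different ways: their difference multiplies [h] into a
    combination of errors that [p] controls. *)
Lemma approx_null_eq0 (R : realType) (E : lmodType R[i]) (f : E -> E -> R[i])
    (p : E -> R) (C : R) (z : R[i]) :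
  psd_form f -> 0 <= C -> (forall h, nsq z * qform f h <= C * p h) ->
  approx_null f p -> z = 0.
Proof.
move=> fP C0 zp Ap; apply/nsq_eq0/eqP; rewrite eq_le nsq_ge0 andbT.
apply/ler_addgt0Pl => e e0; rewrite addr0.
have C1 : 0 < C + 1 by rewrite ltr_wpDl.
have [h h0 ph] := Ap _ (divr_gt0 e0 C1).
rewrite -(ler_pM2r h0); apply: le_trans (zp h) _.
apply: (@le_trans _ _ (C * (e / (C + 1) * qform f h))); first by rewrite ler_wpM2l.
rewrite mulrA ler_wpM2r ?(q_ge0 fP)// mulrA ler_pdivrMr//; nra.
Qed.

(** * Approximate joint eigenvalues lie in the joint spectrum; real spectrum forces
    selfadjointness *)

Section JointSpectrum.
Variables (R : realType) (H : hilbert R).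
Local Notation f := (inner H).
Local Notation q := (qform (inner H)).
Local Notation fP := (inner_psd H).

Lemma normal_shift (N N' : H -> H) (z : R[i]) : adjoint_op N N' ->
  (forall x, N (N' x) = N' (N x)) ->
  forall h, q (N' h - Num.conj z *: h) = q (N h - z *: h).
Proof.
move=> adj com; have N'L := adjoint_linear adj.
have NL := adjoint_linear (adjoint_sym adj).
apply: (@adjoint_normal _ _ (fun h => N h - z *: h) (fun h => N' h - Num.conj z *: h)).
  move=> x y; rewrite (formDl fP) (formNl fP) (formZl fP) adj.
  by rewrite (formDr fP) (formNr fP) (formZr fP) conjCK.
move=> x; rewrite (lin_sub NL) (lin_sub N'L) !(lin_scale NL) !(lin_scale N'L) com.
rewrite !scalerBr !scalerA !opprB !addrA [z * _]mulrC.
by rewrite [LHS]addrAC [RHS]addrAC; congr (_ + _); exact: addrAC.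
Qed.

Lemma approx_null_joint_spectrum (d : nat) (N : 'I_d -> H -> H) (l : 'I_d -> R[i]) :
  normal_tuple N ->
  approx_null f (fun h => \sum_i q (N i h - l i *: h)) ->
  joint_spectrum N (\row_i l i).
Proof.
move=> [Nb Nn _] Al.
have /choice[hs hsP] (m : nat) : exists h, 0 < q h /\
    \sum_i q (N i h - l i *: h) <= m.+1%:R^-1 * q h.
  by have [|h h0 hp] := Al m.+1%:R^-1; [rewrite invr_gt0 ltr0n | exists h].
have hs0 m : 0 < q (hs m) by case: (hsP m).
have Nl i e : 0 < e -> exists m0, forall m, (m0 <= m)%N ->
    q (N i (hs m) - l i *: hs m) <= e * q (hs m).
  move=> e0; have [m0 m0e] : exists m0 : nat, m0.+1%:R^-1 < e.
    exists (Num.truncn e^-1); rewrite invf_plt ?posrE ?ltr0n//.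
    exact: truncnS_gt.
  exists m0 => m mm; have [_ hp] := hsP m.
  apply: (@le_trans _ _ (m.+1%:R^-1 * q (hs m))).
    apply: le_trans hp; rewrite (bigD1 i)//= lerDl sumr_ge0// => j _.
    exact: (q_ge0 fP).
  rewrite ler_wpM2r ?(q_ge0 fP)// (le_trans _ (ltW m0e))//.
  by rewrite lef_pV2 ?posrE ?ltr0n// ler_nat.
(* [eigen_algebra hs] is a C*-subalgebra containing each N_i; for N_i the clause on the adjoint
   comes from normality. *)
have NA : cstar_generated N `<=` eigen_algebra hs.
  apply: smallest_sub; first exact: eigen_algebra_cstar.
  move=> _ [i _ <-]; split; first exact: Nb.
  move=> e e0; have [m0 Hm] := Nl i e e0.
  exists (l i), m0 => m /Hm h1; split=> // y.
  have [T adj /funeqP com] := Nn i.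
  have -> : f (N i y - l i *: y) (hs m) = f y (T (hs m) - Num.conj (l i) *: hs m).
    rewrite (formDl fP) (formNl fP) (formZl fP) adj.
    by rewrite (formDr fP) (formNr fP) (formZr fP) conjCK.
  apply: le_trans (cauchy_schwarz fP _ _) _; rewrite (normal_shift _ adj)//.
  by rewrite [leRHS]mulrAC mulrC ler_wpM2r ?(q_ge0 fP).
have [_ _ AL AM _] := eigen_algebra_cstar hs0.
pose lim_eigen T c := forall e, 0 < e -> exists m0, forall m, (m0 <= m)%N ->
  q (T (hs m) - c *: hs m) <= e * q (hs m).
(* The default 0 is never taken on the generated algebra, where the limit exists by [NA]. *)
pose chi T := xget 0 [set c | lim_eigen T c].
have chiE T c : lim_eigen T c -> chi T = c.
  move=> Tc; rewrite /chi; case: xgetP => [y _ /= H1|/(_ c)//].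
  exact: (eigen_limit_unique hs0 H1 Tc).
have chiP T : eigen_algebra hs T -> lim_eigen T (chi T).
  by move=> /(eigen_algebra_limit hs0)[c Tc]; rewrite (chiE T c).
exists chi; last by move=> i; rewrite mxE; apply/esym/chiE => e; exact: Nl.
split.
- by apply: chiE => e e0; exists 0%N => m _; rewrite scale1r subrr (q0 fP) mulr_ge0 ?ltW.
- move=> c S T /NA AS /NA AT; apply: chiE => e e0.
  have c1 : 0 < 4 * (nsq c + 1) by rewrite mulr_gt0// ltr_wpDl ?nsq_ge0.
  have [m0 Hm0] := chiP _ AS _ (divr_gt0 e0 c1).
  have [m1 Hm1] := chiP _ AT _ (divr_gt0 e0 (ltr0n R 4)).
  exists (maxn m0 m1) => m; rewrite geq_max => /andP[/Hm0 h0 /Hm1 h1].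
  have -> : c *: S (hs m) + T (hs m) - (c * chi S + chi T) *: hs m =
      c *: (S (hs m) - chi S *: hs m) + (T (hs m) - chi T *: hs m).
    by rewrite scalerDl opprD addrACA scalerBr scalerA.
  apply: le_trans (qD_le fP _ _) _; rewrite (qZ fP).
  have : nsq c * q (S (hs m) - chi S *: hs m) <= e / 4 * q (hs m).
    apply: (@le_trans _ _ (nsq c * (e / (4 * (nsq c + 1)) * q (hs m)))).
      by rewrite ler_wpM2l ?nsq_ge0.
    rewrite mulrA ler_wpM2r ?(q_ge0 fP)// mulrA ler_pdivrMr//.
    have := nsq_ge0 c; nra.
  have : 0 < e * q (hs m) by rewrite mulr_gt0.
  lra.
- move=> S T /NA AS /NA AT; apply: chiE => e e0.
  have /bounded_opP[SL [M M0 SM]] := AS.1.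
  have K0 : 0 < 4 * (M + nsq (chi T) + 1).
    by rewrite mulr_gt0// ltr_wpDl// addr_ge0 ?nsq_ge0.
  have [m0 Hm0] := chiP _ AS _ (divr_gt0 e0 K0).
  have [m1 Hm1] := chiP _ AT _ (divr_gt0 e0 K0).
  exists (maxn m0 m1) => m; rewrite geq_max => /andP[/Hm0 h0 /Hm1 h1] /=.
  have -> : S (T (hs m)) - (chi S * chi T) *: hs m =
      S (T (hs m) - chi T *: hs m) + chi T *: (S (hs m) - chi S *: hs m).
    by rewrite (lin_sub SL) (lin_scale SL) scalerBr scalerA [chi T * _]mulrC addrA subrK.
  apply: le_trans (qD_le fP _ _) _; rewrite (qZ fP).
  set a := e / _ in h0 h1.
  have h2 := SM (T (hs m) - chi T *: hs m).
  have h3 : M * q (T (hs m) - chi T *: hs m) <= M * (a * q (hs m)) by rewrite ler_wpM2l.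
  have h4 : nsq (chi T) * q (S (hs m) - chi S *: hs m) <= nsq (chi T) * (a * q (hs m)).
    by rewrite ler_wpM2l ?nsq_ge0.
  have a0 : 0 < a by rewrite divr_gt0.
  have h5 : 4 * (M + nsq (chi T) + 1) * a = e by rewrite mulrC divfK// gt_eqF.
  have h6 : 4 * (M + nsq (chi T) + 1) * (a * q (hs m)) = e * q (hs m).
    by rewrite mulrA h5.
  have h7 : 0 < a * q (hs m) by rewrite mulr_gt0.
  have : 0 <= M * (a * q (hs m)) by rewrite mulr_ge0 ?(ltW h7).
  have : 0 <= nsq (chi T) * (a * q (hs m)).
    by rewrite mulr_ge0 ?nsq_ge0 ?(ltW h7).
  lra.
Qed.

Lemma real_joint_spectrum_selfadjoint (d : nat) (N : 'I_d -> H -> H)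
    (K : set 'rV[R]_d) :
  normal_tuple N -> joint_spectrum N `<=` cplx K -> forall i, adjoint_op (N i) (N i).
Proof.
move=> NN NK i; have [Nb Nn Nc] := NN.
have {}Nc j k x : N j (N k x) = N k (N j x).
  by have /funeqP/(_ x) := Nc j k.
have /choice[T TP] (j : 'I_d) : exists T, adjoint_op (N j) T /\
    forall x, N j (T x) = T (N j x).
  by have [T adj /funeqP com] := Nn j; exists T.
have adj j := (TP j).1; have com j := (TP j).2.
have NL j : linear (N j) := ((bounded_opP (N j)).1 (Nb j)).1.
have Nq j : qbounded f (N j) := ((bounded_opP (N j)).1 (Nb j)).2.
have TL j := adjoint_linear (adj j).
have adj' j := adjoint_sym (adj j).
have Tq j := adjoint_bounded (Nq j) (adj j).
pose D (s : R) h := ((s%:C)%C * 'i%C) *: (N i h - T i h).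
have DL s : linear (D s).
  move=> c x y; rewrite /D NL TL opprD addrACA -scalerBr scalerDr !scalerA.
  by rewrite [_ * c]mulrC.
have Dsa s : adjoint_op (D s) (D s).
  move=> x y; rewrite /D (formZl fP) (formZr fP) (formDl fP) (formNl fP) adj adj'.
  rewrite (formDr fP) (formNr fP) rmorphM /= conj_realC.
  have -> : Num.conj 'i%C = - 'i%C :> R[i] by apply: complex_eq; rewrite /= ?oppr0.
  ring.
have Dq s : qbounded f (D s).
  have [M M0 NM] := Nq i; have [M' M'0 TM] := Tq i.
  exists (nsq ((s%:C)%C * 'i%C) * (2 * M + 2 * M')) => [|x].
    by rewrite mulr_ge0 ?nsq_ge0// addr_ge0// mulr_ge0.
  rewrite (qZ fP) -mulrA ler_wpM2l ?nsq_ge0//.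
  by apply: le_trans (qB_le fP _ _) _; have := NM x; have := TM x; lra.
have DN s h : D s (N i h) = N i (D s h).
  by rewrite /D (lin_scale (NL i)) (lin_sub (NL i)) com.
have Dpos s h : 0 <= Re (f (D s h) h).
  rewrite leNgt; apply/negP => neg.
  have [m m0 Am] := approx_null_inf fP (DL s) (Dq s) (Dsa s) neg.
  have Bq c := qbounded_shift fP c (Nq i).
  have [||z Az] := approx_null_normal fP (NL i) (TL i) (Nq i) (adj i) (com i) _ _ Am.
  - by move=> x; exact: (q_ge0 fP).
  - move=> c; have [M M0 HM] := Bq c; exists M => // x.
    suff -> : D s (N i x + c *: x) - (m%:C)%C *: (N i x + c *: x) =
        N i (D s x - (m%:C)%C *: x) + c *: (D s x - (m%:C)%C *: x) by exact: HM.
    rewrite (lin_sub (NL i)) -DN (lin_scale (NL i)) (lin_add (DL s)) (lin_scale (DL s)).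
    move: (D s (N i x)) (D s x) => u v.
    by rewrite !scalerBr scalerDr !scalerA [c * _]mulrC opprD addrACA.
  have mz : (m%:C)%C = (s%:C)%C * 'i%C * (z - Num.conj z).
    have s0 := sqr_ge0 s.
    have C0 : 0 <= 2 + 8 * s ^+ 2 by lra.
    apply/subr0_eq; apply: approx_null_eq0 fP C0 _ Az => h'.
    rewrite -(qZ fP); set w := _ * _ * (z - _).
    have -> : ((m%:C)%C - w) *: h' = ((s%:C)%C * 'i%C) *:
        ((N i h' - z *: h') - (T i h' - Num.conj z *: h')) - (D s h' - (m%:C)%C *: h').
      have -> : w = (s%:C)%C * 'i%C * z - (s%:C)%C * 'i%C * Num.conj z by rewrite /w mulrBr.
      rewrite /D; set k := _ * 'i%C.
      have -> : (N i h' - z *: h') - (T i h' - Num.conj z *: h') =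
          (N i h' - T i h') - (z - Num.conj z) *: h'.
        by rewrite scalerBl !opprD !opprK addrACA.
      by rewrite scalerBr scalerA [in RHS]opprB [RHS]addrC subrKA -mulrBr scalerBl.
    apply: le_trans (qB_le fP _ _) _; rewrite (qZ fP).
    have := qB_le fP (N i h' - z *: h') (T i h' - Num.conj z *: h').
    rewrite (normal_shift z (adj i) (com i)).
    have -> : nsq ((s%:C)%C * 'i%C : R[i]) = s ^+ 2.
      by rewrite nsqM nsqR /nsq /= expr0n expr1n add0r mulr1.
    have := q_ge0 fP (N i h' - z *: h'); have := q_ge0 fP (D s h' - (m%:C)%C *: h').
    set a := q _; set b := q _; set c := q _ => b0 a0 H1.
    have : s ^+ 2 * c <= s ^+ 2 * (4 * b) by rewrite ler_wpM2l//; lra.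
    have : 0 <= s ^+ 2 * a by rewrite mulr_ge0.
    lra.
  have Imz : Im z != 0.
    apply/eqP => z0; move: mz.
    have -> : z - Num.conj z = 0.
      by apply: complex_eq; rewrite ?Re_add ?Im_add ?Re_opp ?Im_opp ?Re_conj ?Im_conj ?z0 /= ?oppr0 ?addr0 ?subrr.
    by rewrite mulr0 => /(congr1 (@Re R)) /= mz; rewrite mz ltxx in m0.
  (* The condition on [D] is dropped before the other N_j are treated: it involves N_i^*, which is
     not known to commute with N_j. *)
  have Az' : approx_null f (fun h => q (N i h - z *: h)).
    apply: (@approx_null_le _ _ _ fP 1 _ _ _ _ Az) => // h'.
    by rewrite mul1r lerDr (q_ge0 fP).
  have [||l Al] := approx_null_joint fP (enum_uniq 'I_d) NL TL Nq adj com Nc _ _ Az'.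
  - by move=> x; exact: (q_ge0 fP).
  - move=> j c; have [M M0 HM] := qbounded_shift fP c (Nq j); exists M => // x.
    suff -> : N i (N j x + c *: x) - z *: (N j x + c *: x) =
        N j (N i x - z *: x) + c *: (N i x - z *: x) by exact: HM.
    rewrite (lin_add (NL i)) (lin_sub (NL j)) !(lin_scale (NL _)) Nc.
    by rewrite scalerBr scalerDr !scalerA [z * c]mulrC opprD addrACA.
  have zl : z = l i.
    apply/subr0_eq; apply: approx_null_eq0 fP (ler0n R 2) _ Al => h'.
    rewrite big_enum (bigD1 i)//=.
    have -> : nsq (z - l i) * q h' = q ((N i h' - l i *: h') - (N i h' - z *: h')).
      by rewrite -(qZ fP) scalerBl opprB [in RHS]addrC addrA subrK.
    apply: le_trans (qB_le fP _ _) _.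
    have : 0 <= \sum_(j | j != i) q (N j h' - l j *: h').
      by rewrite sumr_ge0// => j _; exact: (q_ge0 fP).
    lra.
  have /NK[x _ /rowP/(_ i)] : joint_spectrum N (\row_j l j).
    apply: approx_null_joint_spectrum => //.
    apply: (@approx_null_le _ _ _ fP 1 _ _ _ _ Al) => // h'.
    by rewrite mul1r big_enum /= lerDr (q_ge0 fP).
  by rewrite !mxE -zl => /(congr1 (@Im R)) /= z0; rewrite -z0 eqxx in Imz.
have D0 h : D 1 h = 0.
  have D00 x : Re (f (D 1 x) x) = 0.
    apply/eqP; rewrite eq_le Dpos andbT.
    have := Dpos (-1) x.
    have -> : D (-1) x = - D 1 x by rewrite /D rmorphN mulNr scaleNr.
    by rewrite (formNl fP) Re_opp oppr_ge0.
  (* The form of D vanishes at [h] and at D h, so at h + D h it equals the cross terms, 2 q (D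
     h). *)
  apply: q_eq0; have := D00 (h + D 1 h).
  rewrite (lin_add (DL 1)) (formDl fP) !(formDr fP) !Re_add !D00 (Dsa _ _ h).
  rewrite /qform; lra.
have NT h : N i h = T i h.
  apply/subr0_eq; have := D0 h; rewrite /D mul1r => /(congr1 (fun u => - 'i%C *: u)).
  by rewrite scalerA scaler0 mulNr -expr2 sqr_i opprK scale1r.
by move=> x y; rewrite adj NT.
Qed.
End JointSpectrum.

(** * Characters of the generated algebra come from approximate eigenvectors *)

Section CstarGenerated.
Variables (R : realType) (H : hilbert R).
Local Notation f := (inner H).
Local Notation q := (qform (inner H)).
Local Notation fP := (inner_psd H).

Lemma cstar_generated_cstar (d : nat) (N : 'I_d -> H -> H) :
  (forall i, bounded_op (N i)) -> cstar_subalgebra (cstar_generated N).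
Proof.
move=> Nb; have gen : cstar_generated N `<=` @bounded_op R H.
  by apply: smallest_sub; [exact: bounded_op_cstar|move=> _ [i _ <-]].
split => //.
- by move=> A [[_ A1 _ _ _] _].
- move=> c S T AS AT A AN; have [[_ _ AL _ _] _] := AN.
  by apply: AL; [exact: AS|exact: AT].
- move=> S T AS AT A AN; have [[_ _ _ AM _] _] := AN.
  by apply: AM; [exact: AS|exact: AT].
- split=> [S T AS ST A AN|T HT A AN]; have [[_ _ _ _ [A1 A2]] _] := AN.
    by apply: A1 ST; exact: AS.
  by apply: A2 => e /HT[S AS ST]; exists S => //; exact: AS.
Qed.

Lemma cstar_generated_gen (d : nat) (N : 'I_d -> H -> H) i : cstar_generated N (N i).
Proof. by move=> A [_]; apply; exists i. Qed.

Definition rnorm (x : H) : R := Re `|x|.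

Lemma rnormE x : `|x| = ((rnorm x)%:C)%C.
Proof. exact/ge0_realE. Qed.
Lemma rnorm_ge0 x : 0 <= rnorm x. Proof. exact/ge0_Re. Qed.
Lemma rnorm_triangle x y : rnorm (x + y) <= rnorm x + rnorm y.
Proof. by have := ler_normD x y; rewrite !rnormE -rmorphD lecR. Qed.
Lemma rnorm_sqr x : rnorm x ^+ 2 = q x.
Proof. by have := norm_sqrE x; rewrite rnormE -rmorphXn => /complexI. Qed.
Lemma rnormN x : rnorm (- x) = rnorm x.
Proof. by rewrite /rnorm normrN. Qed.
Lemma rnorm_eq0 x : rnorm x = 0 -> x = 0.
Proof. by move=> x0; apply: q_eq0; rewrite -rnorm_sqr x0 expr0n. Qed.

Lemma geometric_small (r e : R) : 0 <= r -> r < 1 -> 0 < e -> exists m, r ^+ m <= e.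
Proof.
move=> r0 r1 e0.
have : `|r| < 1 by rewrite ger0_norm.
move=> /cvg_expr/cvgrPdist_le/(_ e e0)[m _ /(_ m (leqnn m))].
by rewrite sub0r normrN ger0_norm ?exprn_ge0//; exists m.
Qed.

(* The inverse is the Neumann series of [S], whose partial sums are in [A]. *)
Lemma cstar_one_sub_inverse (A : set (H -> H)) (S : H -> H) (r : R) :
  cstar_subalgebra A -> A S -> 0 <= r -> r < 1 ->
  (forall x, rnorm (S x) <= r * rnorm x) ->
  exists2 T, A T & (fun x => x - S x) \o T = idfun.
Proof.
move=> [Ab A1 AL AM [_ AC]] AS r0 r1 Sr.
have SL : linear S by have /bounded_opP[] := Ab _ AS.
have r10 : 0 < 1 - r by rewrite subr_gt0.
pose U n x := iteri n (fun _ y => x + S y) (0 : H).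
have US n x : U n.+1 x = x + S (U n x) by [].
have step n x : rnorm (U n.+1 x - U n x) <= r ^+ n * rnorm x.
  elim: n => [|n IH].
    by rewrite /U /= (lin_zero SL) addr0 subr0 expr0 mul1r.
  rewrite !US opprD addrACA subrr add0r -(lin_sub SL) exprS -mulrA.
  by apply: le_trans (Sr _) _; rewrite ler_wpM2l.
have tail n k x : rnorm (U (n + k)%N x - U n x) <= r ^+ n / (1 - r) * rnorm x.
  (* Induction on [k] needs the exact partial sum: subtracting r ^+ (n + k) leaves room for the next
     term. *)
  suff : rnorm (U (n + k)%N x - U n x) <= (r ^+ n - r ^+ (n + k)) / (1 - r) * rnorm x.
    move/le_trans; apply; rewrite ler_wpM2r ?rnorm_ge0// ler_pM2r ?invr_gt0//.
    by rewrite lerBlDr lerDl exprn_ge0.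
  elim: k => [|k IH].
    by rewrite addn0 !subrr mul0r mul0r /rnorm normr0.
  rewrite addnS -[U _.+1 _](subrK (U (n + k)%N x)) -addrA.
  apply: le_trans (rnorm_triangle _ _) _.
  apply: le_trans (lerD (step _ _) IH) _.
  rewrite -mulrDl ler_wpM2r ?rnorm_ge0// exprS.
  by rewrite le_eqVlt; apply/orP; left; apply/eqP; field; rewrite gt_eqF.
have UL n : A (U n).
  elim: n => [|n IH].
    (* Closure is given for combinations c S + T, so the zero operator is produced as - 1 + 1; the
       same device recurs below. *)
    have -> : U 0%N = (fun x : H => (-1) *: idfun x + idfun x).
      by apply/funext => x; rewrite scaleN1r addNr.
    exact: AL.
  have -> : U n.+1 = (fun x => 1 *: idfun x + (S \o U n) x).
    by apply/funext => x; rewrite scale1r.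
  by apply: AL => //; exact: AM.
have lim x : exists y, forall n, rnorm (U n x - y) <= r ^+ n / (1 - r) * rnorm x.
  have /cvg_ex[y Uy] : cvgn (U ^~ x : nat -> H).
    apply/cauchy_cvgP/cauchy_exP => e e0.
    have eE := ge0_realE (ltW e0); have Re0 : 0 < Re e by rewrite eE ltcR in e0.
    have x1 : 0 < rnorm x + 1 by rewrite ltr_wpDl ?rnorm_ge0.
    have [m hm] := geometric_small r0 r1 (divr_gt0 (mulr_gt0 Re0 r10) x1).
    exists (U m x); exists m => // n /= mn.
    rewrite -ball_normE /= distrC rnormE eE ltcR.
    rewrite -(subnKC mn); apply: le_lt_trans (tail _ _ _) _.
    apply: (@le_lt_trans _ _ (Re e / (rnorm x + 1) * rnorm x)).
      rewrite ler_wpM2r ?rnorm_ge0// ler_pdivrMr//.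
      by rewrite mulrAC.
    by rewrite mulrAC ltr_pdivrMr//; have := rnorm_ge0 x; nra.
  exists y => n; apply/ler_addgt0Pl => e e0.
  have e0' : 0 < ((e%:C)%C : R[i]) by rewrite ltcR.
  have /cvgrPdist_le/(_ _ e0')[m _ Hm] := Uy.
  have := Hm (n + m)%N (leq_addl _ _); rewrite rnormE lecR => h.
  have -> : U n x - y = - (U (n + m)%N x - U n x) - (y - U (n + m)%N x).
    by rewrite opprB opprB addrA subrK.
  apply: le_trans (rnorm_triangle _ _) _; rewrite !rnormN addrC.
  by apply: lerD => //; exact: tail.
have /choice[T TU] := lim.
exists T.
  apply: AC => e e0.
  have eE := ge0_realE (ltW e0); have Re0 : 0 < Re e by rewrite eE ltcR in e0.
  have [m hm] := geometric_small r0 r1 (mulr_gt0 Re0 r10).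
  exists (U m) => // x; rewrite !rnormE eE -rmorphM lecR.
  apply: le_trans (TU x m) _; rewrite ler_wpM2r ?rnorm_ge0//.
  by rewrite ler_pdivrMr.
apply/funext => x /=; apply/subr0_eq/rnorm_eq0/eqP.
rewrite eq_le rnorm_ge0 andbT; apply/ler_addgt0Pl => e e0; rewrite addr0.
have x1 : 0 < 2 * (rnorm x + 1) by rewrite mulr_gt0// ltr_wpDl ?rnorm_ge0.
have [m hm] := geometric_small r0 r1 (divr_gt0 (mulr_gt0 e0 r10) x1).
have -> : T x - S (T x) - x = S (U m x - T x) - (U m.+1 x - T x).
  rewrite US (lin_sub SL) [in RHS]opprB [RHS]addrC opprD [X in _ = X + _]addrA.
  by rewrite subrKA addrAC.
apply: le_trans (rnorm_triangle _ _) _; rewrite rnormN.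
have h1 := le_trans (Sr _) (ler_wpM2l r0 (TU x m)).
have h2 := TU x m.+1.
have h3 : r ^+ m / (1 - r) * rnorm x <= e / 2.
  apply: (@le_trans _ _ (e / (2 * (rnorm x + 1)) * rnorm x)).
    by rewrite ler_wpM2r ?rnorm_ge0// ler_pdivrMr// mulrAC.
  by rewrite mulrAC ler_pdivrMr//; have := rnorm_ge0 x; nra.
have h4 : 0 <= r ^+ m / (1 - r) * rnorm x.
  by rewrite !mulr_ge0 ?rnorm_ge0 ?invr_ge0 ?exprn_ge0// ltW.
rewrite exprS -!mulrA in h2; rewrite -!mulrA in h1 h3 h4.
have : r * (r ^+ m * ((1 - r)^-1 * rnorm x)) <= r ^+ m * ((1 - r)^-1 * rnorm x).
  by rewrite -[leRHS]mul1r ler_wpM2r// ltW.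
lra.
Qed.

Lemma cstar_sum (A : set (H -> H)) I (s : seq I) (F : I -> H -> H) :
  cstar_subalgebra A -> (forall i, A (F i)) -> A (fun x => \sum_(i <- s) F i x).
Proof.
move=> [_ A1 AL _ _] AF; elim: s => [|i s IH].
  have -> : (fun x => \sum_(i <- [::]) F i x) = (fun x : H => (-1) *: idfun x + idfun x).
    by apply/funext => x; rewrite big_nil scaleN1r addNr.
  exact: AL.
have -> : (fun x => \sum_(j <- i :: s) F j x) =
    (fun x => 1 *: F i x + \sum_(j <- s) F j x).
  by apply/funext => x; rewrite big_cons scale1r.
exact: AL.
Qed.

Lemma character_sum (A : set (H -> H)) chi I (s : seq I) (F : I -> H -> H) :
  cstar_subalgebra A -> character A chi -> (forall i, A (F i)) ->
  chi (fun x => \sum_(i <- s) F i x) = \sum_(i <- s) chi (F i).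
Proof.
move=> AA [c1 cL _] AF; have [_ A1 AL _ _] := AA.
elim: s => [|i s IH].
  have -> : (fun x => \sum_(i <- [::]) F i x) = (fun x : H => (-1) *: idfun x + idfun x).
    by apply/funext => x; rewrite big_nil scaleN1r addNr.
  by rewrite cL// c1 mulN1r addNr big_nil.
have -> : (fun x => \sum_(j <- i :: s) F j x) =
    (fun x => 1 *: F i x + \sum_(j <- s) F j x).
  by apply/funext => x; rewrite big_cons scale1r.
by rewrite cL ?mul1r ?IH ?big_cons//; exact: cstar_sum.
Qed.

(** Otherwise T = \sum_i (N_i - chi N_i)^* (N_i - chi N_i) is bounded below by [e]; then 1 - t T is
    a strict contraction for a small t > 0, and t T has a right inverse in the algebra, although chi
    T = 0. A character is just linear and multiplicative, so chi N_i is not known to be real and the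
    left factor carries its conjugate. *)
Lemma character_approx_null (d : nat) (N : 'I_d -> H -> H) chi :
  (forall i, bounded_op (N i)) -> (forall i, adjoint_op (N i) (N i)) ->
  character (cstar_generated N) chi ->
  approx_null f (fun h => \sum_i q (N i h - chi (N i) *: h)).
Proof.
move=> Nb Nsa chiP e e0; apply: contrapT => noh.
have AA := cstar_generated_cstar Nb; set A := cstar_generated N in AA chiP.
have [Ab A1 AL AM _] := AA; have [c1 cL cM] := chiP.
have AN i : A (N i) by exact: cstar_generated_gen.
have low h : e * q h <= \sum_i q (N i h - chi (N i) *: h).
  have [h0|] := ltP 0 (q h).
    by rewrite leNgt; apply/negP => hl; apply: noh; exists h => //; exact: ltW.
  move=> hn; have -> : q h = 0 by apply/eqP; rewrite eq_le hn (q_ge0 fP).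
  by rewrite mulr0 sumr_ge0// => i _; exact: (q_ge0 fP).
pose G c i h := (- c) *: h + N i h.
have AG c i : A (G c i) := AL (- c) idfun (N i) A1 (AN i).
pose F i := G (Num.conj (chi (N i))) i \o G (chi (N i)) i.
have AF i : A (F i) by exact: AM.
pose T h := \sum_i F i h.
have AT : A T := cstar_sum (index_enum 'I_d) AA AF.
have chiG c i : chi (G c i) = - c + chi (N i).
  by have := cL (- c) idfun (N i) A1 (AN i); rewrite c1 mulr1.
have chiT : chi T = 0.
  rewrite (character_sum _ AA chiP AF) big1// => i _.
  by rewrite cM// (chiG (chi _)) addNr mulr0.
have [TL [M M0 TM]] := (bounded_opP T).1 (Ab _ AT).
have Tq h : Re (f (T h) h) = \sum_i q (N i h - chi (N i) *: h).
  rewrite (form_suml fP) Re_sum; apply: eq_bigr => i _; rewrite /qform; congr Re.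
  set u := N i h - _; have uE : G (chi (N i)) i h = u by rewrite /G scaleNr addrC.
  have -> : f u u = f u (N i h) - Num.conj (chi (N i)) * f u h.
    by rewrite {2}/u (formDr fP) (formNr fP) (formZr fP).
  by rewrite /F /= uE /G (formDl fP) (formZl fP) Nsa mulNr addrC.
(* For t = e / M1 one has q (S h) <= (1 + t^2 M - 2 t e) q h with t^2 M <= t e = e^2 / M1. The term
   e ^+ 2 makes [r2] nonnegative. *)
pose M1 := M + e ^+ 2 + 1.
have e20 : 0 <= e ^+ 2 by rewrite sqr_ge0.
have M10 : 0 < M1 by rewrite /M1; lra.
pose t := e / M1.
have t0 : 0 < t by rewrite divr_gt0.
pose S h := h - (t%:C)%C *: T h.
have AS : A S.
  have -> : S = (fun h => (- (t%:C)%C) *: T h + idfun h).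
    by apply/funext => h; rewrite /S scaleNr addrC.
  exact: AL.
pose r2 := 1 - e ^+ 2 / M1.
have r20 : 0 <= r2 by rewrite subr_ge0 ler_pdivrMr// /M1; lra.
have qS h : q (S h) <= r2 * q h.
  rewrite /S (qB fP) (qZR fP) (formZr fP) conj_realC Re_mul /= mul0r subr0.
  have -> : Re (f h (T h)) = Re (f (T h) h) by rewrite (form_herm fP) Re_conj.
  rewrite Tq; have := low h; have := TM h; have := q_ge0 fP h.
  set s := \sum_i _ => h0 h1 h2.
  have h3 : t * (e * q h) <= t * s by rewrite ler_wpM2l// ltW.
  have h4 : t ^+ 2 * q (T h) <= t ^+ 2 * (M * q h) by rewrite ler_wpM2l// sqr_ge0.
  have h5 : t * e = e ^+ 2 / M1 by rewrite /t; field; rewrite gt_eqF.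
  have h6 : t ^+ 2 * M <= e ^+ 2 / M1.
    have -> : t ^+ 2 * M = e ^+ 2 / M1 * (M / M1) by rewrite /t; field; rewrite gt_eqF.
    rewrite -[leRHS]mulr1 ler_wpM2l ?divr_ge0 ?(ltW M10)// ler_pdivrMr// mul1r /M1; lra.
  have h7 : t ^+ 2 * M * q h <= e ^+ 2 / M1 * q h by rewrite ler_wpM2r.
  rewrite /r2 -h5; rewrite -h5 in h7; lra.
have r21 : r2 < 1 by rewrite /r2 ltrBlDr ltrDl divr_gt0// exprn_gt0.
have Sn x : rnorm (S x) <= Num.sqrt r2 * rnorm x.
  rewrite -ler_sqr ?nnegrE ?mulr_ge0 ?rnorm_ge0 ?sqrtr_ge0// exprMn sqr_sqrtr//.
  by rewrite !rnorm_sqr.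
have s1 : Num.sqrt r2 < 1 by rewrite -[ltRHS]sqrtr1 ltr_sqrt.
have [U AU] := cstar_one_sub_inverse AA AS (sqrtr_ge0 _) s1 Sn.
(* As 1 - S = t T, the equation for [U] reads t T U = 1; the summand - U + U is a zero that gives
   the left side the shape c S + T on which [chi] is linear. *)
have -> : (fun x => x - S x) \o U = (fun x => (t%:C)%C *: (T \o U) x + (-1 *: U x + U x)).
  by apply/funext => x /=; rewrite /S opprB addrC subrK scaleN1r addNr addr0.
move/(congr1 chi); rewrite cL; [|exact: AM|exact: AL].
rewrite cM// cL// chiT mul0r mulr0 mulN1r addNr addr0 c1 => /eqP.
by rewrite eq_sym oner_eq0.
Qed.
End CstarGenerated.

(** The same isometry serves for the combinations N'_p. For the spectrum, approximate eigenvectors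
    of N' obtained from a character are improved to joint ones for N, since all these operators
    commute; the eigenvalues of N form a point of [S], and those of N' are its image. *)
Lemma Wmin_linear (R : realType) (d e : nat) (S : set 'rV[R]_d) (c : 'M[R]_(e, d))
    (n : nat) (X : 'I_d -> 'M[R[i]]_n.+1) :
  Wmin (cplx S) X ->
  Wmin (cplx [set \row_p \sum_i c p i * x 0 i | x in S])
    (fun p => \sum_i (c p i)%:C%C *: X i).
Proof.
move=> [H [N [NN NS [V [Vs [VL Viso Vadj XV]]]]]].
have fP := inner_psd H.
have Nsa := real_joint_spectrum_selfadjoint NN NS.
have [Nb _ Ncom] := NN.
have {}Ncom j k x : N j (N k x) = N k (N j x) by have /funeqP/(_ x) := Ncom j k.
have NL j : linear (N j) := ((bounded_opP (N j)).1 (Nb j)).1.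
have Nq j : qbounded (inner H) (N j) := ((bounded_opP (N j)).1 (Nb j)).2.
pose N' (p : 'I_e) (h : H) := \sum_i ((c p i)%:C)%C *: N i h.
have bc := bounded_op_cstar H; have [_ B1 BL BM _] := bc.
have N'b p : bounded_op (N' p).
  apply: (cstar_sum _ (F := fun i h => ((c p i)%:C)%C *: N i h) bc) => i.
  have -> : (fun h => ((c p i)%:C)%C *: N i h) =
      (fun h => ((c p i)%:C)%C *: N i h + ((-1) *: idfun h + idfun h)).
    by apply/funext => x; rewrite scaleN1r addNr addr0.
  by apply: (BL) => //; exact: BL.
have N'sa p : adjoint_op (N' p) (N' p).
  move=> x y; rewrite (form_suml fP) (form_sumr fP); apply: eq_bigr => i _.
  by rewrite (formZl fP) (formZr fP) conj_realC Nsa.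
have N'L p : linear (N' p) := adjoint_linear (N'sa p).
have N'N p i x : N' p (N i x) = N i (N' p x).
  rewrite (lin_sum (NL i)); apply: eq_bigr => j _.
  by rewrite (lin_scale (NL i)) Ncom.
have N'com p p' x : N' p (N' p' x) = N' p' (N' p x).
  rewrite {1}/N' (lin_sum (N'L p')); apply: eq_bigr => i _.
  by rewrite (lin_scale (N'L p')) N'N.
exists H, N'; split.
- split => [//|p|p p']; last by apply/funext => x /=.
  by exists (N' p).
- move=> l [chi chiP lchi].
  have Al := character_approx_null N'b N'sa chiP.
  have [||mu Amu] := approx_null_joint fP (enum_uniq 'I_d) NL NL Nq Nsa
      (fun _ _ => erefl) Ncom _ _ Al.
  + by move=> h; rewrite sumr_ge0// => p _; exact: (q_ge0 fP).
  + move=> i k; have [M M0 HM] := qbounded_shift fP k (Nq i); exists M => // h.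
    rewrite mulr_sumr; apply: ler_sum => p _.
    suff -> : N' p (N i h + k *: h) - chi (N' p) *: (N i h + k *: h) =
        N i (N' p h - chi (N' p) *: h) + k *: (N' p h - chi (N' p) *: h) by exact: HM.
    rewrite (lin_add (N'L p)) N'N (lin_sub (NL i)) !(lin_scale (NL _)) (lin_scale (N'L p)).
    by rewrite scalerBr scalerDr !scalerA [k * _]mulrC opprD addrACA.
  have /NS[x Sx /rowP xmu] : joint_spectrum N (\row_j mu j).
    apply: approx_null_joint_spectrum => //.
    apply: (@approx_null_le _ _ _ fP 1 _ _ _ _ Amu) => // h.
    by rewrite mul1r big_enum /= lerDr sumr_ge0// => p _; exact: (q_ge0 fP).
  exists (\row_p \sum_i c p i * x 0 i); first by exists x.
  apply/rowP => p; rewrite !mxE lchi.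
  have xmu' i : mu i = (x 0 i)%:C%C by have := xmu i; rewrite !mxE.
  apply/subr0_eq.
  pose C := 2 + 2 * (d%:R * \sum_i c p i ^+ 2).
  have C0 : 0 <= \sum_i c p i ^+ 2 by rewrite sumr_ge0// => i _; exact: sqr_ge0.
  have C1 : 0 <= d%:R * \sum_i c p i ^+ 2 :> R by rewrite mulr_ge0 ?ler0n.
  have C2 : 0 <= C by rewrite /C; lra.
  apply: (approx_null_eq0 fP C2 _ Amu) => h; rewrite big_enum /=.
  set s1 := (X in C * (X + _)); set s2 := (X in C * (_ + X)).
  have s10 : qform (inner H) (N' p h - chi (N' p) *: h) <= s1.
    rewrite /s1 (bigD1 p)//= lerDl sumr_ge0// => j _; exact: (q_ge0 fP).
  have s20 i : qform (inner H) (N i h - mu i *: h) <= s2.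
    rewrite /s2 (bigD1 i)//= lerDl sumr_ge0// => j _; exact: (q_ge0 fP).
  rewrite -(qZ fP).
  have -> : ((\sum_i c p i * x 0 i)%:C%C - chi (N' p)) *: h =
      (N' p h - chi (N' p) *: h) - \sum_i (c p i)%:C%C *: (N i h - mu i *: h).
    have -> : \sum_i (c p i)%:C%C *: (N i h - mu i *: h) =
        N' p h - (\sum_i c p i * x 0 i)%:C%C *: h.
      rewrite rmorph_sum scaler_suml -sumrB; apply: eq_bigr => i _.
      by rewrite scalerBr scalerA xmu' -rmorphM.
    by rewrite scalerBl [in RHS]opprB [RHS]addrC subrKA.
  apply: le_trans (qB_le fP _ _) _.
  have h1 : qform (inner H) (\sum_i (c p i)%:C%C *: (N i h - mu i *: h)) <=
      d%:R * (\sum_i c p i ^+ 2 * s2).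
    apply: le_trans (q_sum fP _) _; rewrite card_ord ler_wpM2l ?ler0n//.
    apply: ler_sum => i _; rewrite (qZR fP) ler_wpM2l ?sqr_ge0//.
  have s1p : 0 <= s1 by apply: le_trans s10; exact: (q_ge0 fP).
  have s2p : 0 <= s2 by rewrite sumr_ge0// => j _; exact: (q_ge0 fP).
  rewrite -mulr_suml in h1; rewrite /C.
  have : 0 <= d%:R * (\sum_i c p i ^+ 2) * s1 by rewrite mulr_ge0.
  lra.
(* [Vs] is only given as an adjoint of [V]; it is linear because [cdot] separates vectors. *)
- have VsL : linear Vs.
    have cdotE (u v : 'cV[R[i]]_n.+1) : (forall w, cdot w u = cdot w v) -> u = v.
      move=> uv; apply/colP => j; have := uv (delta_mx j 0).
      have E (z : 'cV[R[i]]_n.+1) : cdot (delta_mx j 0) z = Num.conj (z j 0).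
        rewrite /cdot (bigD1 j)//= big1 ?addr0 ?mxE ?eqxx ?mul1r// => i /negbTE ij.
        by rewrite mxE ij mul0r.
      by rewrite !E => /(congr1 Num.conj); rewrite !conjCK.
    move=> k x y; apply: cdotE => w; rewrite -Vadj (formDr fP) (formZr fP) !Vadj.
    rewrite /cdot mulr_sumr -big_split; apply: eq_bigr => i _ /=.
    by rewrite !mxE rmorphD rmorphM /= mulrDr mulrCA.
  exists V, Vs; split => // p x.
  rewrite mulmx_suml (lin_sum VsL); apply: eq_bigr => i _.
  by rewrite -scalemxAl XV (lin_scale VsL).
Qed.

(** * Convex hulls of compact sets *)

Section ConvexHull.
Variables (R : realType) (D : nat).
Implicit Types (G : set 'rV[R]_D) (x y g : 'rV[R]_D).

Definition conv_hull G (m : nat) : set 'rV[R]_D := [set x |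
  exists (t : 'I_m -> R) (g : 'I_m -> 'rV[R]_D),
  [/\ forall i, 0 <= t i, \sum_i t i = 1, forall i, G (g i) & x = \sum_i t i *: g i]].

Lemma conv_hull_join G m m' x y s : 0 <= s <= 1 ->
  conv_hull G m x -> conv_hull G m' y -> conv_hull G (m + m') ((1 - s) *: x + s *: y).
Proof.
move=> /andP[s0 s1] [t [g [t0 t1 Gg ->]]] [t' [g' [t'0 t'1 Gg' ->]]].
exists (fun i => match fintype.split i with inl j => (1 - s) * t j | inr j => s * t' j end).
exists (fun i => match fintype.split i with inl j => g j | inr j => g' j end).
have sl j : fintype.split (lshift m' j) = inl j :> ('I_m + 'I_m')%type by exact: (unsplitK (inl j)).
have sr j : fintype.split (rshift m j) = inr j :> ('I_m + 'I_m')%type by exact: (unsplitK (inr j)).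
split.
- by move=> i; case: (fintype.split i) => j; rewrite mulr_ge0// subr_ge0.
- rewrite big_split_ord /=.
  under eq_bigr do rewrite sl; under [X in _ + X]eq_bigr do rewrite sr.
  by rewrite -!mulr_sumr t1 t'1 !mulr1 subrK.
- by move=> i; case: (fintype.split i).
- rewrite big_split_ord /=; congr (_ + _); rewrite scaler_sumr; apply: eq_bigr => i _.
    by rewrite sl scalerA.
  by rewrite sr scalerA.
Qed.

(** Too many points are affinely dependent: the rows (g_i, 1) of [E] satisfy a nontrivial relation
    [c]. Subtracting from the weights the largest multiple of [c] that keeps them nonnegative kills
    the weight at [i1]. *)
Lemma conv_hull_reduce G m x : (D.+1 < m.+1)%N -> conv_hull G m.+1 x -> conv_hull G m x.
Proof.
move=> Dm [t [g [t0 t1 Gg ->]]].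
pose E : 'M[R]_(m.+1, D + 1) := \matrix_(i, j) row_mx (g i) (const_mx 1) 0 j.
have : kermx E != 0.
  rewrite -mxrank_eq0 mxrank_ker subn_eq0 -ltnNge.
  by apply: leq_ltn_trans (rank_leq_col _) _; rewrite addn1.
case/rowV0Pn => c0 /sub_kermxP c0E c0n.
have [c [cE [i0 ci0]]] : exists c : 'rV[R]_m.+1, c *m E = 0 /\ exists i, 0 < c 0 i.
  have [i ci] : exists i, c0 0 i != 0.
    apply: contrapT => H; move/eqP: c0n; apply; apply/rowP => i; rewrite mxE.
    by apply/eqP; apply: contrapT => /negP ci; apply: H; exists i.
  have [cp|cn] := ltP 0 (c0 0 i); first by exists c0; split=> //; exists i.
  exists (- c0); split; first by rewrite mulNmx c0E oppr0.
  by exists i; rewrite mxE oppr_gt0 lt_neqAle ci.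
have cg : \sum_i c 0 i *: g i = 0.
  apply/rowP => j; have /rowP/(_ (lshift 1 j)) := cE.
  rewrite !mxE summxE => H; rewrite -[RHS]H; apply: eq_bigr => i _.
  by rewrite [E i _]mxE row_mxEl !mxE.
have c1 : \sum_i c 0 i = 0.
  have /rowP/(_ (rshift D ord0)) := cE.
  rewrite !mxE => H; rewrite -[RHS]H; apply: eq_bigr => i _.
  by rewrite [E i _]mxE row_mxEr mxE mulr1.
have [i1 /= ci1 mini] : exists2 i1, 0 < c 0 i1 &
    forall i, 0 < c 0 i -> t i1 / c 0 i1 <= t i / c 0 i.
  by case: (@arg_minP _ _ _ i0 (fun i => 0 < c 0 i) (fun i => t i / c 0 i) ci0) => i1 ci1 H; exists i1.
pose r := t i1 / c 0 i1.
have r0 : 0 <= r by rewrite divr_ge0// ltW.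
pose t' i := t i - r * c 0 i.
have t'i1 : t' i1 = 0 by rewrite /t' /r divfK ?gt_eqF// subrr.
have t'0 i : 0 <= t' i.
  rewrite subr_ge0; have [cp|cn] := ltP 0 (c 0 i).
    by rewrite -ler_pdivlMr//; exact: mini.
  by apply: le_trans (t0 i); rewrite mulr_ge0_le0.
exists (fun i => t' (lift i1 i)), (fun i => g (lift i1 i)); split => //.
  have <- : \sum_i t' i = 1 by rewrite sumrB -mulr_sumr c1 mulr0 subr0.
  by rewrite [RHS](bigD1_ord i1)//= t'i1 add0r.
have <- : \sum_i t' i *: g i = \sum_i t i *: g i.
  under eq_bigr do rewrite scalerBl -scalerA.
  by rewrite sumrB -scaler_sumr cg scaler0 subr0.
by rewrite (bigD1_ord i1)//= t'i1 scale0r add0r.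
Qed.

Lemma conv_hull_caratheodory G m x : conv_hull G (D.+1 + m) x -> conv_hull G D.+1 x.
Proof.
elim: m => [|m IH]; first by rewrite addn0.
by rewrite addnS => H; apply: IH; apply: conv_hull_reduce H; rewrite ltnS leq_addr.
Qed.

(** By induction: the hull with one more point is the image of [0, 1] x hull x G under the
    continuous map (s, y, g) -> (1 - s) y + s g. *)
Lemma conv_hull_compact G m : compact G -> compact (conv_hull G m.+1).
Proof.
move=> Gc; have G1 x : G x -> conv_hull G 1 x.
  by move=> Gx; exists (fun=> 1), (fun=> x); split; rewrite ?big_ord1 ?scale1r.
elim: m => [|m IH].
  suff -> : conv_hull G 1 = G by [].
  apply/seteqP; split=> [_ [t [g [_ t1 Gg ->]]]|]; last exact: G1.
  by rewrite big_ord1; rewrite big_ord1 in t1; rewrite t1 scale1r.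
pose F (p : R * 'rV[R]_D * 'rV[R]_D) := (1 - p.1.1) *: p.1.2 + p.1.1 *: p.2.
have -> : conv_hull G m.+2 = F @` (`[0, 1]%classic `*` conv_hull G m.+1 `*` G).
  apply/seteqP; split.
    move=> _ [t [g [t0 t1 Gg ->]]].
    have s1 : t ord_max <= 1.
      by rewrite -t1 (bigD1 ord_max)//= lerDl sumr_ge0.
    have sE : \sum_(i < m.+1) t (widen_ord (leqnSn _) i) = 1 - t ord_max.
      by rewrite -t1 [in RHS]big_ord_recr /= addrK.
    (* The remaining weights are renormalized by 1 - t, which must not vanish. *)
    have [s_eq1|s_neq1] := eqVneq (t ord_max) 1.
      exists (1, g ord_max, g ord_max); last first.
        rewrite /F /= subrr scale0r add0r scale1r big_ord_recr /= s_eq1 scale1r.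
        rewrite big1 ?add0r// => i _; rewrite s_eq1 subrr in sE.
        have /eqP := sE; rewrite psumr_eq0// => /allP/(_ i).
        by rewrite mem_index_enum => /(_ isT)/eqP ->; rewrite scale0r.
      split; [split|] => /=; [by rewrite in_itv /= ler01 lexx| |exact: Gg].
      exists (fun i => (i == ord_max)%:R), (fun=> g ord_max); split => //.
      + by rewrite (bigD1 ord_max)//= eqxx big1 ?addr0// => i /negbTE ->.
      + by rewrite (bigD1 ord_max)//= eqxx scale1r big1 ?addr0// => i /negbTE ->; rewrite scale0r.
    have sp : 0 < 1 - t ord_max by rewrite subr_gt0 lt_neqAle s_neq1.
    exists (t ord_max, \sum_(i < m.+1) (t (widen_ord (leqnSn _) i) / (1 - t ord_max)) *:
        g (widen_ord (leqnSn _) i), g ord_max).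
      split; [split|] => /=; [by rewrite in_itv /= t0 s1| |exact: Gg].
      exists (fun i => t (widen_ord (leqnSn _) i) / (1 - t ord_max)).
      exists (fun i => g (widen_ord (leqnSn _) i)); split => //.
        by move=> i; rewrite divr_ge0// ltW.
      by rewrite -mulr_suml sE divff// gt_eqF.
    rewrite /F /= [RHS]big_ord_recr /= scaler_sumr; congr (_ + _).
    by apply: eq_bigr => i _; rewrite scalerA mulrCA divff ?mulr1// gt_eqF.
  move=> _ [[[s y] g] [[/= s01 hy] Gg] <-]; rewrite /F /=.
  have -> : m.+2 = (m.+1 + 1)%N by rewrite addn1.
  by apply: conv_hull_join => //; exact: G1.
apply: continuous_compact.
  apply: continuous_subspaceT => p.
  have c1 : {for p, continuous (fun p : R * 'rV[R]_D * 'rV[R]_D => p.1.1)}.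
    by apply: (@cvg_comp _ _ _ fst fst); [exact: cvg_fst|exact: cvg_fst].
  have c2 : {for p, continuous (fun p : R * 'rV[R]_D * 'rV[R]_D => p.1.2)}.
    by apply: (@cvg_comp _ _ _ fst snd); [exact: cvg_fst|exact: cvg_snd].
  have c3 : {for p, continuous (fun p : R * 'rV[R]_D * 'rV[R]_D => p.2)} by exact: cvg_snd.
  apply: cvgD; apply: cvgZ => //.
  by apply: cvgB => //; exact: cvg_cst.
by apply: compact_setX => //; apply: compact_setX => //; exact: segment_compact.
Qed.

Definition rdot x y := \sum_k x 0 k * y 0 k.

(* The hyperplane through the point of the hull nearest to [x] would separate [x]
   from [G]. *)
Lemma conv_hull_halfspaces G x : G !=set0 -> compact G ->
  (forall b c, (forall g, G g -> c <= rdot b g) -> c <= rdot b x) ->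
  conv_hull G D.+1 x.
Proof.
move=> [g0 Gg0] Gc Hx.
have rD b u v : rdot b (u + v) = rdot b u + rdot b v.
  by rewrite /rdot -big_split; apply: eq_bigr => k _; rewrite mxE mulrDr.
have rZ b s u : rdot b (s *: u) = s * rdot b u.
  by rewrite /rdot mulr_sumr; apply: eq_bigr => k _; rewrite mxE mulrCA.
have rC u v : rdot u v = rdot v u.
  by apply: eq_bigr => k _; rewrite mulrC.
have rN b u : rdot b (- u) = - rdot b u by rewrite -scaleN1r rZ mulN1r.
have pad y : G y -> conv_hull G D.+1 y.
  move=> Gy; exists (fun i => (i == ord0)%:R), (fun=> y); split => //.
    by rewrite (bigD1 ord0)//= ?eqxx big1 ?addr0// => i /negbTE ->.
  by rewrite (bigD1 ord0)//= ?eqxx scale1r big1 ?addr0// => i /negbTE ->; rewrite scale0r.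
have C0 : conv_hull G D.+1 !=set0 by exists g0; exact: pad.
(* The squared Euclidean distance is minimized; the norm of row vectors is the sup norm. *)
have /(EVT_min_rV C0 (@conv_hull_compact G D Gc))[y] :
    {within conv_hull G D.+1, continuous (fun y => rdot (y - x) (y - x))}.
  apply: continuous_subspaceT.
  apply: (@continuous_big _ _ +%R 0 _ add_continuous) => k _ y.
  have H : continuous (fun y : 'rV[R]_D => (y - x) 0 k).
    have -> : (fun y : 'rV[R]_D => (y - x) 0 k) = (fun y : 'rV[R]_D => y 0 k - x 0 k).
      by apply/funext => z; rewrite !mxE.
    move=> z; apply: continuousB; first exact: (@coord_continuous R 1 D 0 k z).
    exact: cst_continuous.
  by apply: continuousM; exact: H.
rewrite inE => Cy ymin.
have key g : G g -> 0 <= rdot (y - x) (g - y).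
  move=> Gg; rewrite leNgt; apply/negP => neg.
  set a := rdot (y - x) (g - y) in neg; set b := rdot (g - y) (g - y).
  have b0 : 0 <= b by rewrite sumr_ge0// => k _; rewrite -expr2 sqr_ge0.
  (* A step of this length towards [g] changes the squared distance by 2 s a + s^2 b < 0. *)
  pose s := Num.min 1 (- a / (b + 1)).
  have b1 : 0 < b + 1 by rewrite ltr_wpDl.
  have s0 : 0 < s by rewrite lt_min ltr01 divr_gt0// oppr_gt0.
  have s1 : s <= 1 by rewrite ge_min lexx.
  have sb : s * (b + 1) <= - a by rewrite -ler_pdivlMr// ge_min lexx orbT.
  have : conv_hull G D.+1 ((1 - s) *: y + s *: g).
    (* The segment uses 2 (D + 1) points, which Caratheodory's theorem brings back to D + 1. *)
    apply: (@conv_hull_caratheodory _ D.+1); apply: conv_hull_join => //; last exact: pad.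
    by rewrite ltW.
  move/mem_set/ymin.
  have -> : (1 - s) *: y + s *: g - x = (y - x) + s *: (g - y).
    rewrite scalerBl scale1r scalerBr -!addrA; congr (_ + _).
    by rewrite addrCA [RHS]addrCA; congr (_ + _); rewrite addrC.
  have -> u v : rdot (u + s *: v) (u + s *: v) =
      rdot u u + 2 * s * rdot u v + s ^+ 2 * rdot v v.
    by rewrite rD rZ !(rC (u + _)) !rD !rZ (rC v u); ring.
  rewrite -/a -/b; nra.
suff -> : x = y by [].
have H : rdot (y - x) y <= rdot (y - x) x.
  apply: Hx => g Gg; have := key g Gg; rewrite rD rN; lra.
apply/eqP; rewrite eq_sym -subr_eq0; apply/eqP/rowP => k; rewrite [RHS]mxE.
have : rdot (y - x) (y - x) = 0.
  apply/eqP; rewrite eq_le; apply/andP; split; last first.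
    by rewrite sumr_ge0// => j _; rewrite -expr2 sqr_ge0.
  by rewrite rD rN subr_le0.
move/eqP; rewrite psumr_eq0; last by move=> j _; rewrite -expr2 sqr_ge0.
move=> /allP/(_ k); rewrite mem_index_enum => /(_ isT).
by rewrite mulf_eq0 orbb => /eqP.
Qed.

End ConvexHull.

(** * Finite representations *)

Section RankOne.
Variables (R : realType) (n : nat).
Implicit Types (w v : 'I_n -> R[i]) (A P : 'M[R[i]]_n).

Definition rank_one w : 'M[R[i]]_n := \matrix_(j, k) (w j * Num.conj (w k)).

(** Re tr (P^T A), without conjugation: every real linear functional on complex matrices has this
    form. *)
Definition pairing P A : R := Re (\sum_j \sum_k P j k * A j k).

Lemma pairingDr P A B : pairing P (A + B) = pairing P A + pairing P B.
Proof.
rewrite /pairing -Re_add -big_split; congr Re; apply: eq_bigr => j _.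
by rewrite -big_split; apply: eq_bigr => k _; rewrite mxE mulrDr.
Qed.

Lemma pairingZr P A (s : R) : pairing P ((s%:C)%C *: A) = s * pairing P A.
Proof.
rewrite /pairing; set z := \sum_j _; set y := \sum_j _.
suff -> : z = (s%:C)%C * y by rewrite Re_mul /= mul0r subr0.
rewrite mulr_sumr; apply: eq_bigr => j _; rewrite mulr_sumr.
by apply: eq_bigr => k _; rewrite mxE mulrCA.
Qed.

Lemma pairing0r P : pairing P 0 = 0.
Proof. by have := pairingZr P 0 0; rewrite scaler0 mul0r. Qed.

Lemma pairing_sumr P I (r : seq I) (p : pred I) (F : I -> 'M[R[i]]_n) :
  pairing P (\sum_(i <- r | p i) F i) = \sum_(i <- r | p i) pairing P (F i).
Proof. by rewrite (big_morph _ (pairingDr P) (pairing0r P)). Qed.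

Lemma pairingC P A : pairing P A = pairing A P.
Proof. by congr Re; apply: eq_bigr => j _; apply: eq_bigr => k _; rewrite mulrC. Qed.

Lemma pairingZl P A (s : R) : pairing ((s%:C)%C *: P) A = s * pairing P A.
Proof. by rewrite !(pairingC _ A) pairingZr. Qed.

Lemma pairingBl P Q A : pairing (P - Q) A = pairing P A - pairing Q A.
Proof.
rewrite !(pairingC _ A) pairingDr; congr (_ + _).
by have := pairingZr A Q (-1); rewrite rmorphN1 scaleN1r mulN1r.
Qed.

Lemma pairing1l A : pairing 1%:M A = Re (\tr A).
Proof.
congr Re; apply: eq_bigr => j _; rewrite (bigD1 j)//= mxE eqxx mul1r big1 ?addr0//.
by move=> k /negbTE kj; rewrite mxE eq_sym kj mul0r.
Qed.

Lemma rank_one_tr w : \tr (rank_one w) = ((\sum_j nsq (w j))%:C)%C.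
Proof. by rewrite rmorph_sum; apply: eq_bigr => j _; rewrite mxE mul_conj. Qed.

Lemma rank_oneZ w (s : R) :
  rank_one (fun j => (s%:C)%C * w j) = ((s ^+ 2)%:C)%C *: rank_one w.
Proof.
apply/matrixP => j k; rewrite !mxE rmorphM /= conj_realC rmorphXn.
by rewrite mulrACA -expr2.
Qed.

Lemma rank_one0 w : (forall j, w j = 0) -> rank_one w = 0.
Proof. by move=> w0; apply/matrixP => j k; rewrite !mxE w0 mul0r. Qed.

Lemma nsq_sum_eq0 w : \sum_j nsq (w j) = 0 -> forall j, w j = 0.
Proof.
move=> /eqP; rewrite psumr_eq0 => [/allP w0 j|j _]; last exact: nsq_ge0.
by apply: nsq_eq0; apply/eqP/(implyP (w0 j _)) => //; rewrite mem_index_enum.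
Qed.

(** By the spectral theorem, A = P^* diag(dg) P with [P] unitary; the l-th vector is the conjugate
    of the l-th row of [P], scaled by the root of its eigenvalue. *)
Lemma psd_rank_one_sum A : (forall j k, A k j = Num.conj (A j k)) ->
  (forall x : 'I_n -> R[i], 0 <= \sum_j \sum_k Num.conj (x j) * A j k * x k) ->
  exists v : 'I_n -> 'I_n -> R[i], A = \sum_l rank_one (v l).
Proof.
move=> Ah Apos.
have Aherm : A \is hermsymmx.
  by apply/is_hermitianmxP; rewrite expr0 scale1r; apply/matrixP => j k; rewrite !mxE Ah.
have /hermitian_normalmx/orthomx_spectralP := Aherm.
set P := spectralmx A; set dg := spectral_diag A => AE.
have PU : P \is unitarymx by exact: spectral_unitarymx.
rewrite invmx_unitary// in AE.
have Ajk j k : A j k = \sum_l Num.conj (P l j) * dg 0 l * P l k.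
  by rewrite AE mxE; apply: eq_bigr => l _; rewrite mul_mx_diag !mxE.
have dpos l : 0 <= dg 0 l.
  have := Apos (fun k => Num.conj (P l k)).
  suff -> : \sum_j \sum_k Num.conj (Num.conj (P l j)) * A j k * Num.conj (P l k) = dg 0 l.
    by [].
  have E : P *m A *m (map_mx Num.conj P^T) = diag_mx dg.
    by rewrite AE !mulmxA (unitarymxP PU) mul1mx -mulmxA (unitarymxP PU) mulmx1.
  have /matrixP/(_ l l) := E; rewrite !mxE eqxx mulr1n => <-.
  rewrite exchange_big; apply: eq_bigr => k _; rewrite mxE mulr_suml.
  by apply: eq_bigr => j _; rewrite !mxE conjCK.
exists (fun l j => ((Num.sqrt (Re (dg 0 l)))%:C)%C * Num.conj (P l j)).
apply/matrixP => j k; rewrite summxE Ajk; apply: eq_bigr => l _.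
rewrite rank_oneZ sqr_sqrtr ?ge0_Re// -ge0_realE// !mxE conjCK.
by rewrite mulrA [dg 0 l * _]mulrC.
Qed.

(** Polarization at w = e_a + c e_b for c = 0, 1, i. *)
Lemma quadratic_eq0 A : (forall w, \sum_j \sum_k A j k * (w k * Num.conj (w j)) = 0) -> A = 0.
Proof.
move=> A0; pose Q w := \sum_j \sum_k A j k * (w k * Num.conj (w j)).
have E (c : R[i]) (a b : 'I_n) :
    A a a + c * Num.conj c * A b b + c * A a b + Num.conj c * A b a = 0.
  pose w k : R[i] := (k == a)%:R + c * (k == b)%:R.
  rewrite -[RHS](A0 w) {}/w.
  have S (F : 'I_n -> R[i]) (e : 'I_n) : \sum_j F j * (j == e)%:R = F e.
    rewrite (bigD1 e)//= eqxx mulr1 big1 ?addr0// => j /negbTE ->.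
    by rewrite mulr0.
  under [RHS]eq_bigr => j _.
    have -> : \sum_k A j k * (((k == a)%:R + c * (k == b)%:R) *
        Num.conj ((j == a)%:R + c * (j == b)%:R)) =
        (A j a + c * A j b) * (j == a)%:R +
        (Num.conj c * (A j a + c * A j b)) * (j == b)%:R.
      rewrite rmorphD rmorphM !rmorph_nat.
      transitivity (\sum_k (A j k * ((j == a)%:R + Num.conj c * (j == b)%:R) * (k == a)%:R
         + A j k * c * ((j == a)%:R + Num.conj c * (j == b)%:R) * (k == b)%:R)).
        by apply: eq_bigr => k _; ring.
      by rewrite big_split /= !S; ring.
    over.
  by rewrite big_split /= !S; ring.
apply/matrixP => a b; rewrite mxE.
have D a' : A a' a' = 0.
  by have := E 0 a' a'; rewrite rmorph0 !mul0r !addr0.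
have := E 1 a b; have := E 'i%C a b.
have -> : Num.conj 'i%C = - 'i%C :> R[i] by apply: complex_eq; rewrite /= ?oppr0.
rewrite rmorph1 !D !mulr0 !add0r !mul1r mulNr -mulrBr => /eqP.
rewrite mulf_eq0 => /orP[/eqP i0|/eqP].
  by have := congr1 (@Im R) i0; rewrite /= => /eqP; rewrite oner_eq0.
move=> /subr0_eq ->; rewrite -mulr2n => /eqP.
by rewrite mulrn_eq0 => /eqP.
Qed.

End RankOne.

Lemma big_option (V : nmodType) (I : finType) (F : option I -> V) :
  \sum_a F a = F None + \sum_i F (Some i).
Proof.
rewrite (bigD1 None)//=; congr (_ + _).
rewrite (reindex_omap Some id) //=; last by case.
by apply: eq_bigl => i; rewrite eqxx.
Qed.

Definition finite_rep (R : realType) (d n : nat) (K : set 'rV[R]_d)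
    (X : 'I_d -> 'M[R[i]]_n.+1) (m : nat) :=
  exists (lam : 'I_m -> 'rV[R]_d) (w : 'I_m -> 'I_n.+1 -> R[i]),
  [/\ forall k, K (lam k), \sum_k rank_one (w k) = 1%:M
    & forall i, X i = \sum_k ((lam k 0 i)%:C)%C *: rank_one (w k)].

Lemma continuous_row (R : realType) (T : topologicalType) (D : nat) (F : T -> 'rV[R]_D) :
  (forall k, continuous (fun p => F p 0 k)) -> continuous F.
Proof.
move=> Fc p; apply/cvg_ballP => e e0.
have : \forall q \near p, forall k, ball (F p 0 k) e (F q 0 k).
  apply: filter_forall => k; have /cvg_ballP := Fc k p; exact.
by apply: filterS => q Hq; split => // i k; rewrite ord1.
Qed.

Section FiniteRep.
Variables (R : realType) (d n : nat) (K : set 'rV[R]_d).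
Implicit Types (X : 'I_d -> 'M[R[i]]_n.+1).

(** The added terms have w_k = 0, so any point of [K] can be attached to them. *)
Lemma finite_rep_pad X m m' : K !=set0 -> finite_rep K X m -> finite_rep K X (m + m').
Proof.
move=> [x0 Kx0] [lam [w [Kl w1 Xw]]].
exists (fun i => match fintype.split i with inl k => lam k | inr _ => x0 end).
exists (fun i => match fintype.split i with inl k => w k | inr _ => fun=> 0 end).
have sl j : fintype.split (lshift m' j) = inl j :> ('I_m + 'I_m')%type
  by exact: (unsplitK (inl j)).
have sr j : fintype.split (rshift m j) = inr j :> ('I_m + 'I_m')%type
  by exact: (unsplitK (inr j)).
split.
- by move=> i; case: fintype.split.
- rewrite big_split_ord /= [X in _ + X]big1 ?addr0.
    by rewrite -w1; apply: eq_bigr => k _; rewrite sl.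
  by move=> k _; rewrite sr rank_one0.
- move=> i; rewrite big_split_ord /= [X in _ + X]big1 ?addr0.
    by rewrite Xw; apply: eq_bigr => k _; rewrite sl.
  by move=> k _; rewrite sr rank_one0// scaler0.
Qed.

(** The dual of the cone generated by the tuples (E, lam_1 E, ..., lam_d E) with E = w w^* and lam
    in [K]. *)
Definition dual_positive (P0 : 'M[R[i]]_n.+1) (P : 'I_d -> 'M[R[i]]_n.+1) :=
  forall lam w, K lam ->
    0 <= pairing P0 (rank_one w) + \sum_i lam 0 i * pairing (P i) (rank_one w).

(** Dividing (1, X_1, ..., X_d) by the size of the matrices normalizes traces, so that the cone is
    replaced by the convex hull of the compact set of tuples (E, lam_1 E, ..., lam_d E) with E = w
    w^* and w a unit vector. Real and imaginary parts of the entries place this in R^D; the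
    halfspace of normal [b] and level [c] corresponds to the pencil of [b] with [c] subtracted from
    its constant term. *)
Lemma finite_rep_dual X : K !=set0 -> compact K ->
  (forall P0 P, dual_positive P0 P -> 0 <= pairing P0 1%:M + \sum_i pairing (P i) (X i)) ->
  exists m, finite_rep K X m.
Proof.
move=> [x0 Kx0] Kc HX.
pose I : finType := (option 'I_d * 'I_n.+1 * 'I_n.+1 * bool)%type.
pose D := #|I|.
pose enc (A : option 'I_d -> 'M[R[i]]_n.+1) : 'rV[R]_D := \row_k
  let x := enum_val k in
  if x.2 then Re (A x.1.1.1 x.1.1.2 x.1.2) else Im (A x.1.1.1 x.1.1.2 x.1.2).
have encE A o j k (b : bool) :
    enc A 0 (enum_rank (o, j, k, b)) = if b then Re (A o j k) else Im (A o j k).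
  by rewrite mxE enum_rankK.
have enc_inj A B : enc A = enc B -> forall o, A o = B o.
  move=> AB o; apply/matrixP => j k.
  by apply: complex_eq; [have := encE A o j k true|have := encE A o j k false];
     rewrite AB encE.
pose ev (lam : 'rV[R]_d) o := oapp (lam 0) 1 o.
pose wv (u : 'rV[R]_(n.+1 + n.+1)) j := Complex (u 0 (lshift _ j)) (u 0 (rshift _ j)).
pose F (p : 'rV[R]_d * 'rV[R]_(n.+1 + n.+1)) :=
  enc (fun o => ((ev p.1 o)%:C)%C *: rank_one (wv p.2)).
pose Sph := [set u : 'rV[R]_(n.+1 + n.+1) | \sum_k u 0 k ^+ 2 = 1].
have SphE (u : 'rV[R]_(n.+1 + n.+1)) : \sum_k u 0 k ^+ 2 = \sum_j nsq (wv u j).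
  by rewrite big_split_ord /= -big_split.
pose G := F @` (K `*` Sph).
have Gc : compact G.
  apply: continuous_compact.
    apply: continuous_subspaceT; apply: continuous_row => k p.
    have c1 i : continuous (fun p : 'rV[R]_d * 'rV[R]_(n.+1 + n.+1) => p.1 0 i).
      move=> z; apply: (@continuous_comp _ _ _ fst (fun x : 'rV[R]_d => x 0 i)).
        exact: cvg_fst.
      exact: coord_continuous.
    have c2 i : continuous (fun p : 'rV[R]_d * 'rV[R]_(n.+1 + n.+1) => p.2 0 i).
      move=> z; apply: (@continuous_comp _ _ _ snd
        (fun x : 'rV[R]_(n.+1 + n.+1) => x 0 i)).
        exact: cvg_snd.
      exact: coord_continuous.
    have cev o : continuous (fun p : 'rV[R]_d * 'rV[R]_(n.+1 + n.+1) => ev p.1 o).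
      by case: o => [i|] /=; [exact: c1|exact: cst_continuous].
    case E : (enum_val k) => [[[a j] l] b].
    have -> : (fun p => F p 0 k) = (fun p : 'rV[R]_d * 'rV[R]_(n.+1 + n.+1) =>
      ev p.1 a * (if b then p.2 0 (lshift _ j) * p.2 0 (lshift _ l) +
                            p.2 0 (rshift _ j) * p.2 0 (rshift _ l)
                  else p.2 0 (rshift _ j) * p.2 0 (lshift _ l) -
                       p.2 0 (lshift _ j) * p.2 0 (rshift _ l))).
      apply/funext => z; rewrite !mxE E /=; case: (b); rewrite !mxE ?Re_mul ?Im_mul
        ?Re_conj ?Im_conj ?Re_mul ?Im_mul ?Re_conj ?Im_conj /=; ring.
    apply: continuousM; first exact: cev.
    by case: (b); [apply: continuousD|apply: continuousB]; apply: continuousM; exact: c2.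
  apply: compact_setX => //; apply: bounded_closed_compact.
    exists 1; split; first exact: num_real.
    move=> M M1 u /= u1.
    rewrite [leLHS]/Num.Def.normr /= mx_normrE; apply/bigmax_leP; split; first by rewrite ltW// (lt_trans ltr01).
    move=> [i k] _ /=; rewrite ord1; apply: le_trans (ltW M1).
    rewrite -(@ler_pXn2r _ 2) ?nnegrE// real_normK ?num_real// expr1n -u1.
    by rewrite (bigD1 k)//= lerDl sumr_ge0// => j _; exact: sqr_ge0.
  have -> : Sph = (fun u : 'rV[R]_(n.+1 + n.+1) => \sum_k u 0 k ^+ 2) @^-1` [set 1] by [].
  apply: (@closed_comp _ R); last exact: closed_eq.
  move=> u _; apply: (@continuous_big _ _ +%R 0 _ add_continuous) => k _ z.
  by apply: continuousM; exact: coord_continuous.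
have G0 : G !=set0.
  exists (F (x0, delta_mx 0 0)), (x0, delta_mx 0 0) => //; split => //=.
  rewrite /Sph /= (bigD1 ord0)//= mxE eqxx expr1n big1 ?addr0// => i /negbTE i0.
  by rewrite mxE i0 andbF expr0n.
pose N : R := n.+1%:R.
have N0 : 0 < N by rewrite ltr0n.
pose x := enc (fun o => ((N^-1)%:C)%C *: oapp X 1%:M o).
(* The minus sign makes the real part of a product of entries equal to the product of
   coordinates. *)
pose B (b : 'rV[R]_D) o : 'M[R[i]]_n.+1 := \matrix_(j, k)
  Complex (b 0 (enum_rank (o, j, k, true))) (- b 0 (enum_rank (o, j, k, false))).
have rdotE b A : rdot b (enc A) = pairing (B b None) (A None) +
    \sum_i pairing (B b (Some i)) (A (Some i)).
  have -> : rdot b (enc A) = \sum_(x : I) b 0 (enum_rank x) * enc A 0 (enum_rank x).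
    rewrite /rdot (reindex (@enum_rank I)) //=.
    by apply: onW_bij; exact: enum_rank_bij.
  have -> (u : I -> R) : \sum_x u x = \sum_a \sum_j \sum_k \sum_b' u (a, j, k, b').
    by rewrite !pair_bigA; apply: eq_bigr => -[[[a j] k] b'].
  have E o : \sum_j \sum_k \sum_b' b 0 (enum_rank (o, j, k, b')) *
      enc A 0 (enum_rank (o, j, k, b')) = pairing (B b o) (A o).
    rewrite /pairing Re_sum; apply: eq_bigr => j _; rewrite Re_sum; apply: eq_bigr => k _.
    by rewrite big_bool !encE Re_mul mxE /= mulNr opprK.
  transitivity (\sum_a pairing (B b a) (A a)); first by apply: eq_bigr => a _; exact: E.
  exact: big_option.
have [|t [g [t0 t1 Gg xE]]] := @conv_hull_halfspaces R D G x G0 Gc.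
  move=> b c Hb.
  have := HX (B b None - (c%:C)%C *: 1%:M) (fun i => B b (Some i)).
  rewrite /x rdotE /= pairingZr.
  under [X in _ -> c <= _ + X]eq_bigr do rewrite pairingZr.
  rewrite -mulr_sumr -mulrDr pairingBl pairingZl pairing1l mxtrace1 => H.
  rewrite -(ler_pM2l N0) mulrA divff ?gt_eqF// mul1r.
  have ReN : Re (n.+1%:R : R[i]) = N by rewrite -(rmorph_nat (real_complex R)).
  rewrite ReN in H; suff : 0 <= pairing (B b None) 1%:M - c * N +
      \sum_i pairing (B b (Some i)) (X i) by lra.
  apply: H => lam w Kl; rewrite pairingBl pairingZl pairing1l rank_one_tr /=.
  have [w0|w0] := eqVneq (\sum_j nsq (w j)) 0.
    rewrite (rank_one0 (nsq_sum_eq0 w0)) w0 pairing0r mulr0 subr0 add0r.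
    by rewrite big1// => i _; rewrite pairing0r mulr0.
  set s := \sum_j nsq (w j) in w0 *.
  have s0 : 0 < s by rewrite lt_neqAle eq_sym w0 sumr_ge0// => j _; exact: nsq_ge0.
  pose r := (Num.sqrt s)^-1.
  have r2 : r ^+ 2 = s^-1 by rewrite exprVn sqr_sqrtr// ltW.
  pose w' j := (r%:C)%C * w j.
  have w'1 : \sum_j nsq (w' j) = 1.
    under eq_bigr do rewrite nsqM nsqR r2.
    by rewrite -mulr_sumr -/s mulVf.
  pose u : 'rV[R]_(n.+1 + n.+1) := \row_k
    match fintype.split k with inl j => Re (w' j) | inr j => Im (w' j) end.
  have uE : wv u = w'.
    apply/funext => j; apply: complex_eq; rewrite /= mxE.
      by rewrite (unsplitK (inl j)).
    by rewrite (unsplitK (inr j)).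
  have RW : rank_one (wv u) = ((s^-1)%:C)%C *: rank_one w by rewrite uE rank_oneZ r2.
  have GF : G (F (lam, u)).
    by exists (lam, u) => //; split => //=; rewrite /Sph /= SphE uE.
  have := Hb _ GF; rewrite /F rdotE /= RW !pairingZr mul1r.
  under eq_bigr do rewrite !pairingZr mulrCA.
  rewrite -mulr_sumr -mulrDr => H.
  have := H; rewrite -(ler_pM2l s0) mulrA divff// mul1r; lra.
have /choice[p pP] k : exists p : 'rV[R]_d * 'rV[R]_(n.+1 + n.+1), K p.1 /\ F p = g k.
  by have [p [Kp _] Fp] := Gg k; exists p.
(* The weight N t_k of the convex combination is absorbed into the vector as a square root. *)
exists D.+1, (fun k => (p k).1), (fun k j => ((Num.sqrt (N * t k))%:C)%C * wv (p k).2 j).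
have xo o : oapp X 1%:M o = \sum_k ((N * t k * ev (p k).1 o)%:C)%C *: rank_one (wv (p k).2).
  have : x = enc (fun o => \sum_k ((t k * ev (p k).1 o)%:C)%C *: rank_one (wv (p k).2)).
    rewrite xE; apply/rowP => k; rewrite summxE [RHS]mxE /=.
    case: ifP => kb; rewrite summxE ?Re_sum ?Im_sum; apply: eq_bigr => i _.
      by rewrite mxE -(pP i).2 /F mxE /= kb !mxE !Re_mul !Im_mul /=; ring.
    by rewrite mxE -(pP i).2 /F mxE /= kb !mxE !Im_mul !Re_mul /=; ring.
  move=> /enc_inj/(_ o)/(congr1 (fun M => (N%:C)%C *: M)).
  rewrite scalerA -rmorphM divff ?gt_eqF// scale1r => ->.
  by rewrite scaler_sumr; apply: eq_bigr => k _; rewrite scalerA -rmorphM mulrA.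
have wk k : rank_one (fun j => ((Num.sqrt (N * t k))%:C)%C * wv (p k).2 j) =
    ((N * t k)%:C)%C *: rank_one (wv (p k).2).
  by rewrite rank_oneZ sqr_sqrtr// mulr_ge0// ltW.
split.
- by move=> k; have [] := pP k.
- have /= xN := xo None; rewrite [RHS]xN; apply: eq_bigr => k _.
  by rewrite wk mulr1.
- move=> i; have /= xS := xo (Some i); rewrite [LHS]xS; apply: eq_bigr => k _.
  by rewrite wk scalerA -rmorphM mulrC.
Qed.
End FiniteRep.

Definition herm_part (R : realType) (n : nat) (P : 'M[R[i]]_n) : 'M[R[i]]_n :=
  \matrix_(j, k) ((P j k + Num.conj (P k j)) / 2).

Lemma herm_partE (R : realType) (n : nat) (P : 'M[R[i]]_n) j k :
  Num.conj (herm_part P k j) = herm_part P j k.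
Proof.
by rewrite !mxE rmorphM rmorphD /= conjCK fmorphV rmorph_nat addrC.
Qed.

(** Allows the pencil to be taken Hermitian, so that the operator built from it is selfadjoint. *)
Lemma pairing_herm_part (R : realType) (n : nat) (P A : 'M[R[i]]_n) :
  (forall j k, A k j = Num.conj (A j k)) -> pairing (herm_part P) A = pairing P A.
Proof.
move=> Ah; rewrite /pairing.
have E : \sum_j \sum_k herm_part P j k * A j k =
    (\sum_j \sum_k P j k * A j k + Num.conj (\sum_j \sum_k P j k * A j k)) / 2.
  rewrite [in X in _ + X]exchange_big /= rmorph_sum -big_split mulr_suml.
  apply: eq_bigr => j _; rewrite rmorph_sum -big_split mulr_suml.
  apply: eq_bigr => k _ /=; rewrite !mxE rmorphM /= -Ah.
  by field.
rewrite E; set z := \sum_j _.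
have -> : (z + Num.conj z) / 2 = ((Re z)%:C)%C.
  apply: (mulIf (_ : 2 != 0 :> R[i])); first by rewrite pnatr_eq0.
  rewrite divfK ?pnatr_eq0//; apply: complex_eq.
    rewrite Re_add Re_conj Re_mul /=; ring.
  rewrite Im_add Im_conj Im_mul /=; ring.
by [].
Qed.

(** * From a normal dilation to a finite representation *)

Section FiniteRepWmin.
Variables (R : realType) (H : hilbert R) (n : nat).
Local Notation f := (inner H).
Local Notation fP := (inner_psd H).

(** The inner product of H^n, used as a mere form; H^n is not made into a [hilbert]. *)
Definition pow_form (x y : 'I_n -> H) : R[i] := \sum_j f (x j) (y j).

Lemma pow_psd : psd_form pow_form.
Proof.
split => [c x y z|x y|x].
- rewrite /pow_form mulr_sumr -big_split; apply: eq_bigr => j _ /=.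
  by rewrite -(form_linear fP).
- by rewrite /pow_form rmorph_sum; apply: eq_bigr => j _; exact: (form_herm fP).
- by rewrite sumr_ge0// => j _; exact: (form_pos fP).
Qed.

Lemma pow_qE x : qform pow_form x = \sum_j qform f (x j).
Proof. by rewrite /qform Re_sum. Qed.

(** A Gram matrix is positive semidefinite, hence a sum of rank one matrices. *)
Lemma gram_pairing_ge0 (h : 'I_n -> H) (I : finType) (c : I -> R)
    (P : I -> 'M[R[i]]_n) :
  (forall w, 0 <= \sum_i c i * pairing (P i) (rank_one w)) ->
  0 <= \sum_i c i * pairing (P i) (\matrix_(j, k) f (h k) (h j)).
Proof.
move=> Ppos; set G := \matrix_(j, k) _.
have [||v GE] := @psd_rank_one_sum R n G.
- by move=> j k; rewrite !mxE (form_herm fP).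
- move=> x; suff -> : \sum_j \sum_k Num.conj (x j) * G j k * x k =
      f (\sum_k x k *: h k) (\sum_k x k *: h k) by exact: (form_pos fP).
  rewrite (form_sumr fP); apply: eq_bigr => j _; rewrite (form_suml fP).
  apply: eq_bigr => k _; rewrite mxE (formZl fP) (formZr fP).
  by rewrite [LHS]mulrC.
rewrite GE; under eq_bigr do rewrite pairing_sumr mulr_sumr.
by rewrite exchange_big sumr_ge0// => l _; exact: Ppos.
Qed.

Lemma pow_qbound (I : finType) (a : I -> 'M[R[i]]_n) :
  exists2 C : R, 0 <= C & forall u : I -> 'I_n -> H,
    qform pow_form (fun j => \sum_k \sum_i a i j k *: u i k) <=
    C * \sum_i qform pow_form (u i).
Proof.
pose C := \sum_j n%:R * \sum_(k < n) #|I|%:R * \sum_i nsq (a i j k).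
have C0 : 0 <= C.
  apply: sumr_ge0 => j _; rewrite mulr_ge0 ?ler0n// sumr_ge0// => k _.
  by rewrite mulr_ge0 ?ler0n// sumr_ge0// => i _; exact: nsq_ge0.
exists C => // u; rewrite pow_qE /C mulr_suml; apply: ler_sum => j _.
apply: le_trans (q_sum fP _) _; rewrite card_ord -mulrA ler_wpM2l ?ler0n//.
rewrite mulr_suml; apply: ler_sum => k _.
apply: le_trans (q_sum fP _) _; rewrite -mulrA ler_wpM2l ?ler0n//.
rewrite mulr_suml; apply: ler_sum => i _; rewrite (qZ fP) ler_wpM2l ?nsq_ge0//.
rewrite (bigD1 i)//= pow_qE (bigD1 k)//= -addrA lerDl addr_ge0// sumr_ge0// => ? _.
  exact: (q_ge0 fP).
exact: (q_ge0 pow_psd).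
Qed.

End FiniteRepWmin.

Lemma form_ext (R : realType) (E : lmodType R[i]) (f g : E -> E -> R[i]) :
  psd_form f -> psd_form g -> (forall x, f x x = g x x) -> forall x y, f x y = g x y.
Proof.
move=> fP gP fg.
have qfg x : qform f x = qform g x by rewrite /qform fg.
have ReE x y : Re (f x y) = Re (g x y).
  by have := qfg (x + y); rewrite (qD fP) (qD gP) !qfg; lra.
move=> x y; apply: complex_eq => //.
have := ReE ('i%C *: x) y; rewrite (formZl fP) (formZl gP) !Re_mul /=; lra.
Qed.

Lemma cdot_psd (R : realType) (n : nat) : psd_form (@cdot R n).
Proof.
split => [c x y z|x y|x].
- rewrite /cdot mulr_sumr -big_split; apply: eq_bigr => k _ /=.
  by rewrite !mxE mulrDl mulrA.
- rewrite /cdot rmorph_sum; apply: eq_bigr => k _.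
  by rewrite rmorphM /= conjCK mulrC.
- by rewrite sumr_ge0// => k _; rewrite mul_conj ler0c nsq_ge0.
Qed.

Lemma cdot_deltar (R : realType) (n : nat) (u : 'cV[R[i]]_n) l :
  cdot u (delta_mx l 0) = u l 0.
Proof.
rewrite /cdot (bigD1 l)//= big1 ?addr0 ?mxE ?eqxx ?rmorph1 ?mulr1// => i /negbTE il.
by rewrite mxE il rmorph0 mulr0.
Qed.

Lemma isometry_inner (R : realType) (H : hilbert R) (n : nat) (V : 'cV[R[i]]_n -> H) :
  linear V -> (forall x, inner H (V x) (V x) = cdot x x) ->
  forall x y, inner H (V x) (V y) = cdot x y.
Proof.
move=> VL Viso; have fP := inner_psd H.
apply: (@form_ext _ _ (fun x y => inner H (V x) (V y))) => //; last exact: cdot_psd.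
split => [c x y z|x y|x]; last exact: (form_pos fP).
  by rewrite VL (form_linear fP).
exact: (form_herm fP).
Qed.

Lemma Wmin_finite_rep (R : realType) (d n : nat) (K : set 'rV[R]_d)
    (X : 'I_d -> 'M[R[i]]_n.+1) : K !=set0 -> compact K ->
  Wmin (cplx K) X -> exists m, finite_rep K X m.
Proof.
move=> K0 Kc [H [N [NN NK [V [Vs [VL Viso Vadj XV]]]]]].
have fP := inner_psd H; have gP := pow_psd H n.+1.
have Nsa := real_joint_spectrum_selfadjoint NN NK.
have [Nb _ Ncom] := NN.
have {}Ncom j k x : N j (N k x) = N k (N j x) by have /funeqP/(_ x) := Ncom j k.
have NL j : linear (N j) := ((bounded_opP (N j)).1 (Nb j)).1.
have Nq j : qbounded (inner H) (N j) := ((bounded_opP (N j)).1 (Nb j)).2.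
apply: finite_rep_dual => // P0 P Ppos.
pose g := @pow_form R H n.+1.
pose Nn a : H -> H := oapp N id a.
pose Pn a : 'M[R[i]]_n.+1 := oapp P P0 a.
pose Xn a : 'M[R[i]]_n.+1 := oapp X 1%:M a.
have NnL a : linear (Nn a) by case: a => [i|] //=; exact: NL.
have Nnsa a : adjoint_op (Nn a) (Nn a) by case: a => [i|] //=; exact: Nsa.
have Nncom a i x : Nn a (N i x) = N i (Nn a x) by case: a => [j|] //=; rewrite Ncom.
have NnM a : exists2 M : R, 0 <= M & forall x, qform (inner H) (Nn a x) <= M * qform (inner H) x.
  by case: a => [i|] /=; [exact: Nq|exists 1 => // x; rewrite mul1r].
(* The pencil evaluated at the dilating tuple: the operator matrix of \sum_a P_a (x) N_a, with the
   identity at [None]. *)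
pose L (x : 'I_n.+1 -> H) j := \sum_k \sum_a herm_part (Pn a) j k *: Nn a (x k).
have LL : linear L.
  move=> c x y; apply/funext => j; rewrite /L.
  transitivity (c *: (\sum_k \sum_a herm_part (Pn a) j k *: Nn a (x k)) +
      \sum_k \sum_a herm_part (Pn a) j k *: Nn a (y k)); last by [].
  rewrite scaler_sumr -big_split; apply: eq_bigr => k _.
  rewrite scaler_sumr -big_split; apply: eq_bigr => a _ /=.
  by rewrite NnL scalerDr !scalerA [c * _]mulrC.
have [C C0 Cb] := @pow_qbound R H n.+1 _ (fun a => herm_part (Pn a)).
have Lq : qbounded g L.
  have /choice[M MP] a : exists M : R, 0 <= M /\
      forall x, qform (inner H) (Nn a x) <= M * qform (inner H) x.
    by have [M M0 HM] := NnM a; exists M.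
  exists (C * \sum_a M a) => [|x].
    by rewrite mulr_ge0// sumr_ge0// => a _; exact: (MP a).1.
  apply: le_trans (Cb (fun a k => Nn a (x k))) _.
  rewrite -mulrA ler_wpM2l// mulr_suml; apply: ler_sum => a _.
  rewrite !pow_qE mulr_sumr; apply: ler_sum => j _; exact: (MP a).2.
have Lsa x y : g (L x) y = g x (L y).
  rewrite /g /pow_form.
  transitivity (\sum_j \sum_k \sum_a herm_part (Pn a) j k * inner H (Nn a (x k)) (y j)).
    apply: eq_bigr => j _; rewrite (form_suml fP); apply: eq_bigr => k _.
    by rewrite (form_suml fP); apply: eq_bigr => a _; rewrite (formZl fP).
  rewrite exchange_big; apply: eq_bigr => j _; rewrite (form_sumr fP).
  apply: eq_bigr => k _; rewrite (form_sumr fP); apply: eq_bigr => a _.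
  by rewrite (formZr fP) herm_partE Nnsa.
pose x0 k := V (delta_mx k 0).
have XnE a j k : Xn a j k = inner H (Nn a (x0 k)) (x0 j).
  have XE (A : 'M[R[i]]_n.+1) : A j k = cdot (A *m delta_mx k 0) (delta_mx j 0).
    by rewrite cdot_deltar -colE mxE.
  rewrite XE.
  case: a => [i|] /=.
    by rewrite XV (form_herm (cdot_psd R n.+1)) -Vadj -(form_herm fP).
  by rewrite mul1mx (isometry_inner VL Viso).
have XnH a j k : Xn a k j = Num.conj (Xn a j k).
  by rewrite !XnE Nnsa (form_herm fP).
(* X is the compression of N, so the value of the pencil at X is the form of [L] at the vector with
   components V e_k. *)
have val : Re (g (L x0) x0) = pairing P0 1%:M + \sum_i pairing (P i) (X i).
  rewrite -(big_option (fun a => pairing (Pn a) (Xn a))).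
  under [RHS]eq_bigr => a _ do rewrite -(pairing_herm_part _ (XnH a)).
  rewrite /pairing -Re_sum; congr Re; rewrite exchange_big.
  apply: eq_bigr => j _; rewrite (form_suml fP) exchange_big.
  apply: eq_bigr => k _; rewrite (form_suml fP); apply: eq_bigr => a _.
  by rewrite (formZl fP) XnE.
rewrite -val leNgt; apply/negP => neg.
have [m m0 Am] := approx_null_inf gP LL Lq Lsa neg.
(* N_i acts diagonally and commutes with [L], so the approximate eigenvectors of [L] can be improved
   to joint ones. *)
pose NE i (x : 'I_n.+1 -> H) j := N i (x j).
have NEL i : linear (NE i).
  by move=> c x y; apply/funext => j; exact: NL.
have NEq i : qbounded g (NE i).
  have [M M0 HM] := Nq i; exists M => // x.
  by rewrite !pow_qE mulr_sumr; apply: ler_sum => j _; exact: HM.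
have NEsa i x y : g (NE i x) y = g x (NE i y).
  by apply: eq_bigr => j _; exact: Nsa.
have NEcom i j x : NE i (NE j x) = NE j (NE i x).
  by apply/funext => k; exact: Ncom.
have LN i x : L (NE i x) = NE i (L x).
  apply/funext => j; rewrite /L /NE (lin_sum (NL i)); apply: eq_bigr => k _.
  rewrite (lin_sum (NL i)); apply: eq_bigr => a _.
  by rewrite (lin_scale (NL i)) Nncom.
have [||l Al] := approx_null_joint gP (enum_uniq 'I_d) NEL NEL NEq NEsa
  (fun _ _ => erefl) NEcom _ _ Am.
- by move=> x; exact: (q_ge0 gP).
- move=> i c; have [M M0 HM] := qbounded_shift gP c (NEq i); exists M => // x.
  suff -> : L (NE i x + c *: x) - (m%:C)%C *: (NE i x + c *: x) =
      NE i (L x - (m%:C)%C *: x) + c *: (L x - (m%:C)%C *: x) by exact: HM.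
  rewrite (lin_add LL) LN (lin_scale LL) (lin_sub (NEL i)) (lin_scale (NEL i)).
  by rewrite scalerBr scalerDr !scalerA [c * _]mulrC opprD addrACA.
have /NK[lam Klam /rowP lamE] : joint_spectrum N (\row_i l i).
  apply: approx_null_joint_spectrum => // e e0.
  have [h h0 ph] := Al _ e0; rewrite big_enum /= in ph.
  have {}ph : \sum_i qform g (NE i h - l i *: h) <= e * qform g h.
    by apply: le_trans ph; rewrite lerDr (q_ge0 gP).
  (* If no component of [h] were an approximate eigenvector in H, summing the reverse estimates over
     the components would contradict [ph]. *)
  apply: contrapT => noh; move: ph; apply/negP; rewrite -ltNge.
  have comp k : e * qform (inner H) (h k) <= \sum_i qform (inner H) (N i (h k) - l i *: h k).
    have [hk|] := ltP 0 (qform (inner H) (h k)).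
      by rewrite leNgt; apply/negP => hl; apply: noh; exists (h k) => //; exact: ltW.
    move=> hn; have -> : qform (inner H) (h k) = 0.
      by apply/eqP; rewrite eq_le hn (q_ge0 fP).
    by rewrite mulr0 sumr_ge0// => i _; exact: (q_ge0 fP).
  have [k hk] : exists k, 0 < qform (inner H) (h k).
    apply: contrapT => hn; move: h0; rewrite pow_qE big1 ?ltxx// => k _.
    apply/eqP; rewrite eq_le (q_ge0 fP) andbT leNgt; apply/negP => hk.
    by apply: hn; exists k.
  rewrite pow_qE; under [X in _ < X]eq_bigr do rewrite pow_qE.
  rewrite exchange_big mulr_sumr [ltLHS](bigD1 k)//= [ltRHS](bigD1 k)//=.
  apply: ltr_leD; last by apply: ler_sum => j _; exact: comp.
  rewrite ltNge; apply/negP => hl; apply: noh; exists (h k) => //.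
have lE i : l i = ((lam 0 i)%:C)%C by have := lamE i; rewrite !mxE.
pose ln a : R := oapp (lam 0) 1 a.
(* With N_i replaced by lam_i the operator is positive, as lam is in [K]. It almost agrees with [L]
   on [h], which excludes m < 0. *)
pose L0 (x : 'I_n.+1 -> H) j := \sum_k \sum_a herm_part (Pn a) j k *: (((ln a)%:C)%C *: x k).
have L0pos h : 0 <= Re (g (L0 h) h).
  have -> : Re (g (L0 h) h) =
      \sum_a ln a * pairing (Pn a) (\matrix_(j, k) inner H (h k) (h j)).
    under [RHS]eq_bigr => a _.
      rewrite -(pairing_herm_part (Pn a)); last first.
        by move=> j k; rewrite !mxE (form_herm fP).
      rewrite -pairingZr; over.
    rewrite /pairing -Re_sum; congr Re; rewrite exchange_big.
    apply: eq_bigr => j _; rewrite (form_suml fP) exchange_big.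
    apply: eq_bigr => k _; rewrite (form_suml fP); apply: eq_bigr => a _.
    by rewrite !(formZl fP) !mxE.
  apply: gram_pairing_ge0 => w; rewrite big_option /= mul1r.
  exact: Ppos.
have mz : ((m%:C)%C : R[i]) = 0.
  have C2 : 0 <= 2 + 2 * C by lra.
  apply: (approx_null_eq0 gP C2 _ Al) => h; rewrite nsqR big_enum /=.
  set s := \sum_i _.
  have s0 : 0 <= s by rewrite sumr_ge0// => i _; exact: (q_ge0 gP).
  have h1 : qform g (L h - L0 h) <= C * s.
    have -> : L h - L0 h = (fun j => \sum_k \sum_a herm_part (Pn a) j k *:
        (Nn a (h k) - ((ln a)%:C)%C *: h k)).
      apply/funext => j; rewrite -[LHS]/(L h j - L0 h j) /L /L0 -sumrB; apply: eq_bigr => k _.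
      by rewrite -sumrB; apply: eq_bigr => a _; rewrite scalerBr.
    apply: le_trans (Cb (fun a k => Nn a (h k) - ((ln a)%:C)%C *: h k)) _.
    rewrite ler_wpM2l// big_option /= pow_qE big1 ?add0r; last first.
      by move=> j _; rewrite scale1r subrr (q0 fP).
    by apply: ler_sum => i _; rewrite -lE.
  (* As [L0] is positive and m < 0, the cross term - 2 m <L0 h, h> is nonnegative. *)
  have h2 : m ^+ 2 * qform g h <= qform g (L0 h - (m%:C)%C *: h).
    rewrite (qB gP) (qZR gP) (formZr gP) conj_realC Re_mul /= mul0r subr0.
    have := q_ge0 gP (L0 h); have := L0pos h.
    have : 0 <= - m * Re (g (L0 h) h) by rewrite mulr_ge0// oppr_ge0 ltW.
    lra.
  have h3 : qform g (L0 h - (m%:C)%C *: h) <=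
      2 * qform g (L h - (m%:C)%C *: h) + 2 * qform g (L h - L0 h).
    have -> : L0 h - (m%:C)%C *: h = (L h - (m%:C)%C *: h) - (L h - L0 h).
      by rewrite opprB [RHS]addrC subrKA.
    exact: (qB_le gP).
  have := q_ge0 gP (L h - (m%:C)%C *: h).
  have : 0 <= C * qform g (L h - (m%:C)%C *: h) by rewrite mulr_ge0// (q_ge0 gP).
  lra.
by move: mz => /(congr1 (@Re R)) /= mz; rewrite mz ltxx in m0.
Qed.

(** * The SD property *)

Section Convexity.
Variables (R : realType) (n : nat) (A : set 'rV[R]_n).
Hypothesis Ac : convex_set A.

Lemma convex_set_conv x y (s : R) : A x -> A y -> 0 <= s <= 1 -> A (s *: x + (1 - s) *: y).
Proof.
move=> Ax Ay /andP[s0 s1].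
by have := Ac (Itv01 s0 s1) (mem_set Ax) (mem_set Ay); rewrite inE.
Qed.

(** Induction over partial sums divided by their total weight, which therefore has to be
    positive. *)
Lemma convex_set_sum (I : finType) (t : I -> R) (x : I -> 'rV[R]_n) :
  (forall i, 0 <= t i) -> \sum_i t i = 1 -> (forall i, A (x i)) ->
  A (\sum_i t i *: x i).
Proof.
move=> t0 t1 Ax.
have H (s : seq I) : 0 < \sum_(i <- s) t i ->
    A ((\sum_(i <- s) t i)^-1 *: \sum_(i <- s) t i *: x i).
  elim: s => [|i s IH]; first by rewrite big_nil ltxx.
  rewrite !big_cons; set T := \sum_(j <- s) t j in IH *.
  have T0 : 0 <= T by rewrite sumr_ge0.
  move=> Tp; have [TE|TN] := eqVneq T 0.
    rewrite TE addr0 in Tp *; rewrite [X in _ + X]big_seq big1 => [|j js].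
      by rewrite addr0 scalerA mulVf ?scale1r ?gt_eqF.
    have /eqP := TE; rewrite psumr_eq0// => /allP/(_ _ js)/eqP ->.
    by rewrite scale0r.
  have T1 : 0 < T by rewrite lt_neqAle eq_sym TN.
  have s01 : 0 <= t i / (t i + T) <= 1.
    by rewrite divr_ge0 ?(ltW Tp)//= ler_pdivrMr// mul1r lerDl.
  have := convex_set_conv (Ax i) (IH T1) s01.
  have -> : 1 - t i / (t i + T) = T / (t i + T) by field; rewrite gt_eqF.
  rewrite scalerA [T / _]mulrC -mulrA divff// mulr1 [t i / _]mulrC -!scalerA -scalerDr.
  exact.
have := H (index_enum I); rewrite t1 invr1 scale1r; apply; exact: ltr01.
Qed.

Hypothesis A0 : A !=set0.
Hypothesis As : A = [set - x | x in A].

Lemma sym_opp x : A x -> A (- x).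
Proof. by move=> Ax; rewrite As; exists x. Qed.

Lemma sym_convex0 : A 0.
Proof.
have [x Ax] := A0; have := @convex_set_conv x (- x) 2^-1 Ax (sym_opp Ax).
have -> : 1 - 2^-1 = 2^-1 :> R by field.
rewrite scalerN subrr; apply; apply/andP; split; lra.
Qed.

(** Symmetry moves the signs into the points, and the missing weight is put on 0. *)
Lemma sym_convex_sum (I : finType) (t : I -> R) (x : I -> 'rV[R]_n) :
  \sum_i `|t i| <= 1 -> (forall i, A (x i)) -> A (\sum_i t i *: x i).
Proof.
move=> t1 Ax.
pose u (a : option I) : R := oapp (fun i => `|t i|) (1 - \sum_i `|t i|) a.
pose y (a : option I) := oapp (fun i => if 0 <= t i then x i else - x i) 0 a.
have -> : \sum_i t i *: x i = \sum_a u a *: y a.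
  rewrite big_option /= scaler0 add0r; apply: eq_bigr => i _.
  case: ifPn => [ti|]; first by rewrite ger0_norm.
  by rewrite -ltNge => ti; rewrite ltr0_norm// scalerN scaleNr opprK.
apply: convex_set_sum.
- by move=> [i|] //=; rewrite subr_ge0.
- by rewrite big_option /= subrK.
- move=> [i|] /=; last exact: sym_convex0.
  by case: ifP => // _; exact: sym_opp.
Qed.

Lemma sym_convex_scale x (s : R) : `|s| <= 1 -> A x -> A (s *: x).
Proof.
move=> s1 Ax; have := @sym_convex_sum 'I_1 (fun=> s) (fun=> x).
by rewrite !big_ord1; apply.
Qed.

End Convexity.

Section ScaleSet.
Variables (R : realType) (n : nat) (A : set 'rV[R]_n) (s : R).

Lemma scale_set_convex : convex_set A -> convex_set (scale_set s A).
Proof.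
move=> Ac x y t; rewrite !inE => -[u Au <-] [v Av <-].
exists (t%:num *: u + (1 - t%:num) *: v).
  by have := Ac u v t (mem_set Au) (mem_set Av); rewrite inE.
by rewrite scalerDr !scalerA ![s * _]mulrC -!scalerA.
Qed.

Lemma scale_set_sym : A = [set - x | x in A] ->
  scale_set s A = [set - x | x in scale_set s A].
Proof.
move=> As; apply/seteqP; split => [_ [u Au <-]|_ [_ [u Au <-] <-]].
  exists (s *: - u); last by rewrite scalerN opprK.
  by exists (- u) => //; exact: sym_opp.
by exists (- u); rewrite ?scalerN//; exact: sym_opp.
Qed.

Lemma scale_set_nonempty : A !=set0 -> scale_set s A !=set0.
Proof. by move=> [x Ax]; exists (s *: x), x. Qed.

Lemma scale_set_compact : compact A -> compact (scale_set s A).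
Proof.
move=> Ac; apply: continuous_compact => //; apply: continuous_subspaceT.
exact: scaler_continuous.
Qed.

End ScaleSet.

Lemma Delta_memP (R : realType) (n : nat) (x : 'rV[R]_n) :
  (forall k, 0 <= x 0 k) -> \sum_k x 0 k <= 1 -> Delta x.
Proof.
move=> x0 x1 A [Ac Ag].
pose t (a : option 'I_n) : R := oapp (x 0) (1 - \sum_k x 0 k) a.
pose y (a : option 'I_n) : 'rV[R]_n := oapp (fun k => delta_mx 0 k) 0 a.
have -> : x = \sum_a t a *: y a.
  by rewrite big_option /= scaler0 add0r [LHS]row_sum_delta.
apply: convex_set_sum => //.
- by move=> [k|] //=; rewrite subr_ge0.
- by rewrite big_option /= subrK.
- by move=> [k|]; apply: Ag; [right; exists k|left].
Qed.

Lemma Wmin_subset (R : realType) (d n : nat) (K L : set 'rV[R]_d)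
    (X : 'I_d -> 'M[R[i]]_n.+1) :
  K `<=` L -> Wmin (cplx K) X -> Wmin (cplx L) X.
Proof.
move=> KL [H [N [NN NK NX]]]; exists H, N; split => // l /NK[x Kx xl].
by exists x => //; exact: KL.
Qed.

Lemma finite_rep_scale (R : realType) (d n m : nat) (K : set 'rV[R]_d) (s : R)
    (X : 'I_d -> 'M[R[i]]_n.+1) :
  finite_rep K X m -> finite_rep (scale_set s K) (fun i => (s%:C)%C *: X i) m.
Proof.
move=> [lam [w [Kl w1 Xw]]]; exists (fun k => s *: lam k), w; split => //.
  by move=> k; exists (lam k).
move=> i; rewrite Xw scaler_sumr; apply: eq_bigr => k _.
by rewrite scalerA -rmorphM mxE.
Qed.

Lemma tagnat_sum (V : nmodType) (d : nat) (p_ : 'I_d -> nat)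
    (F : 'I_(\sum_j p_ j)%N -> V) :
  \sum_q F q = \sum_j \sum_(k < p_ j) F (tagnat.Rank j k).
Proof.
rewrite (reindex tagnat.rank); last first.
  by apply: onW_bij; exact: tagnat.rank_bij.
rewrite (@sig_big_dep _ _ _ _ _ xpredT (fun _ => xpredT) (fun j k => F (tagnat.Rank j k))) /=.
by apply: eq_bigr => p _; rewrite tagnat.rankE.
Qed.

Lemma state_rank_one_ge0 (R : realType) (n : nat) (psi : {scalar 'M[R[i]]_n.+1})
    (w : 'I_n.+1 -> R[i]) : state psi -> 0 <= psi (rank_one w).
Proof.
move=> [pos _].
pose C : 'M[R[i]]_n.+1 := \matrix_(i, k) (if i == 0 then Num.conj (w k) else 0).
suff -> : rank_one w = (map_mx Num.conj C)^T *m C by exact: pos.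
apply/matrixP => j k; rewrite !mxE (bigD1 0)//= !mxE eqxx conjCK big1 ?addr0//.
by move=> i /negbTE i0; rewrite !mxE i0 mulr0.
Qed.

Lemma SD_finite_rep (R : realType) (d : nat) (a : 'I_d -> R) (n_ : 'I_d -> nat)
    (L : forall j, set 'rV[R]_(n_ j)) (n m : nat)
    (X : 'I_(\sum_j n_ j) -> 'M[R[i]]_n.+1) :
  SD_tuple a -> (0 < m)%N ->
  (forall j, L j !=set0) -> (forall j, convex_set (L j)) ->
  (forall j, L j = [set - x | x in L j]) ->
  (forall j, finite_rep (L j) (fun k => X (tagnat.Rank j k)) m) ->
  Wmin (cplx (prod_set (fun j => scale_set (a j) (L j)))) X.
Proof.
move=> [a0 SDa] m0 L0 Lc Ls LX0.
(* The type of lam j depends on [j], hence a dependent choice through [cid]. *)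
pose lam j := sval (cid (LX0 j)); pose w j := sval (cid (svalP (cid (LX0 j)))).
have LX j : [/\ forall k, L j (lam j k), \sum_k rank_one (w j k) = 1%:M &
    forall i, X (tagnat.Rank j i) = \sum_k ((lam j k 0 i)%:C)%C *: rank_one (w j k)].
  exact: svalP (cid (svalP (cid (LX0 j)))).
have w1 j : \sum_k rank_one (w j k) = 1%:M by case: (LX j).
pose p_ (_ : 'I_d) := m.
pose A (q : 'I_(\sum_j p_ j)) : 'M[R[i]]_n.+1 :=
  rank_one (w (tagnat.sig1 q) (tagnat.sig2 q)).
have AR j k : A (@tagnat.Rank _ p_ j k) = rank_one (w j k).
  rewrite /A; have -> : tagnat.sig2 (@tagnat.Rank _ p_ j k) = k :> 'I_m.
    by apply: val_inj; rewrite tagnat.Rank2K.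
  by rewrite tagnat.Rank1K.
(* On each block the values of a state are nonnegative and add up to psi 1 = 1, so they form a point
   of the simplex. *)
have AD : Wmax (cplx (prod_set (fun _ : 'I_d => @Delta R m))) A.
  move=> _ [psi psiS <-].
  have psi0 v : 0 <= psi (rank_one v) by exact: state_rank_one_ge0.
  exists (\row_q Re (psi (A q))).
    move=> j; have xE k : (submxrow (\row_q Re (psi (A q))) j : 'rV_m) 0 k =
        Re (psi (rank_one (w j k))).
      by rewrite !mxE -AR.
    apply: Delta_memP => [k|]; first by rewrite xE ge0_Re.
    rewrite (eq_bigr _ (fun k _ => xE k)).
    by rewrite -Re_sum -linear_sum (w1 j) psiS.2 /=.
  by apply/rowP => q; rewrite !mxE; apply/esym/ge0_realE; exact: psi0.
have /Wmin_linear AW := SDa m m0 n A AD.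
(* The block diagonal matrix of the combinations N^j = \sum_k lam^j_k M^j_k. *)
pose c : 'M[R]_(\sum_j n_ j, \sum_j p_ j) := \matrix_(p, q)
  ((tagnat.sig1 q == tag (tagnat.sig p))%:R *
   lam (tag (tagnat.sig p)) (tagnat.sig2 q) 0 (tagged (tagnat.sig p))).
have cR j k (q : 'I_(\sum_j p_ j)) : c (tagnat.Rank j k) q =
    (tagnat.sig1 q == j)%:R * lam j (tagnat.sig2 q) 0 k.
  by rewrite mxE /tagnat.Rank tagnat.rankK.
have cRR j k j' k' : c (tagnat.Rank j k) (@tagnat.Rank _ p_ j' k') =
    (j' == j)%:R * lam j k' 0 k.
  rewrite cR; have -> : tagnat.sig2 (@tagnat.Rank _ p_ j' k') = k' :> 'I_m.
    by apply: val_inj; rewrite tagnat.Rank2K.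
  by rewrite tagnat.Rank1K.
(* [G] is general so that one reduction to the j-th block serves for matrices as well as for points
   of the spectrum. *)
have csum (V : nmodType) (G : R -> 'I_(\sum_j p_ j) -> V) j k : (forall q, G 0 q = 0) ->
    \sum_q G (c (tagnat.Rank j k) q) q =
    \sum_k' G (lam j k' 0 k) (@tagnat.Rank _ p_ j k').
  move=> G0; rewrite tagnat_sum (bigD1 j)//= [X in _ + X]big1 ?addr0.
    by apply: eq_bigr => k' _; rewrite cRR eqxx mul1r.
  by move=> j' /negbTE jj; rewrite big1// => k' _; rewrite cRR jj mul0r G0.
have := AW _ c.
have -> : (fun p => \sum_q ((c p q)%:C)%C *: A q) = X.
  apply/funext => p; rewrite -(tagnat.sigK p); case: (tagnat.sig p) => j k.
  rewrite -/(tagnat.Rank k) (csum _ (fun r q => (r%:C)%C *: A q)) => [|q].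
    by have [_ _ ->] := LX j; apply: eq_bigr => k' _; rewrite AR.
  by rewrite scale0r.
apply: Wmin_subset => _ [x xD <-] j.
have [t /= t1 tx] := xD j.
(* The j-th block of the spectral point is a_j t with t in the l^1 ball, and such coefficients keep
   the combination in L_j. *)
exists (\sum_k t 0 k *: lam j k); last first.
  apply/rowP => k.
  transitivity (\sum_q c (tagnat.Rank j k) q * x 0 q); last by rewrite !mxE.
  rewrite (csum _ (fun r q => r * x 0 q)) => [|q]; last by rewrite mul0r.
  rewrite mxE summxE mulr_sumr; apply: eq_bigr => k' _.
  have /rowP/(_ k') := tx; rewrite !mxE => <-.
  by rewrite mulrA [RHS]mulrC.
by apply: sym_convex_sum => // k; case: (LX j).
Qed.

(** * The constant theta *)

Section Quadratic.
Variables (R : realType) (n : nat).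
Implicit Types (w : 'I_n -> R[i]) (A B : 'M[R[i]]_n).

(** The quadratic form <A w, w>. *)
Definition quad A w : R[i] := \sum_j \sum_k A j k * (w k * Num.conj (w j)).

Lemma quad_linear w : scalar (quad^~ w).
Proof.
move=> c A B; rewrite /quad mulr_sumr -big_split; apply: eq_bigr => j _.
rewrite mulr_sumr -big_split; apply: eq_bigr => k _ /=.
by rewrite !mxE mulrDl -mulrA.
Qed.

Lemma quadD A B w : quad (A + B) w = quad A w + quad B w.
Proof. by have := quad_linear w 1 A B; rewrite scale1r mul1r. Qed.
Lemma quadZ c A w : quad (c *: A) w = c * quad A w.
Proof.
have q0 : quad 0 w = 0.
  by rewrite /quad big1// => j _; rewrite big1// => k _; rewrite mxE mul0r.
by have := quad_linear w c A 0; rewrite q0 !addr0.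
Qed.
Lemma quadN A w : quad (- A) w = - quad A w.
Proof. by rewrite -scaleN1r quadZ mulN1r. Qed.
Lemma quad_sum I (r : seq I) (P : pred I) (F : I -> 'M[R[i]]_n) w :
  quad (\sum_(i <- r | P i) F i) w = \sum_(i <- r | P i) quad (F i) w.
Proof.
have q0 : quad 0 w = 0 by have := quadZ 0 0 w; rewrite scale0r mul0r.
by rewrite (big_morph (quad^~ w) (fun A B => quadD A B w) q0).
Qed.
Lemma quad1 w : quad 1%:M w = ((\sum_j nsq (w j))%:C)%C.
Proof.
rewrite /quad rmorph_sum; apply: eq_bigr => j _; rewrite (bigD1 j)//= mxE eqxx mul1r.
rewrite big1 ?addr0 ?mul_conj// => k /negbTE kj.
by rewrite mxE eq_sym kj mul0r.
Qed.
Lemma quad_conj_tr A w : quad (\matrix_(j, k) Num.conj (A k j)) w = Num.conj (quad A w).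
Proof.
rewrite /quad rmorph_sum exchange_big; apply: eq_bigr => j _ /=.
rewrite rmorph_sum; apply: eq_bigr => k _ /=.
by rewrite mxE !rmorphM /= conjCK [w j * _]mulrC.
Qed.

Lemma quad_real_herm A : (forall w, Im (quad A w) = 0) -> forall j k, A k j = Num.conj (A j k).
Proof.
move=> Ar; have /matrixP E : A - \matrix_(j, k) Num.conj (A k j) = 0.
  apply: quadratic_eq0 => w; rewrite -/(quad _ w) quadD quadN quad_conj_tr.
  by apply: complex_eq; rewrite ?Re_add ?Im_add ?Re_opp ?Im_opp ?Re_conj ?Im_conj ?Ar /=; lra.
by move=> j k; have := E k j; rewrite !mxE => /subr0_eq.
Qed.

Lemma quad_psd_rank_one_sum A : (forall w, 0 <= quad A w) ->
  exists v : 'I_n -> 'I_n -> R[i], A = \sum_l rank_one (v l).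
Proof.
move=> Apos; apply: psd_rank_one_sum => [|x].
  by apply: quad_real_herm => w; have := Apos w; rewrite lecE => /andP[/eqP ->].
suff -> : \sum_j \sum_k Num.conj (x j) * A j k * x k = quad A x by [].
by apply: eq_bigr => j _; apply: eq_bigr => k _; rewrite mulrAC mulrC [x k * _]mulrC.
Qed.

End Quadratic.

(** The vector state of w / |w| is evaluated on X; for w = 0 any point of [K] will do. *)
Lemma Wmax_quad (R : realType) (d n : nat) (K : set 'rV[R]_d)
    (X : 'I_d -> 'M[R[i]]_n.+1) w : K !=set0 -> Wmax (cplx K) X ->
  exists2 x, K x & forall i, quad (X i) w = (((\sum_j nsq (w j)) * x 0 i)%:C)%C.
Proof.
move=> [x0 Kx0] XK.
have [s0|sN] := eqVneq (\sum_j nsq (w j)) 0.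
  exists x0 => // i; rewrite s0 mul0r /quad big1// => j _.
  by rewrite big1// => k _; rewrite !(nsq_sum_eq0 s0) mul0r mulr0.
set s := \sum_j nsq (w j) in sN.
have sp : 0 < s by rewrite lt_neqAle eq_sym sN sumr_ge0// => j _; exact: nsq_ge0.
pose r : R[i] := (((Num.sqrt s)^-1)%:C)%C.
have r2 : r * r = ((s^-1)%:C)%C by rewrite -rmorphM -invfM -expr2 sqr_sqrtr// ltW.
pose v j := r * w j.
have vE A : quad A v = ((s^-1)%:C)%C * quad A w.
  rewrite /quad mulr_sumr; apply: eq_bigr => j _; rewrite mulr_sumr.
  apply: eq_bigr => k _; rewrite /v rmorphM /= conj_realC.
  by rewrite -r2; ring.
pose psi' := GRing.isLinear.Build _ _ _ _ (fun A => quad A v) (quad_linear v).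
pose psi : {scalar 'M[R[i]]_n.+1} := HB.pack (fun A => quad A v) psi'.
have psiS : state psi.
  split => [A|]; last first.
    by rewrite /= vE quad1 -/s -rmorphM mulVf.
  change (0 <= quad ((map_mx Num.conj A)^T *m A) v).
  have -> : quad ((map_mx Num.conj A)^T *m A) v =
      \sum_i (\sum_k A i k * v k) * Num.conj (\sum_k A i k * v k).
    rewrite /quad.
    transitivity (\sum_j \sum_k \sum_i (A i k * v k) * Num.conj (A i j * v j)).
      apply: eq_bigr => j _; apply: eq_bigr => k _; rewrite mxE mulr_suml.
      apply: eq_bigr => i _; rewrite !mxE (rmorphM _ (A i j)) /=.
      by rewrite [Num.conj _ * A i k]mulrC mulrACA.
    under eq_bigr do rewrite exchange_big.
    rewrite exchange_big; apply: eq_bigr => i _ /=.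
    rewrite rmorph_sum mulr_sumr; apply: eq_bigr => j _.
    by rewrite mulr_suml.
  by rewrite sumr_ge0// => i _; rewrite mul_conj ler0c nsq_ge0.
have [x Kx /rowP xE] := XK _ (ex_intro2 _ _ psi psiS erefl).
exists x => // i.
have := xE i; rewrite !mxE => /esym; change (psi (X i)) with (quad (X i) v).
by rewrite vE => E; rewrite rmorphM /= -E mulrA -rmorphM divff// mul1r.
Qed.

Lemma pairing_bound (R : realType) (n : nat) (P : 'M[R[i]]_n) :
  exists2 b : R, 0 <= b &
    forall w, `|pairing P (rank_one w)| <= b * \sum_j nsq (w j).
Proof.
exists (\sum_j \sum_k Num.sqrt (nsq (P j k))).
  by rewrite sumr_ge0// => j _; rewrite sumr_ge0// => k _; rewrite sqrtr_ge0.
move=> w; set s := \sum_j nsq (w j).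
have s0 : 0 <= s by rewrite sumr_ge0// => j _; exact: nsq_ge0.
have ws j : nsq (w j) <= s.
  by rewrite /s (bigD1 j)//= lerDl sumr_ge0// => k _; exact: nsq_ge0.
rewrite /pairing Re_sum mulr_suml; apply: le_trans (ler_norm_sum _ _ _) _.
apply: ler_sum => j _; rewrite Re_sum mulr_suml; apply: le_trans (ler_norm_sum _ _ _) _.
apply: ler_sum => k _; rewrite mxE.
rewrite -ler_sqr ?nnegrE ?mulr_ge0 ?sqrtr_ge0// real_normK ?num_real//.
rewrite exprMn sqr_sqrtr ?nsq_ge0//.
apply: (@le_trans _ _ (nsq (P j k * (w j * Num.conj (w k))))).
  by rewrite /nsq lerDl sqr_ge0.
rewrite !nsqM nsq_conj ler_wpM2l ?nsq_ge0// expr2.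
by apply: ler_pM; rewrite ?nsq_ge0.
Qed.

Lemma compact_coord_bound (R : realType) (d : nat) (K : set 'rV[R]_d) : compact K ->
  exists2 b : R, 0 < b & forall x i, K x -> `|x 0 i| <= b.
Proof.
move=> /compact_bounded/ex_strict_bound_gt0[b b0 Kb]; exists b => // x i Kx.
apply: le_trans (ltW (Kb _ Kx)); rewrite [leRHS]/Num.Def.normr /= mx_normrE.
exact: (@le_bigmax _ _ _ _ (fun ij : 'I_1 * 'I_d => `|x ij.1 ij.2|) (0, i)).
Qed.

(** Rows from [K] of maximal rank; [K] may lie in a proper subspace, so they replace a basis of
    R^d. *)
Lemma row_generators (R : realType) (d : nat) (K : set 'rV[R]_d) :
  exists (r : nat) (E : 'M[R]_(r, d)),
    (forall k, K (row k E)) /\ forall x, K x -> (x <= E)%MS.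
Proof.
pose Q m := `[< exists (r : nat) (E : 'M[R]_(r, d)),
  (forall k, K (row k E)) /\ \rank E = m >].
have Q0 : exists m, Q m.
  exists 0%N; apply/asboolP; exists 0%N, 0; split; first by case.
  exact: mxrank0.
have Qd m : Q m -> (m <= d)%N by move=> /asboolP[r [E [_ <-]]]; exact: rank_leq_col.
case: (ex_maxnP Q0 Qd) => m /asboolP[r [E [KE Em]]] mmax.
exists r, E; split => // x Kx; apply: contrapT => /negP xE.
have : (\rank (col_mx x E) <= m)%N.
  apply: mmax; apply/asboolP; exists (1 + r)%N, (col_mx x E); split => // k.
  rewrite -(fintype.splitK k); case: (fintype.split k) => l /=.
    rewrite rowKu; suff -> : row l x = x by [].
    by apply/rowP => j; rewrite mxE (ord1 l).
  by rewrite rowKd.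
rewrite leqNgt => /negP; apply; rewrite -Em -addsmxE.
apply: rank_ltmx; rewrite ltmxE addsmxSr /= addsmx_sub.
by rewrite (negbTE xE).
Qed.

(** In coordinates along the rows of [E] the tuple becomes T with |<T_k w, w>| <= M |w|^2, so M +
    T_k and M - T_k are sums of rank one matrices. A pencil positive on C K is applied to them at
    the points C row_k and - C row_k; adding both inequalities bounds the k-th term of the pairing
    from below. *)
Lemma Wmax_finite_rep (R : realType) (d : nat) (K : set 'rV[R]_d) :
  K !=set0 -> compact K -> convex_set K -> K = [set - x | x in K] ->
  exists2 C : R, 0 < C & forall n (X : 'I_d -> 'M[R[i]]_n.+1),
    Wmax (cplx K) X -> exists m, finite_rep (scale_set C K) X m.
Proof.
move=> K0 Kc Kcv Ks.
have [r [E [KE spanE]]] := row_generators K.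
have [b b0 Kb] := compact_coord_bound Kc.
pose phi := pinvmx E.
pose M := 1 + \sum_(k < r) \sum_i b * `|phi i k|.
have M1 : 1 <= M.
  by rewrite lerDl sumr_ge0// => k _; rewrite sumr_ge0// => i _; rewrite mulr_ge0// ltW.
have M0 : 0 < M by apply: lt_le_trans M1.
have phiM x k : K x -> `|\sum_i x 0 i * phi i k| <= M.
  move=> Kx; apply: le_trans (ler_norm_sum _ _ _) _.
  apply: (@le_trans _ _ (\sum_i b * `|phi i k|)).
    by apply: ler_sum => i _; rewrite normrM ler_wpM2r// Kb.
  rewrite /M (bigD1 k)//= addrCA lerDl addr_ge0// sumr_ge0// => l _.
  by rewrite sumr_ge0// => i _; rewrite mulr_ge0// ltW.
(* Each of the r terms costs a fraction M / C = 1 / (r + 1) of the pairing of P0 with 1; r + 1 keeps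
   [C] positive for r = 0. *)
pose C : R := r.+1%:R * M.
have C0 : 0 < C by rewrite mulr_gt0// ltr0n.
exists C => // n X XK.
have Xq w := Wmax_quad w K0 XK.
pose T k := \sum_i ((phi i k)%:C)%C *: X i.
have qT w (x : 'rV[R]_d) k : (forall i, quad (X i) w = (((\sum_j nsq (w j)) * x 0 i)%:C)%C) ->
    quad (T k) w = (((\sum_j nsq (w j)) * \sum_i x 0 i * phi i k)%:C)%C.
  move=> xE; rewrite quad_sum mulr_sumr rmorph_sum; apply: eq_bigr => i _.
  by rewrite quadZ xE -rmorphM; congr ((_)%:C)%C; ring.
(* The numerical values of X lie in [K], hence in the row space of [E], where [E] recovers a point
   from its coordinates; matrices are determined by their quadratic forms. *)
have XE i : X i = \sum_k ((E k i)%:C)%C *: T k.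
  apply/subr0_eq/quadratic_eq0 => w; rewrite -/(quad _ w) quadD quadN quad_sum.
  have [x Kx xE] := Xq w.
  have /(congr1 (fun u : 'rV_d => u 0 i)) := mulmxKpV (spanE x Kx).
  rewrite mxE => xi; apply/eqP; rewrite subr_eq0; apply/eqP.
  rewrite xE -xi mulr_sumr rmorph_sum; apply: eq_bigr => k _.
  rewrite quadZ (qT w x k xE) -rmorphM; congr ((_)%:C)%C.
  by rewrite mxE mulrA mulrC.
have Tq k w : exists2 t : R, quad (T k) w = (((\sum_j nsq (w j)) * t)%:C)%C & `|t| <= M.
  have [x Kx xE] := Xq w; exists (\sum_i x 0 i * phi i k); last exact: phiM.
  exact: qT.
apply: finite_rep_dual.
- exact: scale_set_nonempty.
- exact: scale_set_compact.
move=> P0 P Ppos.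
pose Q k : 'M[R[i]]_n.+1 := \sum_i ((E k i)%:C)%C *: P i.
have pairQ k A : pairing (Q k) A = \sum_i E k i * pairing (P i) A.
  rewrite pairingC pairing_sumr; apply: eq_bigr => i _.
  by rewrite pairingZr pairingC.
have pos (e : R) k : `|e| <= 1 -> 0 <= pairing P0 (M%:C%C *: 1%:M + (e%:C)%C *: T k) +
    e * (C * pairing (Q k) (M%:C%C *: 1%:M + (e%:C)%C *: T k)).
  move=> e1.
  have [|v ->] := @quad_psd_rank_one_sum R n.+1 (M%:C%C *: 1%:M + (e%:C)%C *: T k).
    move=> w; rewrite quadD !quadZ quad1; have [t -> tM] := Tq k w.
    rewrite -!rmorphM -rmorphD ler0c mulrCA [M * _]mulrC -mulrDr.
    rewrite mulr_ge0 ?sumr_ge0// => [j _|]; first exact: nsq_ge0.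
    have : `|e * t| <= M.
      by rewrite normrM -[leRHS]mul1r ler_pM.
    by rewrite ler_norml => /andP[]; lra.
  rewrite !pairing_sumr !mulr_sumr -big_split; apply: sumr_ge0 => l _ /=.
  have KC : scale_set C K (C *: (e *: row k E)).
    by exists (e *: row k E) => //; exact: sym_convex_scale.
  have := Ppos _ (v l) KC.
  suff -> : \sum_i (C *: (e *: row k E)) 0 i * pairing (P i) (rank_one (v l)) =
      e * (C * pairing (Q k) (rank_one (v l))) by [].
  by rewrite pairQ !mulr_sumr; apply: eq_bigr => i _; rewrite !mxE; ring.
have P01 : 0 <= pairing P0 1%:M.
  have [|v ->] := @quad_psd_rank_one_sum R n.+1 1%:M.
    by move=> w; rewrite quad1 ler0c sumr_ge0// => j _; exact: nsq_ge0.
  rewrite pairing_sumr sumr_ge0// => l _.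
  have := Ppos (C *: 0) (v l) _; rewrite big1 ?addr0 => [|i _]; last by rewrite !mxE mulr0 mul0r.
  by apply; exists 0 => //; exact: sym_convex0.
have QT k : - (M / C) * pairing P0 1%:M <= pairing (Q k) (T k).
  have := pos 1 k; have := pos (-1) k; rewrite normrN normr1 lexx => /(_ isT) h1 /(_ isT).
  move: h1; rewrite !pairingDr !pairingZr.
  move=> h1 h2; rewrite -(ler_pM2l C0).
  have -> : C * (- (M / C) * pairing P0 1%:M) = - M * pairing P0 1%:M by field; rewrite gt_eqF.
  lra.
have -> : \sum_i pairing (P i) (X i) = \sum_k pairing (Q k) (T k).
  under [RHS]eq_bigr do rewrite pairQ.
  rewrite exchange_big; apply: eq_bigr => i _; rewrite [in LHS]XE pairing_sumr.
  by apply: eq_bigr => k _; rewrite pairingZr.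
have : \sum_(k < r) - (M / C) * pairing P0 1%:M <= \sum_k pairing (Q k) (T k).
  by apply: ler_sum => k _; exact: QT.
rewrite sumr_const card_ord -mulr_natl.
have -> : M / C = r.+1%:R^-1 by rewrite /C invfM mulrCA divff ?mulr1// gt_eqF.
have : r%:R * (- r.+1%:R^-1 * pairing P0 1%:M) >= - pairing P0 1%:M.
  rewrite mulrA mulrN mulNr lerN2 -[leRHS]mul1r ler_wpM2r// ler_pdivrMr ?ltr0n//.
  by rewrite mul1r ler_nat.
by move=> h1 h2; have := le_trans h1 h2; lra.
Qed.

Section Theta.
Variables (R : realType) (d0 : nat) (a : 'I_d0 -> R).
Hypotheses (d0_gt0 : (0 < d0)%N) (ha : SD_tuple a).
Variables (d : nat) (K : set 'rV[R]_d).
Hypotheses (K0 : K !=set0) (Kc : compact K) (Kcv : convex_set K)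
  (Ks : K = [set - x | x in K]).

(** The SD property is applied to d0 copies of X, and one copy is read off. The factor a_j is
    harmless, since only the finiteness of theta is drawn from this. *)
Lemma finite_rep_Wmin n m (X : 'I_d -> 'M[R[i]]_n.+1) :
  finite_rep K X m -> Wmin (cplx (scale_set (a (Ordinal d0_gt0)) K)) X.
Proof.
move=> XK; set j0 := Ordinal d0_gt0.
pose n_ (_ : 'I_d0) := d.
pose Y (p : 'I_(\sum_j n_ j)) := X (tagnat.sig2 p).
have YR j k : Y (@tagnat.Rank _ n_ j k) = X k.
  by congr X; apply: val_inj; rewrite tagnat.Rank2K.
(* A zero term is added to the representation, because the SD property concerns a positive number of
   vectors. *)
have := @SD_finite_rep R d0 a n_ (fun=> K) n (m + 1) Y ha _ _ _ _ _.
rewrite addn1 => /(_ isT (fun=> K0) (fun=> Kcv) (fun=> Ks)) H.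
have {}H := H _; have {H}: Wmin (cplx (prod_set (fun j : 'I_d0 => scale_set (a j) K))) Y.
  apply: H => j; have -> : (fun k => Y (@tagnat.Rank _ n_ j k)) = X by apply/funext.
  by rewrite -addn1; exact: finite_rep_pad.
pose c : 'M[R]_(d, \sum_j n_ j) := \matrix_(k, q) (q == @tagnat.Rank _ n_ j0 k)%:R.
have cE k q : c k q = (q == @tagnat.Rank _ n_ j0 k)%:R by rewrite mxE.
move=> WY; have := Wmin_linear c WY.
have -> : (fun p => \sum_q ((c p q)%:C)%C *: Y q) = X.
  apply/funext => k; rewrite (bigD1 (@tagnat.Rank _ n_ j0 k))//= cE eqxx scale1r YR.
  by rewrite big1 ?addr0// => q /negbTE qk; rewrite cE qk scale0r.
apply: Wmin_subset => _ [x xK <-].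
have [y Ky yx] := xK j0; exists y => //; rewrite yx; apply/rowP => k.
rewrite mxE [RHS]mxE (bigD1 (@tagnat.Rank _ n_ j0 k))//= cE eqxx mul1r.
by rewrite [X in _ = _ + X]big1 ?addr0// => q /negbTE qk; rewrite cE qk mul0r.
Qed.

End Theta.

Section ThetaAttained.
Variables (R : realType) (d0 : nat) (a : 'I_d0 -> R).
Hypotheses (d0_gt0 : (0 < d0)%N) (ha : SD_tuple a).
Variables (d : nat) (K : set 'rV[R]_d).
Hypotheses (K0 : K !=set0) (Kc : compact K) (Kcv : convex_set K)
  (Ks : K = [set - x | x in K]).

Lemma mscale_memP (C : R) (S : matrix_set R d) n (X : 'I_d -> 'M[R[i]]_n.+1) :
  0 < C -> S n (fun i => ((C^-1)%:C)%C *: X i) -> Defs.mscale C S X.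
Proof.
move=> C0 SX; exists (fun i => ((C^-1)%:C)%C *: X i) => //.
by apply/funext => i; rewrite scalerA -rmorphM divff ?gt_eqF// scale1r.
Qed.

Lemma Wmax_sub_mscale_Wmin :
  exists2 C : R, 0 < C & msubset (Wmax (cplx K)) (Defs.mscale C (Wmin (cplx K))).
Proof.
have [C1 C10 XC] := Wmax_finite_rep K0 Kc Kcv Ks.
set aj := a (Ordinal d0_gt0); have aj0 : 0 < aj by exact: ha.1.
have C0 : 0 < C1 * aj by rewrite mulr_gt0.
exists (C1 * aj) => // n X /XC[m /finite_rep_scale XK].
apply: mscale_memP => //.
have := finite_rep_Wmin d0_gt0 ha _ _ _ (XK (C1 * aj)^-1).
move=> /(_ (scale_set_nonempty _ (scale_set_nonempty _ K0))).
move=> /(_ (@scale_set_convex _ _ _ _ (@scale_set_convex _ _ _ _ Kcv))).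
move=> /(_ (scale_set_sym _ (scale_set_sym _ Ks))).
apply: Wmin_subset => _ [_ [_ [x Kx <-] <-] <-].
rewrite !scalerA -/aj; suff -> : aj * (C1 * aj)^-1 * C1 = 1 by rewrite scale1r.
by field; rewrite !gt_eqF.
Qed.

Lemma theta_fin : exists2 t : R, 0 <= t & theta (cplx K) = (t%:E)%E.
Proof.
have [C C0 KC] := Wmax_sub_mscale_Wmin.
have th0 : (0 <= theta (cplx K))%E.
  by apply: le_ereal_inf_tmp => _ [c [c0 _] <-]; rewrite lee_fin ltW.
have th1 : (theta (cplx K) <= C%:E)%E by apply: ereal_inf_lbound; exists C.
have thf : theta (cplx K) \is a fin_num.
  by rewrite ge0_fin_numE// (le_lt_trans th1)// ltry.
exists (fine (theta (cplx K))); last by rewrite fineK.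
exact: fine_ge0.
Qed.

(** In the dual description the claim is a closed inequality: passing from [t] to an admissible C <
    t + e costs at most e B for a given pencil, and [e] is arbitrary. *)
Lemma Wmax_theta_finite_rep t n (X : 'I_d -> 'M[R[i]]_n.+1) :
  theta (cplx K) = (t%:E)%E -> Wmax (cplx K) X ->
  exists m, finite_rep (scale_set t K) X m.
Proof.
move=> tE XK; apply: finite_rep_dual.
- exact: scale_set_nonempty.
- exact: scale_set_compact.
move=> P0 P Ppos.
have [L L0 KL] := compact_coord_bound Kc.
have /choice[b bP] i : exists b : R, 0 <= b /\
    forall w, `|pairing (P i) (rank_one w)| <= b * \sum_j nsq (w j).
  by have [b b0 Hb] := pairing_bound (P i); exists b.
(* L bounds the coordinates on [K], b_i the pairing with P_i, and the squared norms of the w_k add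
   up to the trace of the identity. *)
pose B := L * (\sum_i b i) * n.+1%:R.
have B0 : 0 <= B.
  by rewrite !mulr_ge0 ?ler0n ?(ltW L0)// sumr_ge0// => i _; exact: (bP i).1.
have key (e : R) : 0 < e ->
    - (e * B) <= pairing P0 1%:M + \sum_i pairing (P i) (X i).
  move=> e0.
  have thf : ereal_inf [set C%:E | C in [set C : R | 0 < C /\
      msubset (Wmax (cplx K)) (Defs.mscale C (Wmin (cplx K)))]] \is a fin_num.
    by rewrite -/(theta _) tE.
  have [_ [C [C0 KC] <-]] := lb_ereal_inf_adherent e0 thf.
  rewrite -/(theta _) tE -EFinD lte_fin => Cte.
  have tC : t <= C.
    by rewrite -lee_fin -tE; apply: ereal_inf_lbound; exists C.
  have [Y YK YX] := KC n X XK.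
  have [m [lam [w [Kl w1 Yw]]]] := Wmin_finite_rep K0 Kc YK.
  have -> : pairing P0 1%:M + \sum_i pairing (P i) (X i) =
      \sum_k (pairing P0 (rank_one (w k)) +
              \sum_i C * lam k 0 i * pairing (P i) (rank_one (w k))).
    rewrite big_split /= -pairing_sumr w1; congr (_ + _).
    rewrite exchange_big; apply: eq_bigr => i _ /=.
    rewrite -YX pairingZr Yw pairing_sumr mulr_sumr; apply: eq_bigr => k _.
    by rewrite pairingZr mulrA.
  have tr : \sum_k \sum_j nsq (w k j) = n.+1%:R.
    transitivity (\sum_k pairing 1%:M (rank_one (w k))).
      by apply: eq_bigr => k _; rewrite pairing1l rank_one_tr.
    by rewrite -pairing_sumr w1 pairing1l mxtrace1 -(rmorph_nat (real_complex R)).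
  apply: (@le_trans _ _ (\sum_k - (e * (L * (\sum_i b i) * \sum_j nsq (w k j))))).
    by rewrite sumrN -!mulr_sumr tr lexx.
  apply: ler_sum => k _; set s := \sum_j nsq _.
  have := Ppos (t *: lam k) (w k) _.
  move=> /(_ (ex_intro2 _ _ (lam k) (Kl k) erefl)) h1.
  have h2 : \sum_i (t *: lam k) 0 i * pairing (P i) (rank_one (w k)) =
     \sum_i C * lam k 0 i * pairing (P i) (rank_one (w k)) -
     (C - t) * \sum_i lam k 0 i * pairing (P i) (rank_one (w k)).
    rewrite mulr_sumr -sumrB; apply: eq_bigr => i _; rewrite mxE; ring.
  have h3 : `|\sum_i lam k 0 i * pairing (P i) (rank_one (w k))| <= L * (\sum_i b i) * s.
    apply: le_trans (ler_norm_sum _ _ _) _.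
    have -> : L * (\sum_i b i) * s = \sum_i L * (b i * s).
      by rewrite -mulrA mulr_suml mulr_sumr.
    apply: ler_sum => i _; rewrite normrM.
    by apply: ler_pM => //; [exact: KL|exact: (bP i).2].
  have h4 : `|(C - t) * \sum_i lam k 0 i * pairing (P i) (rank_one (w k))| <=
      e * (L * (\sum_i b i) * s).
    rewrite normrM; apply: ler_pM => //; rewrite ger0_norm ?subr_ge0//; lra.
  rewrite h2 in h1; move: h4; rewrite ler_norml => /andP[]; lra.
apply/ler_addgt0Pl => e e0.
have B1 : 0 < B + 1 by rewrite ltr_wpDl.
have := key _ (divr_gt0 e0 B1).
have : e / (B + 1) * B <= e by rewrite mulrAC ler_pdivrMr//; nra.
lra.
Qed.

End ThetaAttained.

(** * Products of symmetric convex sets *)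

Section Products.
Variables (R : realType) (d : nat) (a : 'I_d -> R).
Hypotheses (d_gt0 : (0 < d)%N) (ha : SD_tuple a).
Variables (n_ : 'I_d -> nat) (K : forall i, set 'rV[R]_(n_ i)).
Arguments K : clear implicits.
Hypotheses (K0 : forall i, K i !=set0) (Kc : forall i, compact (K i))
  (Kcv : forall i, convex_set (K i)) (Ks : forall i, K i = [set - x | x in K i]).

Lemma finite_rep_common n (L : forall i, set 'rV[R]_(n_ i))
    (X : 'I_(\sum_j n_ j) -> 'M[R[i]]_n.+1) :
  (forall j, L j !=set0) ->
  (forall j, exists m, finite_rep (L j) (fun k => X (tagnat.Rank j k)) m) ->
  exists2 m, (0 < m)%N & forall j, finite_rep (L j) (fun k => X (tagnat.Rank j k)) m.
Proof.
move=> L0 /choice[m mP]; exists (\max_j m j).+1 => // j.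
have mj : (m j <= (\max_j m j).+1)%N by rewrite leqW// leq_bigmax.
by rewrite -(subnKC mj); exact: finite_rep_pad.
Qed.

Lemma Wmax_prod_factor n (X : 'I_(\sum_j n_ j) -> 'M[R[i]]_n.+1) j :
  Wmax (cplx (prod_set K)) X -> Wmax (cplx (K j)) (fun k => X (tagnat.Rank j k)).
Proof.
move=> XK _ [psi psiS <-].
have [x xK /rowP xE] := XK _ (ex_intro2 _ _ psi psiS erefl).
exists (submxrow x j) => //; apply/rowP => k.
by have := xE (tagnat.Rank j k); rewrite !mxE.
Qed.

Lemma Wmax_prod_finite_rep (t : 'I_d -> R) n (X : 'I_(\sum_j n_ j) -> 'M[R[i]]_n.+1) :
  (forall i, theta (cplx (K i)) = ((t i)%:E)%E) -> Wmax (cplx (prod_set K)) X ->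
  exists2 m, (0 < m)%N &
    forall j, finite_rep (scale_set (t j) (K j)) (fun k => X (tagnat.Rank j k)) m.
Proof.
move=> tE XK; apply: finite_rep_common => j; first exact: scale_set_nonempty.
by apply: Wmax_theta_finite_rep (tE j) _ => //; exact: Wmax_prod_factor.
Qed.

(** C^-1 X has finite representations over C^-1 t_j K_j. The SD property costs a factor a_j, and a_j
    t_j / C <= 1 leads back into K_j by convexity and symmetry. *)
Lemma theta_prod_le (t : 'I_d -> R) (C : R) : 0 < C ->
  (forall i, theta (cplx (K i)) = ((t i)%:E)%E) -> (forall i, 0 <= t i) ->
  (forall i, a i * t i <= C) -> (theta (cplx (prod_set K)) <= C%:E)%E.
Proof.
move=> C0 tE t0 atC; apply: ereal_inf_lbound; exists C => //; split => // n X XK.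
have [m m0 Xm] := Wmax_prod_finite_rep tE XK.
apply: mscale_memP => //.
have := @SD_finite_rep R d a n_ (fun j => scale_set C^-1 (scale_set (t j) (K j))) n m
  (fun i => ((C^-1)%:C)%C *: X i) ha m0 _ _ _ (fun j => finite_rep_scale _ (Xm j)).
move=> /(_ (fun j => scale_set_nonempty _ (scale_set_nonempty _ (K0 j)))).
move=> /(_ (fun j => @scale_set_convex _ _ _ _ (@scale_set_convex _ _ _ _ (@Kcv j)))).
move=> /(_ (fun j => scale_set_sym _ (scale_set_sym _ (Ks j)))).
apply: Wmin_subset => x xK j; have [_ [_ [y Ky <-] <-] <-] := xK j.
rewrite !scalerA; apply: sym_convex_scale => //.
have aj : 0 < a j by exact: ha.1.
rewrite ger0_norm; last by rewrite !mulr_ge0 ?invr_ge0 ?(ltW aj) ?(ltW C0).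
by rewrite mulrAC ler_pdivrMr// mul1r.
Qed.

End Products.

Lemma bigmaxe_fin (R : realType) (d : nat) (F : 'I_d -> R) : (0 < d)%N ->
  exists i, \big[maxe/-oo%E]_(i < d) ((F i)%:E)%E = ((F i)%:E)%E.
Proof.
move=> d0.
have [i _ imax] := @arg_maxP _ _ _ (Ordinal d0) xpredT F isT.
exists i; apply/eqP; rewrite eq_le; apply/andP; split.
  by apply: bigmax_le => [|j _]; [exact: leNye|rewrite lee_fin; exact: imax].
exact: (le_bigmax _ (fun j => ((F j)%:E)%E)).
Qed.

Unset Implicit Arguments.

Theorem theorem2p9 (R : realType) (d : nat) (hd : (0 < d)%N)
    (a : 'I_d -> R) (ha : SD_tuple a)
    (n_ : 'I_d -> nat) (K : forall i, set 'rV[R]_(n_ i))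
    (K0 : forall i, K i !=set0) (Kcompact : forall i, compact (K i))
    (Kconvex : forall i, convex_set (K i))
    (Ksym : forall i, K i = [set - x | x in K i]) :
  [/\ msubset (mprod (fun i => Wmin (cplx (K i))))
        (Wmin (cplx (prod_set (fun i => scale_set (a i) (K i))))),
      msubset (Wmax (cplx (prod_set K)))
        (Wmin (cplx (prod_set
          (fun i => scale_set (fine (theta (cplx (K i))) * a i) (K i))))),
      (theta (cplx (prod_set K)) <=
        ereal_inf [set \big[maxe/-oo]_(i < d) ((b i)%:E * theta (cplx (K i)))
                  | b in @SD_tuple R d])%E
    & (ereal_inf [set \big[maxe/-oo]_(i < d) ((b i)%:E * theta (cplx (K i)))
                  | b in @SD_tuple R d] <=
        SD_constant R d * \big[maxe/-oo]_(i < d) theta (cplx (K i)))%E ].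
Proof.
(* Each theta is a real number, so [fine] is faithful in the second inclusion. *)
have /choice[t tP] i : exists t : R, 0 <= t /\ theta (cplx (K i)) = (t%:E)%E.
  by have [t t0 tE] := theta_fin hd ha (K0 i) (@Kcompact i) (@Kconvex i) (Ksym i); exists t.
have t0 i := (tP i).1; have tE i := (tP i).2.
have bmax (b : 'I_d -> R) : \big[maxe/-oo%E]_(i < d) ((b i)%:E * theta (cplx (K i)))%E =
    \big[maxe/-oo%E]_(i < d) ((b i * t i)%:E)%E.
  by apply: eq_bigr => i _; rewrite tE.
split.
- move=> n X XK.
  have [||m m0 Xm] := @finite_rep_common R d n_ n K X => //.
    by move=> j; apply: Wmin_finite_rep => //; exact: XK.
  exact: (SD_finite_rep ha m0).
- move=> n X XK.
  have [m m0 Xm] := Wmax_prod_finite_rep K0 Kcompact tE XK.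
  have := SD_finite_rep ha m0 _ _ _ Xm.
  move=> /(_ (fun j => scale_set_nonempty _ (K0 j))).
  move=> /(_ (fun j => @scale_set_convex _ _ _ _ (@Kconvex j))).
  move=> /(_ (fun j => scale_set_sym _ (Ksym j))).
  apply: Wmin_subset => x xK j; have [_ [y Ky <-] <-] := xK j.
  by exists y => //; rewrite scalerA mulrC tE.
- apply: le_ereal_inf_tmp => _ [b hb <-]; rewrite bmax.
  have [i0 E] := bigmaxe_fin (fun i => b i * t i) hd.
  have bt i : b i * t i <= b i0 * t i0.
    by rewrite -lee_fin -E; exact: (le_bigmax _ (fun i => (b i * t i)%:E)).
  (* The constant in [theta_prod_le] has to be positive while the maximum may be 0, hence the
     additional [e]. *)
  rewrite E; apply/lee_addgt0Pr => e e0; rewrite -EFinD.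
  have b0 : 0 < b i0 by exact: hb.1.
  apply: (theta_prod_le hb K0 Kcompact Kconvex Ksym _ tE t0) => [|i].
    by rewrite ltr_wpDl// mulr_ge0// ltW.
  by apply: le_trans (bt i) _; rewrite lerDl ltW.
- have -> : \big[maxe/-oo%E]_(i < d) theta (cplx (K i)) =
      \big[maxe/-oo%E]_(i < d) ((t i)%:E)%E by apply: eq_bigr => i _.
  have [i0 E] := bigmaxe_fin t hd; rewrite E.
  have ti i : t i <= t i0.
    by rewrite -lee_fin -E; exact: (le_bigmax _ (fun i => (t i)%:E)).
  (* Division by the maximum is excluded if it is 0. The right side is then 0 whatever [SD_constant]
     is, and the given tuple [a] bounds the infimum by 0. *)
  have [ti0|tN] := eqVneq (t i0) 0.
    rewrite ti0 mule0; apply: ge_ereal_inf; exists (\big[maxe/-oo%E]_(i < d) ((a i)%:E * theta (cplx (K i)))%E).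
      by exists a.
    rewrite bmax; apply: bigmax_le => // i _.
    have -> : t i = 0 by apply/eqP; rewrite eq_le t0 -ti0 ti.
    by rewrite mulr0.
  have tp : 0 < t i0 by rewrite lt_neqAle eq_sym tN t0.
  rewrite -lee_pdivrMr//; apply: le_ereal_inf_tmp => _ [C [C0 SDC] <-].
  rewrite lee_pdivrMr//; apply: ge_ereal_inf.
  exists (\big[maxe/-oo%E]_(i < d) (C%:E * theta (cplx (K i)))%E).
    by exists (fun=> C).
  rewrite (bmax (fun=> C)); apply: bigmax_le => // [|i _]; first exact: leNye.
  by rewrite -EFinM lee_fin ler_wpM2l// ltW.
Qed.
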